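(* Let $\ell\geq 1$ be an integer and, for $j=1,2$, let $a^j\in C^{2+\ell}(\mathbb{R}\times\mathbb{R}^n;\mathbb{R}^{n\times n})$ be symmetric, elliptic, and of the spectral form (S) (these three notions are defined in the context). Let $\{e_1',\ldots,e_n'\}$ be an orthonormal basis of $\mathbb{R}^n$ and let $x_1,\ldots,x_n\in\partial\Omega$ be points such that $$|\nu(x_k)-e_k'|<\frac{1}{\sqrt n},\qquad k=1,\ldots,n .$$ Fix $R>0$ and, for $j=1,2$, $\lambda\in[-R,R]$, $\omega\in\mathbb{S}^{n-1}$ and $\tau\in(-\epsilon_\lambda,\epsilon_\lambda)$, let $u^j_{\lambda,\omega,\tau}\in C^{2+\alpha}(\overline\Omega)$ be the unique solution of $$-\sum_{i,k=1}^n\partial_{x_i}\big(a^j_{i,k}(u,\nabla u)\,\partial_{x_k}u\big)=0\ \text{ in }\Omega,\qquad u(x)=\lambda+\tau\,x\cdot\omega\ \text{ for }x\in\partial\Omega .$$ For each $\lambda\in[-R,R]$ let $\epsilon=\epsilon(\lambda)$ be an arbitrary number in $(0,\epsilon_\lambda)$. If $$\partial_{\nu_{a^1}}u^1_{\lambda,\omega,\tau}(x_k)=\partial_{\nu_{a^2}}u^2_{\lambda,\omega,\tau}(x_k)\qquad\text{for all }\lambda\in[-R,R],\ \omega\in\mathbb{S}^{n-1},\ \tau\in(-\epsilon,\epsilon),\ k=1,\ldots,n,$$ then $$D_\eta^k a^1(\lambda,0)=D_\eta^k a^2(\lambda,0)\qquad\text{for all }\lambda\in[-R,R],\ k=0,\ldots,\ell-1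 .$$
   Context: Let $n\geq2$, $\alpha\in(0,1)$, and let $\Omega\subset\mathbb{R}^n$ be a bounded domain with $C^{2+\alpha}$ boundary; $\nu$ is the outward unit normal to $\partial\Omega$ and $\mathbb{S}^{n-1}=\{x\in\mathbb{R}^n:|x|=1\}$. Variables of a coefficient $a$ are written $(\mu,\eta)\in\mathbb{R}\times\mathbb{R}^n$. A coefficient $a=(a_{i,k})$ is symmetric if $a_{i,k}(\mu,\eta)=a_{k,i}(\mu,\eta)$ for all $(\mu,\eta)$ and $i,k$; it is elliptic if there is $\kappa\in C(\mathbb{R}\times\mathbb{R}^n;(0,+\infty))$ with $\sum_{i,k=1}^n a_{i,k}(\mu,\eta)\xi_i\xi_k\geq\kappa(\mu,\eta)|\xi|^2$ for all $\mu\in\mathbb{R}$, $\eta,\xi\in\mathbb{R}^n$. A coefficient $a\in C^{2+\ell}(\mathbb{R}\times\mathbb{R}^n;\mathbb{R}^{n\times n})$ has the spectral form (S) if there exist positive integers $p,m_1,\ldots,m_p$ with $m_1+\cdots+m_p=n$, functions $\gamma_1,\ldots,\gamma_p\in C^{2+\ell}(\mathbb{R}\times\mathbb{R}^n;(0,+\infty))$ and $U\in C^{2+\ell}(\mathbb{R};\mathbb{R}^{n\times n})$ such that, for all $(\mu,\eta)\in\mathbb{R}\times\mathbb{R}^n$, $U(\mu)^TU(\mu)=U(\mu)U(\mu)^T=\mathrm{Id}$, $0<\gamma_1(\mu,\eta)<\cdots<\gamma_p(\mu,\eta)$, and $a(\mu,\eta)=U(\mu)\,D(\mu,\eta)\,U(\mu)^T$,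 where $D(\mu,\eta)$ is the diagonal matrix whose diagonal consists of $\gamma_1(\mu,\eta)$ repeated $m_1$ times, then $\gamma_2(\mu,\eta)$ repeated $m_2$ times, and so on up to $\gamma_p(\mu,\eta)$ repeated $m_p$ times. The data $p,m_k,\gamma_k,U$ may differ for $a^1$ and $a^2$. For each $\lambda\in\mathbb{R}$, $\epsilon_\lambda>0$ denotes a number, depending only on $a^1,a^2,\lambda,\Omega$, such that for $j=1,2$, all $\omega\in\mathbb{S}^{n-1}$ and all $\tau\in(-\epsilon_\lambda,\epsilon_\lambda)$ the boundary value problem in the claim has a unique solution $u^j_{\lambda,\omega,\tau}\in C^{2+\alpha}(\overline\Omega)$, and such that $\tau\mapsto u^j_{\lambda,\omega,\tau}$ belongs to $C^\ell((-\epsilon_\lambda,\epsilon_\lambda);C^{2+\alpha}(\overline\Omega))$. The flux is $\partial_{\nu_{a^j}}u(x)=\sum_{i,k=1}^n a^j_{i,k}(u(x),\nabla u(x))\,\partial_{x_k}u(x)\,\nu_i(x)$, $x\in\partial\Omega$. $D_\eta^k a(\lambda,0)$ denotes the $k$-th order derivative of $a$ with respect to $\eta$ at $(\lambda,0)$ (with $D^0_\eta a=a$). *)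

(* Defs.v *)
From HB Require Import structures.
From mathcomp Require Import all_boot all_order all_algebra.
From mathcomp Require Import all_classical all_reals all_analysis.

Set Implicit Arguments.
Unset Strict Implicit.
Unset Printing Implicit Defensive.

Import Order.TTheory GRing.Theory Num.Theory.
Import numFieldNormedType.Exports.

Local Open Scope classical_set_scope.
Local Open Scope ring_scope.

(* Points of R^n are row vectors 'rV[R]_n.                                     *)
(* The library norm `|x| on 'rV[R]_n is the sup norm (it only provides the     *)
(* topology here); [enorm] is the Euclidean norm.                              *)

Section Euclidean.
Context {R : realType} {n : nat}.
Implicit Types x y : 'rV[R]_n.

Definition dot x y : R := \sum_(i < n) x 0 i * y 0 i.
Definition enorm x : R := Num.sqrt (dot x x).
Definition sphere : set 'rV[R]_n := [set x | enorm x = 1].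
Definition eball x (r : R) : set 'rV[R]_n := [set y | enorm (y - x) < r].

Definition orthonormal_basis (e : 'I_n -> 'rV[R]_n) : Prop :=
  forall i j, dot (e i) (e j) = (i == j)%:R.

Definition boundary (A : set 'rV[R]_n) : set 'rV[R]_n :=
  closure A `\` interior A.

End Euclidean.

Section Differentiability.
Context {R : realType}.

(* Iterated directional derivatives, along all directions; in finite dimension *)
(* this is the usual class C^k on the whole space.                             *)
Fixpoint Ck {V W : normedModType R} (k : nat) (f : V -> W) : Prop :=
  match k with
  | 0%N => continuous f
  | k'.+1 => [/\ continuous f,
                 forall x v, derivable f x v &
                 forall v, Ck k' (fun x => 'D_v f x)]
  end.

(* D^k f (x) as a k-linear map: D^k f (x)[v_1, ..., v_k]. *)
Definition Dk {V W : normedModType R} (k : nat) (f : V -> W) (x : V)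
    (vs : k.-tuple V) : W :=
  foldr (fun v (g : V -> W) => (fun y => 'D_v g y)) f vs x.

End Differentiability.
Arguments Dk {R V W} k f x vs.

Section HoelderSpaces.
Context {R : realType} {n : nat}.
Implicit Types (A Om : set 'rV[R]_n) (f u : 'rV[R]_n -> R) (al : R).

Definition pd (i : 'I_n) f (x : 'rV[R]_n) : R := 'D_(delta_mx 0 i) f x.
Definition grad f (x : 'rV[R]_n) : 'rV[R]_n := \row_i pd i f x.

Definition sup_norm A f : \bar R := ereal_sup [set (`|f x|)%:E | x in A].

Definition hoelder_seminorm A al f : \bar R :=
  ereal_sup [set (`|f z.1 - f z.2| / enorm (z.1 - z.2) `^ al)%:E
            | z in [set z : 'rV[R]_n * 'rV[R]_n |
                    [/\ A z.1, A z.2 & z.1 != z.2]]].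

Definition has_cont_ext Om f : Prop :=
  exists2 g : 'rV[R]_n -> R,
    {within closure Om, continuous g} & forall x, Om x -> g x = f x.

(* The value at a point of the closure of the continuous extension of f|Om. *)
Definition cont_ext Om f (x : 'rV[R]_n) : R :=
  lim (f y @[y --> within Om (nbhs x)]).

(* C^{2+al}(closure Om), Om open.  Elements are represented by total functions *)
(* of which only the values on closure Om matter.                              *)
Definition C2al Om al u : Prop :=
  [/\ {within closure Om, continuous u},
      forall i x, Om x -> derivable u x (delta_mx 0 i),
      forall i j x, Om x -> derivable (pd i u) x (delta_mx 0 j),
      forall i, has_cont_ext Om (pd i u) &
      forall i j, has_cont_ext Om (pd j (pd i u)) /\
                  (hoelder_seminorm Om al (pd j (pd i u)) < +oo)%E].

Definition C2al_norm Om al u : \bar R :=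
  (sup_norm Om u
   + \sum_(i < n) sup_norm Om (pd i u)
   + \sum_(i < n) \sum_(j < n) sup_norm Om (pd j (pd i u))
   + \sum_(i < n) \sum_(j < n) hoelder_seminorm Om al (pd j (pd i u)))%E.

(* v restricted to (-e, e) belongs to C^l((-e, e); C^{2+al}(closure Om)):      *)
(* w k is the k-th derivative of v, limits being taken in the C^{2+al} norm.   *)
Definition Cl_curve Om al (l : nat) (e : R) (v : R -> 'rV[R]_n -> R) : Prop :=
  exists w : nat -> R -> 'rV[R]_n -> R,
  forall t, - e < t < e ->
  [/\ forall x, closure Om x -> w 0%N t x = v t x,
      forall k, (k <= l)%N -> C2al Om al (w k t),
      forall k, (k < l)%N ->
        C2al_norm Om al
          (fun x => h^-1 * (w k (t + h) x - w k t x) - w k.+1 t x)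
          @[h --> (0 : R)^'] --> 0%E &
      C2al_norm Om al (fun x => w l (t + h) x - w l t x)
          @[h --> (0 : R)] --> 0%E].

End HoelderSpaces.

Section Domains.
Context {R : realType} {n : nat}.
Implicit Types Om : set 'rV[R]_n.

Definition bounded_domain Om : Prop :=
  [/\ Om !=set0, open Om, connected Om & bounded_set Om].

(* Near each boundary point, in suitable orthonormal coordinates y = x Q, Om   *)
(* is the strict epigraph of a C^{2+al} function of the coordinates other than *)
(* y_i.  Asking g to be C^{2+al} globally is no loss: cut off and shrink r.    *)
Definition C2al_boundary Om (al : R) : Prop :=
  forall x0, boundary Om x0 ->
  exists (r : R) (Q : 'M[R]_n) (i : 'I_n) (g : 'rV[R]_n.-1 -> R),
  [/\ 0 < r,
      Q *m Q^T = 1%:M,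
      Ck 2 g,
      forall j k, (hoelder_seminorm setT al (pd k (pd j g)) < +oo)%E &
      Om `&` eball x0 r
      = [set x | g (col' i (x *m Q)) < (x *m Q) 0 i] `&` eball x0 r].

Definition tangent_to (S : set 'rV[R]_n) (x v : 'rV[R]_n) : Prop :=
  exists c : R -> 'rV[R]_n,
  [/\ c 0 = x, \forall t \near (0 : R), S (c t) & is_derive (0 : R) (1 : R) c v].

Definition outward_unit_normal Om (x nu : 'rV[R]_n) : Prop :=
  [/\ sphere nu,
      forall v, tangent_to (boundary Om) x v -> dot nu v = 0 &
      \forall t \near (0 : R)^'+, ~ Om (x + t *: nu) /\ Om (x - t *: nu)].

End Domains.

Section Coefficients.
Context {R : realType} {n : nat}.
Implicit Types a : R * 'rV[R]_n -> 'M[R]_n.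

Definition symmetric_coef a : Prop := forall z i k, a z i k = a z k i.

Definition elliptic_coef a : Prop :=
  exists kappa : R * 'rV[R]_n -> R,
  [/\ continuous kappa, forall z, 0 < kappa z &
      forall z (xi : 'rV[R]_n), kappa z * enorm xi ^+ 2
        <= \sum_(i < n) \sum_(k < n) a z i k * xi 0 i * xi 0 k].

(* gam_1 repeated m_1 times, ..., gam_p repeated m_p times *)
Definition spectral_diag (p : nat) (m : 'I_p -> nat) (gam : 'I_p -> R) : 'M[R]_n :=
  diag_mx (\row_(i < n) nth 0 (flatten [seq nseq (m k) (gam k) | k <- enum 'I_p]) i).

Definition spectral_form (l : nat) a : Prop :=
  exists (p : nat) (m : 'I_p -> nat) (gam : 'I_p -> R * 'rV[R]_n -> R)
         (U : R -> 'M[R]_n),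
  [/\ [/\ (0 < p)%N, forall k, (0 < m k)%N & (\sum_(k < p) m k)%N = n],
      forall k, Ck (2 + l) (gam k) /\ forall z, 0 < gam k z,
      Ck (2 + l) U /\
        forall mu, (U mu)^T *m U mu = 1%:M /\ U mu *m (U mu)^T = 1%:M,
      forall (k k' : 'I_p) z, (k < k')%N -> gam k z < gam k' z &
      forall mu eta, a (mu, eta)
        = U mu *m spectral_diag m (fun k => gam k (mu, eta)) *m (U mu)^T].

Definition admissible_coef (l : nat) a : Prop :=
  [/\ Ck (2 + l) a, symmetric_coef a, elliptic_coef a & spectral_form l a].

Definition D_eta (k : nat) a (mu : R) (eta : 'rV[R]_n) :
    k.-tuple 'rV[R]_n -> 'M[R]_n :=
  Dk k (fun eta' => a (mu, eta')) eta.

End Coefficients.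
Arguments D_eta {R n} k a mu eta _.

Section BoundaryValueProblem.
Context {R : realType} {n : nat}.
Variables (Om : set 'rV[R]_n) (al : R) (a : R * 'rV[R]_n -> 'M[R]_n).
Implicit Types (u : 'rV[R]_n -> R) (om : 'rV[R]_n) (lam tau : R).

Definition solution lam om tau u : Prop :=
  [/\ C2al Om al u,
      forall x, Om x ->
        - \sum_(i < n) pd i
            (fun y => \sum_(k < n) a (u y, grad u y) i k * pd k u y) x = 0 &
      forall x, boundary Om x -> u x = lam + tau * dot x om].

Definition unique_solution lam om tau u : Prop :=
  solution lam om tau u /\
  forall v, solution lam om tau v -> forall x, closure Om x -> v x = u x.

Definition wellposed_radius (l : nat) lam (e : R) : Prop :=
  forall om, sphere om ->
  exists u : R -> 'rV[R]_n -> R,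
    (forall tau, - e < tau < e -> unique_solution lam om tau (u tau)) /\
    Cl_curve Om al l e u.

Definition bgrad u (x : 'rV[R]_n) : 'rV[R]_n := \row_k cont_ext Om (pd k u) x.

Definition conormal_flux (nu : 'rV[R]_n -> 'rV[R]_n) u (x : 'rV[R]_n) : R :=
  \sum_(i < n) \sum_(k < n)
    a (u x, bgrad u x) i k * bgrad u x 0 k * nu x 0 i.

End BoundaryValueProblem.

(* Main.v *)
Require Import Defs.
From HB Require Import structures.
From mathcomp Require Import all_boot all_order all_algebra.
From mathcomp Require Import all_classical all_reals all_analysis.
From mathcomp Require Import ring lra.

Set Implicit Arguments.
Unset Strict Implicit.
Unset Printing Implicit Defensive.

Import Order.TTheory GRing.Theory Num.Theory.
Import numFieldNormedType.Exports.

Local Open Scope classical_set_scope.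
Local Open Scope ring_scope.

(* Put b = a1 - a2.  By induction on k one shows that D_eta^k b(mu, 0) = 0 for
   all mu in [-r, r]; it suffices to treat interior mu = lam.  Expand the
   solutions in tau around the constant solution lam.  The first tau-derivative
   solves a(lam, 0) : D^2 v = 0 with boundary values x.omega, so it is x.omega.
   Since b vanishes to order k in eta for mu near lam, the two equations differ
   by o(tau^(k+1)): the term D_eta^k b(lam, 0)[omega^k] omega is constant in x
   and drops out of the divergence.  Hence the successive tau-derivatives of the
   difference of the solutions, up to order k + 1, solve the homogeneous
   constant-coefficient problem and vanish.  At order k + 1 the equality of the
   fluxes reads D_eta^k b(lam, 0)[omega^k] omega . nu(x_q) = 0 for all q, and the
   nu(x_q) form a basis.  For k = 0 this is b(lam, 0) = 0; then the spectral form
   makes U^T b(lam, eta) U diagonal for all eta, with U = U^1(lam), so that the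
   i-th diagonal entry d_i satisfies D^k d_i[omega^k] (U^T omega)_i = 0.
   Polarization gives D^k d_i = 0. *)

(** * Directional derivatives *)

(** For k > 0 the fluxes only give D_eta^k b(lam, 0)[omega^k] omega = 0, which alone does not
    determine the derivative: |eta|^2 Id - eta eta^T is symmetric and annihilates eta. In a common
    eigenbasis the vector equation splits into one scalar equation per eigenvalue difference, and
    this removes the freedom. The basis is found at eta = 0 and serves every eta because U depends
    on mu alone. Interior lam matters because replacing the solution by lam costs derivatives of b
    in mu, which are small in eta only if b vanishes to order k for all nearby mu. The equation for
    the tau-derivative of order m is obtained as a limit: if the derivatives of lower order agree,
    the difference of the two equations is divided by tau^m. Terms quadratic in the gradient and the
    Hessian leave no trace, since both tend to 0. The terms containing b are o(tau^(k+1)) because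
    the Hessian is o(tau), the first-order term x.omega being linear. Order k consumes k + 1
    derivatives in tau, hence the bound k <= l - 1. *)

Lemma cvg_mulr_dnbhs0 (R : realType) (c : R) : c != 0 ->
  h * c @[h --> (0 : R)^'] --> (0 : R)^'.
Proof.
move=> c0; have c0' : 0 < `|c| by rewrite normr_gt0.
move=> A [e /= e0 He].
exists (e / `|c|); first by rewrite /= divr_gt0.
move=> h /=; rewrite !sub0r !normrN ltr_pdivlMr // => hc h0.
by apply: He; rewrite /= ?mulf_neq0 // sub0r normrN normrM.
Qed.

Section DirectionalDerivatives.
Context {R : realType} {V : normedModType R}.
Implicit Types (f g : V -> R) (x y v w : V).

Lemma is_derive_line f x v (t : R) : derivable f (x + t *: v) v ->
  is_derive t (1 : R) (fun s : R => f (x + s *: v)) ('D_v f (x + t *: v)).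
Proof.
move=> df.
have E : (fun h : R => h^-1 *: (((fun s : R => f (x + s *: v)) \o shift t) (h *: 1)
           - f (x + t *: v))) =
         (fun h => h^-1 *: ((f \o shift (x + t *: v)) (h *: v) - f (x + t *: v))).
  apply/funext => h /=; congr (_ *: (f _ - _)).
  by rewrite [h *: 1]mulr1 scalerDl addrCA.
split; first by rewrite /derivable E.
by rewrite /derive E.
Qed.

Lemma is_derive_line0 f x v df : is_derive x v f df ->
  is_derive (0 : R) (1 : R) (fun s : R => f (x + s *: v)) df.
Proof.
move=> [d1 <-]; have E : x = x + 0 *: v by rewrite scale0r addr0.
by rewrite [in 'D_v f x]E; apply: is_derive_line; rewrite -E.
Qed.

Lemma is_deriveZdir f x v (c : R) : derivable f x v ->
  is_derive x (c *: v) f (c * 'D_v f x).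
Proof.
move=> df; have [->|c0] := eqVneq c 0.
  by rewrite scale0r mul0r; exact: is_derive0.
suff H : h^-1 *: ((f \o shift x) (h *: (c *: v)) - f x) @[h --> 0^'] -->
    c * 'D_v f x.
  by split; [apply/cvg_ex; eexists; exact: H | exact: cvg_lim H].
have E : (fun h : R => h^-1 *: ((f \o shift x) (h *: (c *: v)) - f x)) =
   (fun h => c * ((fun k : R => k^-1 *: ((f \o shift x) (k *: v) - f x)) (h * c))).
  apply/funext => h /=; rewrite scalerA /GRing.scale /= invfM.
  by rewrite !mulrA [c * h^-1 * c^-1]mulrAC divff // mul1r.
rewrite E; apply: cvgMr.
exact: (cvg_comp _ _ (cvg_mulr_dnbhs0 c0) df).
Qed.

Lemma mvt_line f x v :
  (forall t : R, 0 <= t <= 1 -> derivable f (x + t *: v) v) ->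
  exists2 t : R, 0 <= t <= 1 & f (x + v) - f x = 'D_v f (x + t *: v).
Proof.
move=> df.
have [|||t] := @MVT_segment R (fun s : R => f (x + s *: v))
    (fun t => 'D_v f (x + t *: v)) 0 1.
- exact: ler01.
- by move=> t /[!in_itv]/= /andP[t0 t1]; apply/is_derive_line/df; rewrite !ltW.
- apply: derivable_within_continuous => t; rewrite in_itv /= => t01.
  exact: (@ex_derive _ _ _ _ _ _ _ (is_derive_line (df _ t01))).
rewrite in_itv /= => t01; rewrite scale1r scale0r addr0 subr0 mulr1 => E.
by exists t.
Qed.

(** Bounding [t] by [|h|], instead of placing it between 0 and h, treats both signs of h at once, as
    punctured limits at 0 require. *)
Lemma mvt_dir f x v (h : R) :
  (forall t : R, `|t| <= `|h| -> derivable f (x + t *: v) v) ->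
  exists2 t : R, `|t| <= `|h| & f (x + h *: v) - f x = h * 'D_v f (x + t *: v).
Proof.
move=> df.
have le_h (t : R) : 0 <= t <= 1 -> `|t * h| <= `|h|.
  by move=> /andP[t0 t1]; rewrite normrM ger0_norm // ler_piMl.
have [t t01|t t01 ->] := @mvt_line f x (h *: v).
  rewrite scalerA; exact: (@ex_derive _ _ _ _ _ _ _ (is_deriveZdir h (df _ (le_h _ t01)))).
exists (t * h); first exact: le_h.
by rewrite scalerA (@derive_val _ _ _ _ _ _ _ (is_deriveZdir h (df _ (le_h _ t01)))).
Qed.

Lemma near_plane x v w (P : V -> Prop) : (\forall y \near x, P y) ->
  exists2 d : R, 0 < d &
    forall s t : R, `|s| < d -> `|t| < d -> P (x + s *: v + t *: w).
Proof.
move=> /nbhs_ballP[e /= e0 He].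
have N0 : 0 < `|v| + `|w| + 1 by rewrite ltr_wpDl // addr_ge0.
exists (e / (`|v| + `|w| + 1)); first by rewrite divr_gt0.
set d := e / _ => s t sd td; apply: He; rewrite -ball_normE /ball_ /=.
have -> : x - (x + s *: v + t *: w) = - (s *: v + t *: w).
  by rewrite -addrA opprD addNKr.
rewrite normrN; apply: le_lt_trans (ler_normD _ _) _; rewrite !normrZ.
have d0 : 0 < d by rewrite divr_gt0.
apply: (@le_lt_trans _ _ (d * (`|v| + `|w|))).
  by rewrite mulrDr lerD // ler_wpM2r // ltW.
have -> : e = d * (`|v| + `|w| + 1) by rewrite divfK // gt_eqF.
by rewrite ltr_pM2l // ltrDl.
Qed.

(** The increment along v + w is one along v from x followed by one along w from x + h v. The mean
    value theorem turns the second into a value of ['D_w f] near x, so continuity of this derivative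
    at x gives its limit. *)
Lemma is_deriveDdir f x v w :
  (\forall y \near x, derivable f y w) -> {for x, continuous ('D_w f)} ->
  derivable f x v -> is_derive x (v + w) f ('D_v f x + 'D_w f x).
Proof.
move=> dw cw dv.
have H1 : h^-1 *: (f (x + h *: v + h *: w) - f (x + h *: v)) @[h --> 0^'] -->
    'D_w f x.
  apply/cvgrPdist_le => e e0.
  have [d d0 Hd] := near_plane v w (filterI dw ((cvgrPdist_le _ _).1 cw e e0)).
  have n1 : \forall h \near (0 : R)^', h != 0 by exact: withinT.
  have n2 : \forall h \near (0 : R)^', `|h| < d by exact: dnbhs0_lt.
  apply: filterS2 n1 n2 => h h0 hd.
  have [t th|t th ->] := @mvt_dir f (x + h *: v) w h.
    by have [] := Hd h t hd (le_lt_trans th hd).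
  rewrite /GRing.scale /= mulKf //.
  by have [_] := Hd h t hd (le_lt_trans th hd).
suff H : h^-1 *: ((f \o shift x) (h *: (v + w)) - f x) @[h --> 0^'] -->
    'D_v f x + 'D_w f x.
  by split; [apply/cvg_ex; eexists; exact: H | exact: cvg_lim H].
have E : (fun h : R => h^-1 *: ((f \o shift x) (h *: (v + w)) - f x)) =
  (fun h : R => h^-1 *: ((f \o shift x) (h *: v) - f x) +
     h^-1 *: (f (x + h *: v + h *: w) - f (x + h *: v))).
  apply/funext => h /=; rewrite -scalerDr; congr (_ *: _).
  by rewrite (addrC x) [RHS]addrC subrKA scalerDr addrAC.
by rewrite E; exact: (cvgD dv H1).
Qed.

Lemma is_derive_translate f x v c : derivable f (x + c) v ->
  is_derive x v (fun y => f (y + c)) ('D_v f (x + c)).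
Proof.
move=> df.
have E : (fun h : R => h^-1 *: (((fun y => f (y + c)) \o shift x) (h *: v)
           - f (x + c))) =
         (fun h => h^-1 *: ((f \o shift (x + c)) (h *: v) - f (x + c))).
  by apply/funext => h /=; rewrite addrA.
by split; rewrite /derivable /derive E.
Qed.

Lemma second_difference f x v w (h : R) :
  (forall s t : R, `|s| <= `|h| -> `|t| <= `|h| ->
    derivable f (x + s *: v + t *: w) v /\
    derivable ('D_v f) (x + s *: v + t *: w) w) ->
  exists s t : R, [/\ `|s| <= `|h|, `|t| <= `|h| &
    f (x + h *: v + h *: w) - f (x + h *: v) - (f (x + h *: w) - f x)
    = h * (h * 'D_w ('D_v f) (x + s *: v + t *: w))].
Proof.
move=> df.
have dg (s : R) : `|s| <= `|h| ->
    is_derive (x + s *: v) v (fun y => f (y + h *: w) - f y)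
      ('D_v f (x + s *: v + h *: w) - 'D_v f (x + s *: v)).
  move=> sh; apply: is_deriveB.
    by apply: is_derive_translate; have [] := df s h sh (lexx _).
  apply: derivableP; have [] := df s 0 sh _; first by rewrite normr0.
  by rewrite scale0r addr0.
have [s /dg/@ex_derive//|s sh E] :=
  @mvt_dir (fun y => f (y + h *: w) - f y) x v h.
rewrite E (@derive_val _ _ _ _ _ _ _ (dg s sh)).
have [t th|t th ->] := @mvt_dir ('D_v f) (x + s *: v) w h.
  by have [] := df s t sh th.
by exists s, t.
Qed.

(** The second difference is symmetric in v and w, so the two mixed derivatives take a common value
    at two points near x; continuity of both brings the equality to x. *)
Lemma derive_comm f x v w :
  (\forall y \near x, derivable f y v /\ derivable f y w) ->
  (\forall y \near x, derivable ('D_v f) y w /\ derivable ('D_w f) y v) ->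
  {for x, continuous ('D_w ('D_v f))} -> {for x, continuous ('D_v ('D_w f))} ->
  'D_w ('D_v f) x = 'D_v ('D_w f) x.
Proof.
move=> d1 d2 c1 c2; apply/eqP; rewrite -subr_eq0 -normr_le0.
apply/ler_addgt0Pr => e e0; rewrite add0r.
have e20 : 0 < e / 2 by rewrite divr_gt0.
have [d d0 Hd] := near_plane v w (filterI (filterI d1 d2)
  (filterI ((cvgrPdist_le _ _).1 c1 _ e20) ((cvgrPdist_le _ _).1 c2 _ e20))).
pose h := d / 2.
have hd : `|h| < d by rewrite gtr0_norm ?divr_gt0 // ltr_pdivrMr // ltr_pMr // ltr1n.
have h0 : h != 0 by rewrite gt_eqF // divr_gt0.
have [s t sh th|s1 [t1 [sh1 th1 E1]]] := @second_difference f x v w h.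
  by have [[D1 D2] _] := Hd s t (le_lt_trans sh hd) (le_lt_trans th hd);
    exact: conj D1.1 D2.1.
have [s t sh th|t2 [s2 [th2 sh2 E2]]] := @second_difference f x w v h.
  rewrite addrAC.
  by have [[D1 D2] _] := Hd t s (le_lt_trans th hd) (le_lt_trans sh hd);
    exact: conj D1.2 D2.2.
have E : h * (h * 'D_w ('D_v f) (x + s1 *: v + t1 *: w)) =
         h * (h * 'D_v ('D_w f) (x + s2 *: v + t2 *: w)).
  rewrite (addrAC x (s2 *: v)); apply: etrans (esym E1) (etrans _ E2).
  rewrite (addrAC x (h *: v)) !opprB addrACA.
  by rewrite [in RHS]addrACA [X in _ = _ + X]addrC.
move/(mulfI h0)/(mulfI h0) in E.
have [_ [H1 _]] := Hd s1 t1 (le_lt_trans sh1 hd) (le_lt_trans th1 hd).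
have [_ [_ H2]] := Hd s2 t2 (le_lt_trans sh2 hd) (le_lt_trans th2 hd).
rewrite -(subrKA ('D_w ('D_v f) (x + s1 *: v + t1 *: w))) [e]splitr.
apply: le_trans (ler_normD _ _) (lerD H1 _).
by rewrite E distrC.
Qed.

End DirectionalDerivatives.

(** * Functions of class C^k and iterated directional derivatives *)

Section SmoothFunctions.
Context {R : realType} {V : normedModType R}.
Implicit Types (f g : V -> R) (x y v w : V) (us vs : seq V).

Definition Ds vs f : V -> R := foldr (fun v g => fun y => 'D_v g y) f vs.

Lemma Ck_ext k f g : f =1 g -> Ck k f -> Ck k g.
Proof. by move=> /funext ->. Qed.

Lemma Ck_continuous k f : Ck k f -> continuous f.
Proof. by case: k => [|k] // []. Qed.

Lemma Ck_derivable k f x v : Ck k.+1 f -> derivable f x v.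
Proof. by move=> [_ df _]; exact: df. Qed.

Lemma Ck_derive k f v : Ck k.+1 f -> Ck k ('D_v f).
Proof. by move=> [_ _]; exact. Qed.

Lemma CkW k f : Ck k.+1 f -> Ck k f.
Proof.
elim: k f => [|k IH] f; first exact: Ck_continuous.
by move=> [cf df Df]; split=> // v; exact: IH (Df v).
Qed.

Lemma Ck_le j k f : (j <= k)%N -> Ck k f -> Ck j f.
Proof.
by move=> /subnK <-; elim: (k - j)%N => // i IH; rewrite addSn => /CkW.
Qed.

Lemma Ck_cst k (c : R) : Ck k (fun _ : V => c).
Proof.
elim: k c => [|k IH] c /=; first exact: cst_continuous.
split=> [|x v|v]; first exact: cst_continuous.
  exact: derivable_cst.
by apply: Ck_ext (IH 0) => x; rewrite derive_cst.
Qed.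

Lemma CkD k f g : Ck k f -> Ck k g -> Ck k (fun x => f x + g x).
Proof.
elim: k f g => [|k IH] f g /= => [cf cg x|[cf df Df] [cg dg Dg]].
  by apply: cvgD; [exact: cf|exact: cg].
split=> [x|x v|v]; first by apply: cvgD; [exact: cf|exact: cg].
  exact: derivableD.
by apply: Ck_ext (IH _ _ (Df v) (Dg v)) => x; rewrite -deriveD.
Qed.

Lemma CkZ k (c : R) f : Ck k f -> Ck k (fun x => c * f x).
Proof.
elim: k f => [|k IH] f /= => [cf x|[cf df Df]].
  by apply: cvgMr; exact: cf.
split=> [x|x v|v]; first by apply: cvgMr; exact: cf.
  exact: derivableZ.
by apply: Ck_ext (IH _ (Df v)) => x; rewrite -[LHS]deriveZ.
Qed.

Lemma CkB k f g : Ck k f -> Ck k g -> Ck k (fun x => f x - g x).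
Proof.
by move=> cf cg; apply: Ck_ext (CkD cf (CkZ (-1) cg)) => x; rewrite mulN1r.
Qed.

Lemma Ck_sum k (I : Type) (r : seq I) (F : I -> V -> R) :
  (forall i, Ck k (F i)) -> Ck k (fun x => \sum_(i <- r) F i x).
Proof.
move=> cF; elim: r => [|i r IH].
  by apply: Ck_ext (Ck_cst _ 0) => x; rewrite big_nil.
by apply: Ck_ext (CkD (cF i) IH) => x; rewrite big_cons.
Qed.

Lemma Ck_Ds k vs f : Ck (size vs + k) f -> Ck k (Ds vs f).
Proof.
elim: vs k => [|v vs IH] k //= cf; apply: Ck_derive; apply: IH.
by rewrite addnS.
Qed.

Lemma Ds_cat us vs f : Ds (us ++ vs) f = Ds us (Ds vs f).
Proof. by rewrite /Ds foldr_cat. Qed.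

(* [Ck] only asks for directional derivatives; their linearity in the direction
   follows from continuity and the mean value theorem. *)
Lemma derive_dirD f x v w : Ck 1 f -> 'D_(v + w) f x = 'D_v f x + 'D_w f x.
Proof.
move=> cf; apply: (@derive_val _ _ _ _ _ _ _ (is_deriveDdir _ _ _)).
- by apply: nearW => y; exact: Ck_derivable cf.
- exact: Ck_continuous (Ck_derive w cf) x.
- exact: Ck_derivable cf.
Qed.

Lemma derive_dirZ f x (c : R) v : Ck 1 f -> 'D_(c *: v) f x = c * 'D_v f x.
Proof.
move=> cf; apply: (@derive_val _ _ _ _ _ _ _ (is_deriveZdir _ _)).
exact: Ck_derivable cf.
Qed.

Lemma derive_dir_sum f x (I : Type) (r : seq I) (c : I -> R) (v : I -> V) :
  Ck 1 f -> 'D_(\sum_(i <- r) c i *: v i) f x = \sum_(i <- r) c i * 'D_(v i) f x.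
Proof.
move=> cf; elim: r => [|i r IH]; first by rewrite !big_nil derive0.
by rewrite !big_cons derive_dirD // IH derive_dirZ.
Qed.

Lemma derive_swap f v w : Ck 2 f -> 'D_w ('D_v f) = 'D_v ('D_w f).
Proof.
move=> cf; have cv := Ck_derive v cf; have cw := Ck_derive w cf.
apply/funext => x; apply: derive_comm.
- by apply: nearW => y; split; exact: Ck_derivable cf.
- by apply: nearW => y; split; [exact: Ck_derivable cv|exact: Ck_derivable cw].
- exact: Ck_continuous (Ck_derive w cv) x.
- exact: Ck_continuous (Ck_derive v cw) x.
Qed.

Lemma Ds_rot us v vs f : Ck (size us + size vs).+1 f ->
  Ds (us ++ v :: vs) f = Ds (v :: us ++ vs) f.
Proof.
elim: us => [|u us IH] //= cf; rewrite IH; last exact: CkW.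
apply: derive_swap; apply: Ck_Ds; rewrite size_cat addn2.
exact: cf.
Qed.

Lemma Ds_nseq_scale k (c : R) v f : Ck k f ->
  Ds (nseq k (c *: v)) f = fun x => c ^+ k * Ds (nseq k v) f x.
Proof.
elim: k => [|k IH] cf; first by apply/funext => x; rewrite mul1r.
apply/funext => x; rewrite /= -/(Ds _ f) IH; last exact: CkW.
have cD : Ck 1 (Ds (nseq k v) f) by apply: Ck_Ds; rewrite size_nseq addn1.
rewrite -/(Ds _ f) derive_dirZ; last exact: CkZ.
rewrite (deriveZ (c ^+ k)); last exact: Ck_derivable cD.
by rewrite exprS mulrA.
Qed.

Lemma Ds_sum vs (I : Type) (r : seq I) (c : I -> R) (F : I -> V -> R) :
  (forall i, Ck (size vs) (F i)) ->
  Ds vs (fun x => \sum_(i <- r) c i * F i x)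
  = fun x => \sum_(i <- r) c i * Ds vs (F i) x.
Proof.
elim: vs => [|v vs IH] //= cF; rewrite IH; last by move=> i; exact: CkW.
have cD i : Ck 1 (Ds vs (F i)) by apply: Ck_Ds; rewrite addn1.
elim: r {IH} => [|i r IHr]; apply/funext => x.
  rewrite big_nil (_ : (fun x => _) = fun=> 0); first exact: derive_cst.
  by apply/funext => y; rewrite big_nil.
rewrite big_cons -(congr1 (@^~ x) IHr) -[X in _ = X + _]deriveZ; last first.
  exact: Ck_derivable (cD i).
rewrite -deriveD.
- by congr ('D_v _ x); apply/funext => y; rewrite big_cons.
- exact: Ck_derivable (CkZ _ (cD i)).
- by apply: Ck_derivable; apply: Ck_sum => j; exact: CkZ (cD j).
Qed.

End SmoothFunctions.

Lemma Ck_coord (R : realType) (V : normedModType R) k m n (f : V -> 'M[R]_(m, n)) i j :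
  Ck k f -> Ck k (fun x => f x i j).
Proof.
elim: k f => [|k IH] f /= => [cf x|[cf df Df]].
  exact: (continuous_comp (cf x) (@coord_continuous _ _ _ i j _)).
split=> [x|x v|v].
- exact: (continuous_comp (cf x) (@coord_continuous _ _ _ i j _)).
- by have /derivable_mxP := df x v.
by apply: Ck_ext (IH _ (Df v)) => x; rewrite derive_mx // mxE.
Qed.

(** * Asymptotics of coefficient functions *)

Section Asymptotics.
Context {R : realType} {T : Type} {F : set_system T} {FF : Filter F}.
Implicit Types (f g : T -> R).

Lemma cvg0_le f g : (\forall t \near F, `|f t| <= g t) ->
  g t @[t --> F] --> 0 -> f t @[t --> F] --> 0.
Proof.
move=> fg g0; apply/cvgrPdist_le => e e0.
have H : \forall t \near F, `|0 - g t| <= e by exact: (cvgrPdist_le _ _).1 g0 e e0.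
apply: filterS2 fg H => t ft; rewrite !sub0r !normrN => gt.
by apply: le_trans ft _; apply: le_trans (ler_norm _) gt.
Qed.

Lemma cvg_sum_fin (I : Type) (r : seq I) (f : I -> T -> R) (a : I -> R) :
  (forall i, f i t @[t --> F] --> a i) ->
  \sum_(i <- r) f i t @[t --> F] --> \sum_(i <- r) a i.
Proof.
move=> fa; elim: r => [|i r IH].
  rewrite big_nil (_ : (fun t => _) = fun=> 0); first exact: cvg_cst.
  by apply/funext => t; rewrite big_nil.
rewrite big_cons (_ : (fun t => _) = fun t => f i t + \sum_(j <- r) f j t).
  exact: (cvgD (fa i) IH).
by apply/funext => t; rewrite big_cons.
Qed.

Lemma cvg_exp f (a : R) k : f t @[t --> F] --> a -> f t ^+ k @[t --> F] --> a ^+ k.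
Proof.
move=> fa; elim: k => [|k IH]; first exact: cvg_cst.
rewrite exprS (_ : (fun t => _) = fun t => f t * f t ^+ k); first exact: cvgM.
by apply/funext => t; rewrite exprS.
Qed.

Lemma cvg_rV n (p : T -> 'rV[R]_n) (p0 : 'rV[R]_n) :
  (forall i, p t 0 i @[t --> F] --> p0 0 i) -> p t @[t --> F] --> p0.
Proof.
move=> pp; apply/cvgrPdist_le => e e0.
have : \forall t \near F, forall i, `|p0 0 i - p t 0 i| <= e.
  by apply: filter_forall => i; exact: (cvgrPdist_le _ _).1 (pp i) e e0.
apply: filterS => t H; rewrite [leLHS]/Num.Def.normr/= mx_normrE.
by rewrite (bigmax_le _ (ltW e0))//= => -[i j] _; rewrite !mxE /= ord1.
Qed.

End Asymptotics.

Lemma segment_dist_lt (R : realType) (a b c d t : R) : 0 <= t <= 1 ->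
  `|a - b| < d -> `|a - c| < d -> `|a - (b + t * (c - b))| < d.
Proof.
move=> /andP[t0 t1] ab ac.
have -> : a - (b + t * (c - b)) = (1 - t) * (a - b) + t * (a - c) by ring.
apply: le_lt_trans (_ : _ <= Num.max `|a - b| `|a - c|) _; last first.
  by rewrite gt_max ab.
apply: le_trans (ler_normD _ _) _; rewrite !normrM (ger0_norm t0).
rewrite (ger0_norm (_ : 0 <= 1 - t)) ?subr_ge0 //.
set m := Num.max _ _; have -> : m = (1 - t) * m + t * m by ring.
by rewrite lerD // ler_wpM2l ?subr_ge0 // le_max lexx ?orbT.
Qed.

Section CoefficientFunctions.
Context {R : realType} {n : nat}.
Local Notation V := (R * 'rV[R]_n)%type.
Implicit Types (phi : V -> R) (z : V) (p eta : 'rV[R]_n).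

(** The l^1 norm fits estimates that expand a derivative in coordinate directions and bound each
    coordinate separately. *)
Definition l1norm p : R := \sum_i `|p 0 i|.

Definition e_mu : V := (1, 0).
Definition e_eta (i : 'I_n) : V := (0, delta_mx 0 i).

Lemma l1norm_ge0 p : 0 <= l1norm p.
Proof. by apply: sumr_ge0 => i _. Qed.

Lemma l1normZ (c : R) p : l1norm (c *: p) = `|c| * l1norm p.
Proof. by rewrite /l1norm mulr_sumr; apply: eq_bigr => i _; rewrite mxE normrM. Qed.

Lemma ler_l1normD p q : l1norm (p + q) <= l1norm p + l1norm q.
Proof.
by rewrite /l1norm -big_split /=; apply: ler_sum => i _; rewrite mxE ler_normD.
Qed.

Lemma pair_decomp (sg : R) p :
  ((sg, p) : V) = sg *: e_mu + \sum_i p 0 i *: e_eta i.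
Proof.
have -> : \sum_i p 0 i *: e_eta i = (0, p) :> V.
  rewrite [in RHS](row_sum_delta p).
  elim/big_ind2: _ => [|x1 x2 y1 y2 -> ->|i _] //.
    by congr pair; rewrite /= addr0.
  by congr pair; rewrite /= scaler0.
by congr pair; rewrite /= ?scaler0 ?addr0 ?add0r // [sg *: 1]mulr1.
Qed.

Lemma derive_pair phi z (sg : R) p : Ck 1 phi ->
  'D_(sg, p) phi z = sg * 'D_e_mu phi z + \sum_i p 0 i * 'D_(e_eta i) phi z.
Proof.
by move=> cphi; rewrite pair_decomp derive_dirD // derive_dirZ // derive_dir_sum.
Qed.

Lemma ball_pair (mu0 : R) eta0 (d mu : R) eta : 0 < d ->
  `|mu0 - mu| < d -> (forall i, `|eta0 0 i - eta 0 i| < d) ->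
  ball ((mu0, eta0) : V) d (mu, eta).
Proof.
move=> d0 mud etad; split => //=; split=> // i j; rewrite ord1; exact: etad.
Qed.

Lemma ball_pairP (mu0 : R) eta0 (d mu : R) eta :
  ball ((mu0, eta0) : V) d (mu, eta) ->
  `|mu0 - mu| < d /\ forall i, `|eta0 0 i - eta 0 i| < d.
Proof. by move=> [/= ? [_ H]]; split=> // i; exact: H. Qed.

(** On a small ball the derivatives in the coordinate directions exceed their size at z by at most
    1. The ball is convex, so the mean value theorem applies on segments. *)
Lemma l1_lipschitz phi z : Ck 1 phi ->
  exists2 C : R, 0 <= C & exists2 d : R, 0 < d &
  forall (s1 s2 : R) p1 p2, ball z d (s1, p1) -> ball z d (s2, p2) ->
    `|phi (s1, p1) - phi (s2, p2)| <= C * (`|s1 - s2| + l1norm (p1 - p2)).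
Proof.
move=> cphi.
have cD v : continuous ('D_v phi) := Ck_continuous (Ck_derive v cphi).
have H1 : \forall y \near z, `|'D_e_mu phi y| <= `|'D_e_mu phi z| + 1.
  have : \forall y \near z, `|'D_e_mu phi z - 'D_e_mu phi y| <= 1.
    exact: (cvgrPdist_le _ _).1 (cD e_mu z) 1 ltr01.
  apply: filterS => y; rewrite distrC => H.
  by rewrite -lerBlDl; apply: le_trans (lerB_dist _ _) H.
have H2 : \forall y \near z, forall i,
    `|'D_(e_eta i) phi y| <= `|'D_(e_eta i) phi z| + 1.
  apply: (@filter_forall V _
    (fun i y => `|'D_(e_eta i) phi y| <= `|'D_(e_eta i) phi z| + 1) (nbhs z)) => i.
  have : \forall y \near z, `|'D_(e_eta i) phi z - 'D_(e_eta i) phi y| <= 1.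
    exact: (cvgrPdist_le _ _).1 (cD (e_eta i) z) 1 ltr01.
  apply: filterS => y; rewrite distrC => H.
  by rewrite -lerBlDl; apply: le_trans (lerB_dist _ _) H.
have [d /= d0 Hd] := (@nbhs_ballP _ V z _).1 (filterI H1 H2).
pose C := `|'D_e_mu phi z| + 1 + \sum_i (`|'D_(e_eta i) phi z| + 1).
have S0 : 0 <= \sum_i (`|'D_(e_eta i) phi z| + 1) by apply: sumr_ge0 => i _; rewrite addr_ge0.
exists C; first by rewrite /C addr_ge0 // addr_ge0.
exists d => // s1 s2 p1 p2; case: z => [s0 p0] in H1 H2 Hd C S0 *.
move=> /ball_pairP[b1 b1'] /ball_pairP[b2 b2'].
have [t _|t t01 E] := @mvt_line _ _ phi (s2, p2) (s1 - s2, p1 - p2).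
  exact: Ck_derivable cphi.
have -> : (s1, p1) = (s2, p2) + (s1 - s2, p1 - p2) :> V.
  by congr pair; rewrite /= addrC subrK.
rewrite E derive_pair //.
have /Hd[D1 D2] : ball ((s0, p0) : V) d ((s2, p2) + t *: ((s1 - s2, p1 - p2) : V)).
  apply: ball_pair => //=; first exact: segment_dist_lt.
  by move=> i; rewrite !mxE; exact: segment_dist_lt.
apply: le_trans (ler_normD _ _) _.
rewrite mulrDr; apply: lerD.
  rewrite normrM mulrC ler_wpM2r //; apply: le_trans D1 _.
  by rewrite /C lerDl.
apply: le_trans (ler_norm_sum _ _ _) _; rewrite /l1norm mulr_sumr.
apply: ler_sum => i _; rewrite normrM mulrC ler_wpM2r //.
apply: le_trans (D2 i) _; rewrite /C (bigD1 i) //= addrCA lerDl.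
apply: addr_ge0; first exact: addr_ge0.
by apply: sumr_ge0 => j _; exact: addr_ge0.
Qed.

End CoefficientFunctions.

Lemma near_dnbhs_cvg (R : realType) (f g : R -> R) (a l : R) :
  (forall h, h != a -> f h = g h) ->
  g h @[h --> a^'] --> l -> f h @[h --> a^'] --> l.
Proof.
move=> fg; apply: cvg_trans; apply: near_eq_cvg.
have : \forall h \near a^', h != a by exact: withinT.
by apply: filterS => h /fg ->.
Qed.

Section CoefficientAsymptotics.
Context {R : realType} {n : nat}.
Local Notation V := (R * 'rV[R]_n)%type.
Implicit Types (phi : V -> R) (z : V) (p eta : 'rV[R]_n).

Section Filter.
Context {T : Type} {F : set_system T} {FF : Filter F}.
Implicit Types (s q c : T -> R) (P : T -> 'rV[R]_n).

Lemma cvg_pair_rV s P (s0 : R) p0 : s t @[t --> F] --> s0 ->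
  (forall i, P t 0 i @[t --> F] --> p0 0 i) ->
  ((s t, P t) : V) @[t --> F] --> ((s0, p0) : V).
Proof. by move=> ss pp; exact: (cvg_pair ss (@cvg_rV _ _ _ FF _ _ _ pp)). Qed.

Lemma near_pair_ball s P (s0 : R) p0 (d : R) : 0 < d -> s t @[t --> F] --> s0 ->
  (forall i, P t 0 i @[t --> F] --> p0 0 i) ->
  \forall t \near F, ball ((s0, p0) : V) d (s t, P t).
Proof.
move=> d0 ss pp.
have n1 : \forall t \near F, `|s0 - s t| < d by exact: (cvgrPdist_lt _ _).1 ss d d0.
have n2 : \forall t \near F, forall i, `|p0 0 i - P t 0 i| < d.
  by apply: filter_forall => i; exact: (cvgrPdist_lt _ _).1 (pp i) d d0.
by apply: filterS2 n1 n2 => t b1 b2; exact: ball_pair.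
Qed.

Lemma cvg_coefficient phi s P (s0 : R) p0 : continuous phi ->
  s t @[t --> F] --> s0 -> (forall i, P t 0 i @[t --> F] --> p0 0 i) ->
  phi (s t, P t) @[t --> F] --> phi (s0, p0).
Proof.
move=> cphi ss pp.
apply: (@cvg_comp _ _ _ (fun t => ((s t, P t) : V)) phi F (nbhs ((s0, p0) : V))).
  exact: cvg_pair_rV.
exact: cphi.
Qed.

(** The factor c is quantified after t, so that it may be a quotient such as t^-m. *)
Lemma near_increment_le phi s1 s2 P1 P2 (s0 : R) p0 : Ck 1 phi ->
  s1 t @[t --> F] --> s0 -> (forall i, P1 t 0 i @[t --> F] --> p0 0 i) ->
  s2 t @[t --> F] --> s0 -> (forall i, P2 t 0 i @[t --> F] --> p0 0 i) ->
  exists C : R, \forall t \near F, forall c : R,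
    `|c * (phi (s1 t, P1 t) - phi (s2 t, P2 t))|
    <= C * (`|c * (s1 t - s2 t)| + \sum_i `|c * (P1 t 0 i - P2 t 0 i)|).
Proof.
move=> cphi hs1 hP1 hs2 hP2.
have [C C0 [d d0 Hd]] := l1_lipschitz (s0, p0) cphi.
have n1 : \forall t \near F, ball ((s0, p0) : V) d (s1 t, P1 t).
  exact: near_pair_ball.
have n2 : \forall t \near F, ball ((s0, p0) : V) d (s2 t, P2 t).
  exact: near_pair_ball.
exists C; apply: filterS2 n1 n2 => t b1 b2 c.
rewrite normrM; apply: le_trans (ler_wpM2l (normr_ge0 _) (Hd _ _ _ _ b1 b2)) _.
rewrite mulrCA ler_wpM2l // mulrDr normrM lerD2l /l1norm mulr_sumr.
by apply: ler_sum => i _; rewrite !mxE normrM.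
Qed.

(** By the Lipschitz estimate the rescaled increment of phi stays bounded; the factor q makes the
    product tend to 0. *)
Lemma cvg_increment phi s1 s2 P1 P2 (s0 : R) p0 c (sg : R) (pi : 'I_n -> R) q :
  Ck 1 phi ->
  s1 t @[t --> F] --> s0 -> (forall i, P1 t 0 i @[t --> F] --> p0 0 i) ->
  s2 t @[t --> F] --> s0 -> (forall i, P2 t 0 i @[t --> F] --> p0 0 i) ->
  c t * (s1 t - s2 t) @[t --> F] --> sg ->
  (forall i, c t * (P1 t 0 i - P2 t 0 i) @[t --> F] --> pi i) ->
  q t @[t --> F] --> 0 ->
  c t * (phi (s1 t, P1 t) - phi (s2 t, P2 t)) * q t @[t --> F] --> 0.
Proof.
move=> cphi hs1 hP1 hs2 hP2 hs hP hq.
have [C HC] := near_increment_le cphi hs1 hP1 hs2 hP2.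
pose g t := C * (`|c t * (s1 t - s2 t)| + \sum_i `|c t * (P1 t 0 i - P2 t 0 i)|)
  * `|q t|.
apply: (@cvg0_le _ _ _ _ _ g).
  by apply: filterS HC => t Ht; rewrite /g normrM ler_wpM2r.
rewrite /g.
have hsum : `|c t * (s1 t - s2 t)| + \sum_i `|c t * (P1 t 0 i - P2 t 0 i)|
    @[t --> F] --> `|sg| + \sum_i `|pi i|.
  apply: cvgD; first exact: cvg_norm.
  by apply: cvg_sum_fin => i; exact: (cvg_norm (hP i)).
have hqn : `|q t| @[t --> F] --> (0 : R) by rewrite -[X in _ --> X](@normr0 _ R); exact: cvg_norm.
rewrite -[X in _ --> X](mulr0 (C * (`|sg| + \sum_i `|pi i|))).
by apply: cvgM hqn; apply: cvgMr.
Qed.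

(** Discrete product rule: phi_1 q_1 - phi_2 q_2 = phi_1 (q_1 - q_2) + (phi_1 - phi_2) q_2. As q_2
    tends to 0, only the first term survives, with phi frozen at the limit point. *)
Lemma cvg_product_increment phi s1 s2 P1 P2 (s0 : R) p0 c (sg : R)
    (pi : 'I_n -> R) q1 q2 (ka : R) :
  Ck 1 phi ->
  s1 t @[t --> F] --> s0 -> (forall i, P1 t 0 i @[t --> F] --> p0 0 i) ->
  s2 t @[t --> F] --> s0 -> (forall i, P2 t 0 i @[t --> F] --> p0 0 i) ->
  c t * (s1 t - s2 t) @[t --> F] --> sg ->
  (forall i, c t * (P1 t 0 i - P2 t 0 i) @[t --> F] --> pi i) ->
  q2 t @[t --> F] --> 0 -> c t * (q1 t - q2 t) @[t --> F] --> ka ->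
  c t * (phi (s1 t, P1 t) * q1 t - phi (s2 t, P2 t) * q2 t) @[t --> F]
    --> phi (s0, p0) * ka.
Proof.
move=> cphi hs1 hP1 hs2 hP2 hs hP hq2 hq.
have H := cvg_increment cphi hs1 hP1 hs2 hP2 hs hP hq2.
have H1 : phi (s1 t, P1 t) @[t --> F] --> phi (s0, p0).
  by apply: cvg_coefficient => //; exact: Ck_continuous cphi.
rewrite -[X in _ --> X]addr0.
rewrite (_ : (fun t => _) = (fun t => phi (s1 t, P1 t) * (c t * (q1 t - q2 t))
   + c t * (phi (s1 t, P1 t) - phi (s2 t, P2 t)) * q2 t)).
  exact: (cvgD (cvgM H1 hq) H).
by apply/funext => t; ring.
Qed.

End Filter.

(** Chain rule: replacing the arguments of phi by their affine approximations costs o(h) by the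
    Lipschitz estimate, and what remains is a difference quotient of phi along a fixed direction. *)
Lemma is_derive_comp_pair (W : normedModType R) phi (s : W -> R)
    (P : W -> 'rV[R]_n) (x v : W) (ds : R) (dP : 'I_n -> R) :
  Ck 1 phi -> is_derive x v s ds ->
  (forall i, is_derive x v (fun y => P y 0 i) (dP i)) ->
  is_derive x v (fun y => phi (s y, P y)) ('D_(ds, \row_i dP i) phi (s x, P x)).
Proof.
move=> cphi hs hP.
pose D (f : W -> R) (h : R) : R := h^-1 * (f (h *: v + x) - f x).
have cv0 (f : W -> R) df : is_derive x v f df -> D f h @[h --> 0^'] --> df.
  by move=> [+ <-].
have h0 : (h : R) @[h --> (0 : R)^'] --> (0 : R).
  by apply: cvg_within_filter; exact: cvg_id.
have cvx (f : W -> R) df : is_derive x v f df ->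
    f (h *: v + x) @[h --> (0 : R)^'] --> f x.
  move=> /cv0 H.
  suff : f (h *: v + x) @[h --> (0 : R)^'] --> f x + 0 * df by rewrite mul0r addr0.
  apply: (@near_dnbhs_cvg _ _ (fun h => f x + h * D f h)) => [h hn0|].
    by rewrite /D mulVKf // [RHS]addrC subrK.
  by apply: cvgD; [exact: cvg_cst | exact: cvgM].
have cl (a b : R) : a + h * b @[h --> (0 : R)^'] --> a.
  suff : a + h * b @[h --> (0 : R)^'] --> a + 0 * b by rewrite mul0r addr0.
  by apply: cvgD; [exact: cvg_cst | apply: cvgM => //; exact: cvg_cst].
have HD : D (fun y => phi (s y, P y)) h @[h --> (0 : R)^'] -->
    'D_(ds, \row_i dP i) phi (s x, P x); last first.
  by split; [apply/cvg_ex; eexists; exact: HD | exact: cvg_lim HD].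
have L : h^-1 *: ((phi \o shift (s x, P x)) (h *: ((ds, \row_i dP i) : V))
    - phi (s x, P x)) @[h --> (0 : R)^'] --> 'D_(ds, \row_i dP i) phi (s x, P x).
  exact: Ck_derivable cphi.
have cl0 (f : W -> R) df : is_derive x v f df ->
    h^-1 * (f (h *: v + x) - (f x + h * df)) @[h --> (0 : R)^'] --> 0.
  move=> /cv0 H; rewrite -[X in _ --> X](subrr df).
  apply: (@near_dnbhs_cvg _ _ (fun h => D f h - df)) => [h hn0|].
    by rewrite /D opprD addrA mulrBr mulKf.
  by apply: cvgB => //; exact: cvg_cst.
have M : h^-1 * (phi (s (h *: v + x), P (h *: v + x))
      - phi (s x + h * ds, P x + h *: \row_i dP i)) @[h --> (0 : R)^'] --> 0.
  have [|||||C HC] := @near_increment_le _ ((0 : R)^') _ phi (fun h => s (h *: v + x))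
    (fun h => s x + h * ds) (fun h => P (h *: v + x))
    (fun h => P x + h *: \row_i dP i) (s x) (P x) => //.
  - exact: cvx hs.
  - by move=> i; exact: cvx (hP i).
  - by move=> i; under eq_fun do rewrite !mxE; exact: cl.
  pose g h := C * (`|h^-1 * (s (h *: v + x) - (s x + h * ds))| +
    \sum_i `|h^-1 * (P (h *: v + x) 0 i - (P x 0 i + h * dP i))|).
  apply: (@cvg0_le _ _ _ _ _ g).
    apply: filterS HC => h /(_ h^-1) Hh; apply: le_trans Hh _.
    by rewrite /g; under eq_bigr do rewrite !mxE.
  rewrite /g -[X in _ --> X](mulr0 C) -[X in C * X]addr0; apply: cvgMr.
  apply: cvgD; first by rewrite -[X in _ --> X](@normr0 _ R); apply: cvg_norm; exact: cl0 hs.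
  rewrite -[X in _ --> X](@big1_eq _ 0 +%R _ (index_enum 'I_n) xpredT).
  apply: cvg_sum_fin => i; rewrite -[X in _ --> X](@normr0 _ R); apply: cvg_norm.
  exact: cl0 (hP i).
rewrite -[X in _ --> X]add0r.
rewrite (_ : (fun h => _) = fun h => h^-1 * (phi (s (h *: v + x), P (h *: v + x))
      - phi (s x + h * ds, P x + h *: \row_i dP i)) +
   h^-1 *: ((phi \o shift (s x, P x)) (h *: ((ds, \row_i dP i) : V))
    - phi (s x, P x))).
  by apply: cvgD; [exact: M | exact: L].
apply/funext => h; rewrite /D -[X in _ = _ + X]/(_ * _) -mulrDr.
have -> : (phi \o shift (s x, P x)) (h *: ((ds, \row_i dP i) : V)) =
    phi (s x + h * ds, P x + h *: \row_i dP i).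
  by congr phi; congr pair; rewrite /= addrC.
by rewrite subrKA.
Qed.

End CoefficientAsymptotics.

(** Peano's form of Taylor's theorem for a chain in which [f j.+1] is the derivative of [f j]. The
    induction shifts the chain and integrates the asymptotics of [f 1] by the mean value theorem. *)
Lemma peano_limit (R : realType) m (f : nat -> R -> R) (e : R) : 0 < e ->
  (forall j t, (j < m)%N -> `|t| < e -> is_derive t (1 : R) (f j) (f j.+1 t)) ->
  {for 0, continuous (f 0%N)} -> (forall j, (j < m)%N -> f j 0 = 0) ->
  (t ^+ m)^-1 * f 0%N t @[t --> (0 : R)^'] --> (m`!%:R)^-1 * f m 0.
Proof.
move=> e0; case: m => [|m] df cf f0.
  have -> : (0`!%:R)^-1 * f 0%N 0 = f 0%N 0 by rewrite fact0 invr1 mul1r.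
  apply: (@near_dnbhs_cvg _ _ (f 0%N)) => [t _|].
    by rewrite expr0 invr1 mul1r.
  apply: cvg_within_filter; exact: cf.
elim: m => [|m IH] in f df cf f0 *.
  have [d1 d2] : is_derive (0 : R) (1 : R) (f 0%N) (f 1%N 0) by apply: df; rewrite ?normr0.
  have -> : (1`!%:R)^-1 * f 1%N 0 = f 1%N 0 by rewrite factS fact0 invr1 mul1r.
  rewrite -d2; move: d1; rewrite /derivable /derive => d1.
  apply: (@near_dnbhs_cvg _ _ (fun h : R => h^-1 * (f 0%N (h *: 1 + 0) - f 0%N 0)));
    last exact: d1.
  by move=> t _; rewrite addr0 f0 // subr0 expr1 [t *: _]mulr1.
have df1 : is_derive (0 : R) (1 : R) (f 1%N) (f 2%N 0) by apply: df; rewrite ?normr0.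
have := IH (fun j => f j.+1); set L := _ * f m.+2 0 => {}IH.
have {}IH : (t ^+ m.+1)^-1 * f 1%N t @[t --> (0 : R)^'] --> L.
  apply: IH => [j t jm te||j jm]; [exact: df| |exact: f0].
  by apply/differentiable_continuous/derivable1_diffP; exact: (@ex_derive _ _ _ _ _ _ _ df1).
have -> : (m.+2`!%:R)^-1 * f m.+2 0 = L / m.+2%:R.
  by rewrite /L factS natrM invfM; ring.
apply/cvgrPdist_le => d d0.
have n1 : \forall t \near (0 : R)^', `|L - (t ^+ m.+1)^-1 * f 1%N t| <= d.
  exact: (cvgrPdist_le _ _).1 IH d d0.
have [r /= r0 Hr] := n1.
have n2 : \forall t \near (0 : R)^', `|t| < Num.min r e.
  by apply: dnbhs0_lt; rewrite lt_min r0.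
have n3 : \forall t \near (0 : R)^', t != 0 by exact: withinT.
apply: filterS2 n2 n3 => t; rewrite lt_min => /andP[tr te] t0.
(* With the leading term subtracted, the derivative at s is at most d |s|^(m+1), and the mean value
   theorem passes this bound on to g. *)
pose g (t : R) := f 0%N t - L / m.+2%:R * t ^+ m.+2.
have dg s : `|s| <= `|t| -> is_derive s (1 : R) g (f 1%N s - L * s ^+ m.+1).
  move=> st; have d1 : is_derive s (1 : R) (f 0%N) (f 1%N s).
    by apply: df => //; exact: le_lt_trans te.
  have d2 : is_derive s (1 : R) (fun t : R => L / m.+2%:R * t ^+ m.+2) (L * s ^+ m.+1).
    have H := @is_deriveZ _ _ _ _ (L / m.+2%:R) s 1 _
      (@is_deriveX _ _ id m.+2 s (1 : R) 1 (is_derive_id _ _)).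
    rewrite (_ : (fun _ => _) = L / m.+2%:R *: (@id R) ^+ m.+2); last first.
      by apply/funext => u; rewrite scalrfctE exprfctE.
    apply: (is_derive_eq H); rewrite /GRing.scale /= mulr1.
    by rewrite mulrA divfK ?pnatr_eq0.
  exact: is_deriveB.
have bg s : `|s| <= `|t| -> `|f 1%N s - L * s ^+ m.+1| <= d * `|s| ^+ m.+1.
  move=> st; have [->|s0] := eqVneq s 0.
    by rewrite f0 // expr0n /= mulr0 subr0 normr0 expr0n mulr0.
  have := Hr s; rewrite /ball_ /= sub0r normrN => /(_ (le_lt_trans st tr) s0).
  have sm : s ^+ m.+1 != 0 by rewrite expf_neq0.
  rewrite -normrX => H; rewrite -ler_pdivrMr ?normr_gt0 // -normfV -normrM.
  by rewrite mulrBl mulfK // distrC [_ / _]mulrC.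
have [s|s st E] := @mvt_dir _ _ g 0 1 t.
  rewrite add0r [s *: _]mulr1 => st.
  exact: (@ex_derive _ _ _ _ _ _ _ (dg s st)).
move: E; rewrite !add0r [t *: _]mulr1 [s *: _]mulr1 (@derive_val _ _ _ _ _ _ _ (dg s st)).
rewrite {2}/g f0 // expr0n /= mulr0 !subr0 => E.
have tm : t ^+ m.+2 != 0 by rewrite expf_neq0.
have -> : L / m.+2%:R - (t ^+ m.+2)^-1 * f 0%N t = - ((t ^+ m.+2)^-1 * g t).
  by rewrite /g mulrBr opprB [X in _ = X - _]mulrCA mulVf // mulr1.
rewrite normrN E normrM normfV normrX normrM ler_pdivrMl ?exprn_gt0 ?normr_gt0 //.
rewrite [`|t| ^+ _]exprS -[leRHS]mulrA.
apply: ler_wpM2l => //; apply: le_trans (bg s st) _.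
rewrite mulrC; apply: ler_wpM2r; first exact: ltW.
by rewrite lerXn2r ?nnegrE.
Qed.

(** * Coefficients vanishing to order k in eta *)

Section VanishingCoefficients.
Context {R : realType} {n : nat}.
Local Notation V := (R * 'rV[R]_n)%type.
Implicit Types (phi : V -> R) (p eta : 'rV[R]_n) (vs : seq 'rV[R]_n).

Definition Ds_eta vs phi : V -> R := Ds [seq (0, v) : V | v <- vs] phi.

Definition vanishes_at (k : nat) phi (mu : R) : Prop :=
  forall vs, (size vs < k)%N -> Ds_eta vs phi (mu, 0) = 0.

(* For k = 0 the truncated [k.-1] makes this the trivial order. *)
Lemma vanishes_eta k phi (mu : R) i :
  vanishes_at k phi mu -> vanishes_at k.-1 ('D_(e_eta i) phi) mu.
Proof.
case: k => [|k] H vs //= vk.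
have := H (rcons vs (delta_mx 0 i)).
by rewrite size_rcons ltnS /Ds_eta map_rcons -cats1 Ds_cat; exact.
Qed.

(** D_mu commutes with the eta-derivatives, and those of order below k vanish on a whole interval of
    the line eta = 0. This is why vanishing is assumed near [mu0] and not only at it. *)
Lemma vanishes_mu k phi (mu0 : R) : Ck k phi ->
  (\forall mu \near mu0, vanishes_at k phi mu) ->
  \forall mu \near mu0, vanishes_at k ('D_e_mu phi) mu.
Proof.
move=> cphi H; have := near_join H; apply: filterS => mu Hmu vs vk.
have E : Ds_eta vs ('D_e_mu phi) = 'D_e_mu (Ds_eta vs phi).
  rewrite /Ds_eta -[LHS](Ds_cat _ [:: e_mu]).
  by rewrite Ds_rot ?cats0 // size_map addn0; exact: Ck_le cphi.
rewrite E /derive; apply: lim_near_cst => //=.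
have [d /= d0 Hd] := (@nbhs_ballP _ R _ _).1 Hmu.
have : \forall h \near (0 : R)^', `|h| < d by exact: dnbhs0_lt.
apply: filterS => h hd.
have -> : h *: e_mu + (mu, 0) = (mu + h, 0) :> V.
  by congr pair; rewrite /= ?scaler0 ?addr0 // [h *: 1]mulr1 addrC.
rewrite (Hd (mu + h)) //; last first.
  by rewrite /ball /= opprD addNKr normrN.
by rewrite (Hd mu) ?subrr ?scaler0 //; exact: ballxx.
Qed.

(** Taylor's bound, uniform in mu: phi(mu, 0) = 0, so phi(mu, eta) is an eta-derivative at an
    intermediate point applied to eta, and that derivative vanishes to order k - 1. *)
Lemma vanishing_bound k phi (mu0 : R) : Ck k phi ->
  (\forall mu \near mu0, vanishes_at k phi mu) ->
  exists2 C : R, 0 <= C & \forall z \near ((mu0, 0) : V),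
    `|phi z| <= C * l1norm z.2 ^+ k.
Proof.
elim: k phi => [|k IH] phi cphi H.
  exists (`|phi (mu0, 0)| + 1); first exact: addr_ge0.
  have : \forall y \near ((mu0, 0) : V), `|phi (mu0, 0) - phi y| <= 1.
    exact: (cvgrPdist_le _ _).1 (cphi (mu0, 0)) 1 ltr01.
  apply: filterS => y; rewrite distrC expr0 mulr1 => Hy.
  by rewrite -lerBlDl; apply: le_trans (lerB_dist _ _) Hy.
have /choice[C HC] : forall i : 'I_n, exists C : R, 0 <= C /\
    \forall z \near ((mu0, 0) : V), `|'D_(e_eta i) phi z| <= C * l1norm z.2 ^+ k.
  move=> i; have [|C C0 HC] := IH ('D_(e_eta i) phi) (Ck_derive _ cphi).
    by apply: filterS H => mu Hmu; exact: (vanishes_eta i Hmu).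
  by exists C.
exists (\sum_i C i); first by apply: sumr_ge0 => i _; have [] := HC i.
have H1 : \forall z \near ((mu0, 0) : V), forall i,
    `|'D_(e_eta i) phi z| <= C i * l1norm z.2 ^+ k.
  apply: (@filter_forall V _ (fun i z => `|'D_(e_eta i) phi z| <= C i * l1norm z.2 ^+ k)
    (nbhs ((mu0, 0) : V))) => i.
  by have [] := HC i.
have [d1 /= d10 Hd1] := (@nbhs_ballP _ V _ _).1 H1.
have [d2 /= d20 Hd2] := (@nbhs_ballP _ R _ _).1 H.
apply/nbhs_ballP; exists (Num.min d1 d2); first by rewrite /= lt_min d10.
case=> mu eta /ball_pairP[]; rewrite lt_min => /andP[m1 m2] he.
have he1 i : `|eta 0 i| < d1.
  by have := he i; rewrite mxE sub0r normrN lt_min => /andP[].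
have phi0 : phi (mu, 0) = 0 by exact: (Hd2 mu m2 [::]).
have [t _|t /andP[t0 t1]] := @mvt_line _ _ phi (mu, 0) (0, eta).
  exact: Ck_derivable cphi.
have zE (u : R) : ((mu, 0) : V) + u *: ((0, eta) : V) = (mu, u *: eta).
  by congr pair; rewrite /= ?scaler0 ?addr0 ?add0r.
have -> : ((mu, 0) : V) + (0, eta) = (mu, eta).
  by congr pair; rewrite /= ?addr0 ?add0r.
rewrite zE phi0 subr0 => ->; rewrite derive_pair ?mul0r ?add0r; last first.
  by apply: Ck_le cphi.
have b : ball ((mu0, 0) : V) d1 (mu, t *: eta).
  apply: ball_pair => // i; rewrite !mxE sub0r normrN normrM ger0_norm //.
  by apply: le_lt_trans (he1 i); rewrite ler_piMl.
have t1' : l1norm (t *: eta) <= l1norm eta.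
  by rewrite l1normZ ger0_norm // ler_piMl // l1norm_ge0.
apply: le_trans (ler_norm_sum _ _ _) _.
have -> : (\sum_i C i) * l1norm eta ^+ k.+1
    = \sum_i `|eta 0 i| * ((\sum_i C i) * l1norm eta ^+ k).
  by rewrite -mulr_suml exprS mulrCA.
apply: ler_sum => i _; rewrite normrM ler_wpM2l //.
apply: le_trans (Hd1 _ b i) _; have [C0 _] := HC i.
apply: ler_pM => //.
- by rewrite exprn_ge0 // l1norm_ge0.
- rewrite (bigD1 i) //= lerDl.
  by apply: sumr_ge0 => j _; have [] := HC j.
- by rewrite lerXn2r // nnegrE l1norm_ge0.
Qed.

End VanishingCoefficients.

Section SmallCurves.
Context {R : realType} {n : nat}.
Local Notation V := (R * 'rV[R]_n)%type.
Implicit Types (phi : V -> R) (s q : R -> R) (P : R -> 'rV[R]_n).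

Lemma cvg_id_dnbhs0 : (h : R) @[h --> (0 : R)^'] --> (0 : R).
Proof. by apply: cvg_within_filter; exact: cvg_id. Qed.

Lemma cvg0_of_quotient q (a : R) k : t^-1 * q t @[t --> (0 : R)^'] --> a ->
  t ^+ k * q t @[t --> (0 : R)^'] --> 0.
Proof.
move=> H.
suff : t ^+ k * q t @[t --> (0 : R)^'] --> (0 ^+ k * (0 * a) : R).
  by rewrite mul0r mulr0.
apply: (@near_dnbhs_cvg _ _ (fun t => t ^+ k * (t * (t^-1 * q t)))) => [t t0|].
  by rewrite mulVKf.
apply: cvgM; first exact: cvg_exp cvg_id_dnbhs0.
exact: cvgM cvg_id_dnbhs0 H.
Qed.

Section Curve.
Variables (mu0 : R) (om : 'rV[R]_n) (s : R -> R) (P : R -> 'rV[R]_n).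
Hypothesis hs : s t @[t --> (0 : R)^'] --> mu0.
Hypothesis hP : forall i, t^-1 * P t 0 i @[t --> (0 : R)^'] --> om 0 i.

Lemma cvg_curve0 i : P t 0 i @[t --> (0 : R)^'] --> (0 : 'rV[R]_n) 0 i.
Proof.
rewrite mxE; apply: (@near_dnbhs_cvg _ _ (fun t => t ^+ 0 * P t 0 i)).
  by move=> t _; rewrite mul1r.
exact: (@cvg0_of_quotient (fun t => P t 0 i) (om 0 i) 0 (@hP i)).
Qed.

Lemma cvg_l1norm_quotient : l1norm (t^-1 *: P t) @[t --> (0 : R)^'] --> l1norm om.
Proof.
apply: cvg_sum_fin => i; apply: cvg_norm.
by under eq_fun do rewrite mxE; exact: hP.
Qed.

(** Along the curve phi is O(t^k), because [P t] is O(t); with q = o(t^i) the product is o(t^(i+k)),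
    hence o(t^m). *)
Lemma cvg_vanishing_term phi q (C : R) i k m : (m <= i + k)%N ->
  (\forall z \near ((mu0, 0) : V), `|phi z| <= C * l1norm z.2 ^+ k) ->
  (t ^+ i)^-1 * q t @[t --> (0 : R)^'] --> 0 ->
  (t ^+ m)^-1 * (phi (s t, P t) * q t) @[t --> (0 : R)^'] --> 0.
Proof.
move=> mik /(@nbhs_ballP _ V _ _).1[d /= d0 Hd] hq.
have n1 : \forall t \near (0 : R)^', ball ((mu0, 0) : V) d (s t, P t).
  by apply: near_pair_ball => //; exact: cvg_curve0.
have n2 : \forall t \near (0 : R)^', `|t| < 1 by exact: dnbhs0_lt.
have n3 : \forall t \near (0 : R)^', t != 0 by exact: withinT.
pose g t := C * l1norm (t^-1 *: P t) ^+ k * `|(t ^+ i)^-1 * q t|.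
apply: (@cvg0_le _ _ _ _ _ g).
  apply: filterS2 n1 (filterI n2 n3) => t /Hd /= Ht [t1 t0].
  have t0' : 0 < `|t| by rewrite normr_gt0.
  rewrite /g l1normZ normfV exprMn !normrM !normfV !normrX.
  have -> : C * ((`|t|^-1) ^+ k * l1norm (P t) ^+ k) * ((`|t| ^+ i)^-1 * `|q t|)
     = (`|t| ^+ (i + k))^-1 * ((C * l1norm (P t) ^+ k) * `|q t|).
    by rewrite exprD invfM exprVn; ring.
  apply: ler_pM; rewrite ?invr_ge0 ?exprn_ge0 ?mulr_ge0 //.
    rewrite lef_pV2 ?posrE ?exprn_gt0 //.
    by apply: ler_wiXn2l => //; exact: ltW.
  by rewrite ler_wpM2r.
rewrite /g -[X in _ --> X](mulr0 (C * l1norm om ^+ k)).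
apply: cvgM; first by apply: cvgMr; exact: cvg_exp cvg_l1norm_quotient.
by rewrite -[X in _ --> X](@normr0 _ R); exact: cvg_norm.
Qed.

(* The quotient by t^k is o(1) because D_mu phi = O(|eta|^k), D_eta phi =
   O(|eta|^(k-1)), and the arguments differ by (o(1), o(t)). *)
Lemma cvg_frozen_argument phi k : Ck k.+1 phi ->
  (\forall mu \near mu0, vanishes_at k phi mu) ->
  (t ^+ k)^-1 * (phi (s t, P t) - phi (mu0, t *: om)) @[t --> (0 : R)^'] --> 0.
Proof.
move=> cphi van.
have cphik : Ck k phi := CkW cphi.
have [C1 C10 HC1] := vanishing_bound (Ck_derive e_mu cphi) (vanishes_mu cphik van).
have /choice[C2 HC2] : forall i : 'I_n, exists C : R, 0 <= C /\
    \forall z \near ((mu0, 0) : V), `|'D_(e_eta i) phi z| <= C * l1norm z.2 ^+ k.-1.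
  move=> i; have [||C C0 HC] := @vanishing_bound _ _ k.-1 ('D_(e_eta i) phi) mu0.
  - by apply: Ck_le (Ck_derive _ cphi); exact: leq_pred.
  - by apply: filterS van => mu Hmu; exact: (vanishes_eta i Hmu).
  by exists C.
have H1 : \forall z \near ((mu0, 0) : V), forall i,
    `|'D_(e_eta i) phi z| <= C2 i * l1norm z.2 ^+ k.-1.
  apply: (@filter_forall V _
    (fun i z => `|'D_(e_eta i) phi z| <= C2 i * l1norm z.2 ^+ k.-1)
    (nbhs ((mu0, 0) : V))) => i.
  by have [] := HC2 i.
have [d /= d0 Hd] := (@nbhs_ballP _ V _ _).1 (filterI HC1 H1).
have n1 : \forall t \near (0 : R)^', ball ((mu0, 0) : V) d (s t, P t).
  by apply: near_pair_ball => //; exact: cvg_curve0.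
have n2 : \forall t \near (0 : R)^', ball ((mu0, 0) : V) d (mu0, t *: om).
  apply: near_pair_ball => //; first exact: cvg_cst.
  move=> i; rewrite mxE -[X in _ --> X](mul0r (om 0 i)).
  under eq_fun do rewrite mxE.
  by apply: cvgM; [exact: cvg_id_dnbhs0 | exact: cvg_cst].
have n3 : \forall t \near (0 : R)^', `|t| < 1 by exact: dnbhs0_lt.
have n4 : \forall t \near (0 : R)^', t != 0 by exact: withinT.
(* Every point z on the segment joining the two arguments satisfies |z.2| <= |t| N(t), and N(t)
   converges. *)
pose N t := l1norm (t^-1 *: P t) + l1norm om.
pose g t := C1 * N t ^+ k * `|s t - mu0| +
  \sum_i (C2 i * N t ^+ k.-1) * `|t^-1 * P t 0 i - om 0 i|.
apply: (@cvg0_le _ _ _ _ _ g).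
  apply: filterS2 (filterI n1 n2) (filterI n3 n4) => t [b1 b2] [t1 t0].
  have t0' : 0 < `|t| by rewrite normr_gt0.
  have N0 : 0 <= N t by rewrite addr_ge0 // l1norm_ge0.
  pose v : V := (s t - mu0, P t - t *: om).
  have [u _|u /andP[u0 u1]] := @mvt_line _ _ phi (mu0, t *: om) v.
    exact: Ck_derivable cphi.
  have -> : ((mu0, t *: om) : V) + v = (s t, P t).
    by congr pair; rewrite /= addrC subrK.
  have zE : ((mu0, t *: om) : V) + u *: v =
    (mu0 + u * (s t - mu0), t *: om + u *: (P t - t *: om)) by [].
  rewrite zE => ->; rewrite derive_pair; last exact: Ck_le cphi.
  set z : V := (_, _).
  have /Hd[/= D1 D2] : ball ((mu0, 0) : V) d z.
    have [a1 a2] := ball_pairP b1; have [a3 a4] := ball_pairP b2.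
    apply: ball_pair => //; first by apply: segment_dist_lt; rewrite ?u0.
    by move=> i; rewrite !mxE; have := a2 i; have := a4 i; rewrite !mxE => ? ?;
       apply: segment_dist_lt; rewrite ?u0.
  have zN : l1norm z.2 <= `|t| * N t.
    have -> : z.2 = u *: P t + (1 - u) *: (t *: om).
      by rewrite /z /= scalerBr scalerBl scale1r addrCA.
    apply: le_trans (ler_l1normD _ _) _; rewrite /N mulrDr.
    apply: lerD; rewrite !l1normZ.
      by rewrite normfV mulrA divff ?gt_eqF // mul1r (ger0_norm u0) ler_piMl // l1norm_ge0.
    by rewrite ger0_norm ?subr_ge0 // ler_piMl ?mulr_ge0 ?l1norm_ge0 // gerBl.
  have zNk j : l1norm z.2 ^+ j <= `|t| ^+ j * N t ^+ j.
    by rewrite -exprMn lerXn2r // nnegrE ?mulr_ge0 // l1norm_ge0.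
  rewrite normrM normfV normrX ler_pdivrMl ?exprn_gt0 //.
  apply: le_trans (ler_normD _ _) _; rewrite /g mulrDr; apply: lerD.
    rewrite normrM.
    have -> : `|t| ^+ k * (C1 * N t ^+ k * `|s t - mu0|) =
      `|s t - mu0| * (C1 * (`|t| ^+ k * N t ^+ k)) by ring.
    by rewrite ler_wpM2l //; apply: le_trans D1 _; rewrite ler_wpM2l.
  apply: le_trans (ler_norm_sum _ _ _) _; rewrite mulr_sumr.
  apply: ler_sum => i _; rewrite normrM !mxE.
  have -> : `|P t 0 i - t * om 0 i| = `|t| * `|t^-1 * P t 0 i - om 0 i|.
    by rewrite -normrM mulrBr mulVKf.
  (* For k = 0 the truncated [k.-1] makes the left side |t| instead of 1; the restriction |t| < 1
     covers this case. *)
  have tk : `|t| * `|t| ^+ k.-1 <= `|t| ^+ k.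
    by rewrite -exprS; apply: ler_wiXn2l => //; [exact: ltW | exact: leqSpred].
  have [C20 _] := HC2 i.
  apply: (@le_trans _ _ (`|t| * `|t^-1 * P t 0 i - om 0 i| *
      (C2 i * (`|t| ^+ k.-1 * N t ^+ k.-1)))).
    by rewrite ler_wpM2l ?mulr_ge0 //; apply: le_trans (D2 i) _; rewrite ler_wpM2l.
  have -> : `|t| * `|t^-1 * P t 0 i - om 0 i| * (C2 i * (`|t| ^+ k.-1 * N t ^+ k.-1))
    = `|t| * `|t| ^+ k.-1 * (C2 i * N t ^+ k.-1 * `|t^-1 * P t 0 i - om 0 i|) by ring.
  by rewrite ler_wpM2r // !mulr_ge0 // exprn_ge0.
have hN : N t @[t --> (0 : R)^'] --> l1norm om + l1norm om.
  by apply: cvgD; [exact: cvg_l1norm_quotient | exact: cvg_cst].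
have nrm0 q (a : R) : q t @[t --> (0 : R)^'] --> a ->
    `|q t - a| @[t --> (0 : R)^'] --> (0 : R).
  move=> H; suff : `|q t - a| @[t --> (0 : R)^'] --> `|a - a| by rewrite subrr normr0.
  by apply: cvg_norm; apply: cvgB => //; exact: cvg_cst.
have E0 : C1 * (l1norm om + l1norm om) ^+ k * 0 +
    \sum_i (C2 i * (l1norm om + l1norm om) ^+ k.-1) * 0 = 0.
  by rewrite mulr0 add0r big1 // => i _; rewrite mulr0.
suff : g t @[t --> (0 : R)^'] --> C1 * (l1norm om + l1norm om) ^+ k * 0 +
    \sum_i (C2 i * (l1norm om + l1norm om) ^+ k.-1) * 0 by rewrite E0.
apply: cvgD.
  apply: cvgM; last exact: nrm0 hs.
  by apply: cvgMr; exact: cvg_exp hN.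
apply: cvg_sum_fin => i; apply: cvgM; last exact: (nrm0 _ _ (@hP i)).
by apply: cvgMr; exact: cvg_exp hN.
Qed.

End Curve.
End SmallCurves.

(** * Polarization and the spectral form *)

Lemma poly_eq0_of_horner (R : realType) (p : {poly R}) :
  (forall t, p.[t] = 0) -> p = 0.
Proof.
move=> p0; apply/eqP; apply: contraT => pn0.
have := @max_poly_roots _ p [seq i%:R | i <- iota 0 (size p)] pn0.
rewrite size_map size_iota ltnn; apply.
  by apply/allP => t _; rewrite rootE p0.
rewrite map_inj_uniq ?iota_uniq // => i j /eqP.
by rewrite eqr_nat => /eqP.
Qed.

Section Polarization.
Context {R : realType} {W : lmodType R}.
Implicit Types (T : seq W -> R) (u v w : W) (us vs : seq W).

(* Symmetry is only required through the moves of one entry to the front. *)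
Definition symmetric_multilinear k T : Prop :=
  (forall u v (c : R) us, (size us).+1 = k ->
     T ((u + c *: v) :: us) = T (u :: us) + c * T (v :: us)) /\
  (forall us v vs, (size us + size vs).+1 = k ->
     T (us ++ v :: vs) = T (v :: us ++ vs)).

(* t |-> T(v + t w, ..., v + t w, us) is a polynomial; its linear coefficient
   brings out one slot w, which drives the polarization. *)
Lemma pencil_poly k T v w : symmetric_multilinear k T ->
  forall m us, (m + size us)%N = k ->
  exists q : {poly R},
  [/\ forall t, T (nseq m (v + t *: w) ++ us) = q.[t],
      q`_0 = T (nseq m v ++ us) &
      q`_1 = m%:R * T (w :: nseq m.-1 v ++ us)].
Proof.
move=> [lin rot]; elim=> [|m IH] us muk.
  exists (T us)%:P; split=> [t||]; by rewrite ?hornerC ?coefC // mul0r.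
have [qv [hv v0 v1]] := IH (v :: us) ltac:(by rewrite /= addnS -muk).
have [qw [hw w0 w1]] := IH (w :: us) ltac:(by rewrite /= addnS -muk).
have sz u' : (size (nseq m u') + size us).+1 = k by rewrite size_nseq.
(* Linearity in one slot: T(v + t w, ...) = T(v, ...) + t T(w, ...), with the entry v or w moved to
   the fixed arguments. *)
exists (qv + 'X * qw); split=> [t||].
- rewrite hornerD hornerM hornerX -hv -hw.
  by rewrite /= lin ?rot ?size_cat.
- by rewrite coefD coefXM /= addr0 v0 rot.
- rewrite coefD coefXM /= v1 w0 rot // -natr1 mulrDl mul1r; congr (_ + _).
  case: m muk {IH qv hv v0 v1 qw hw w0 w1} sz => [|m] muk sz; first by rewrite !mul0r.
  congr (_ * _); rewrite /= (rot (w :: nseq m v)) /=; last first.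
    by rewrite size_nseq -muk addSn.
  by rewrite (rot [:: v] w) //= size_cat size_nseq -muk !addSn add0n.
Qed.

(** The linear coefficient of the zero polynomial t |-> T(v + t w, ..., v + t w) gives T(w, v, ...,
    v) = 0. Fixing w in the first slot thus leaves a form with one argument less that again vanishes
    on the diagonal. *)
Lemma polarization k T : symmetric_multilinear k T ->
  (forall v, T (nseq k v) = 0) -> forall vs, size vs = k -> T vs = 0.
Proof.
elim: k T => [|k IH] T symT diag0 vs.
  by move/size0nil ->; exact: (diag0 0).
case: vs => [//|w us] [usk].
have [lin rot] := symT.
apply: (IH (fun us => T (w :: us))) => //.
  split=> [u v c xs xsk|xs v ys xyk].
    have sw y : T [:: w, y & xs] = T [:: y, w & xs].
      by apply: (rot [:: w]); rewrite add1n xsk.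
    by rewrite !sw lin //= xsk.
  rewrite -cat_cons rot; last by rewrite addSn xyk.
  by apply: (rot [:: v]); rewrite add1n size_cat xyk.
move=> v.
have [q [hq _ q1]] := @pencil_poly _ _ v w symT k.+1 [::] (addn0 _).
have q0 : q = 0.
  by apply: poly_eq0_of_horner => t; rewrite -hq cats0.
move: q1; rewrite q0 coef0 cats0 => /esym/eqP.
by rewrite mulf_eq0 pnatr_eq0 /= => /eqP.
Qed.

(** On the line v + t w both factors are polynomials in t with product 0, and L(v) + t L(w) is not
    the zero polynomial since L(w) != 0. The other factor is therefore 0, also at t = 0, even when
    L(v) = 0. *)
Lemma polarization_off_hyperplane k T (L : W -> R) w :
  symmetric_multilinear k T ->
  (forall u v (c : R), L (u + c *: v) = L u + c * L v) -> L w != 0 ->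
  (forall v, T (nseq k v) * L v = 0) -> forall vs, size vs = k -> T vs = 0.
Proof.
move=> symT linL Lw TL0; apply: polarization => // v.
have [q [hq q0 _]] := @pencil_poly _ _ v w symT k [::] (addn0 _).
have : q * ((L v)%:P + L w *: 'X) = 0.
  apply: poly_eq0_of_horner => t.
  by rewrite hornerM hornerD hornerC hornerZ hornerX -hq cats0 [L w * t]mulrC
    -linL TL0.
move/eqP; rewrite mulf_eq0 => /orP[/eqP q00|/eqP L0].
  by rewrite -[RHS](coef0 _ 0) -q00 q0 cats0.
have := congr1 (fun p : {poly R} => p`_1) L0.
by rewrite coefD coefC coefZ coefX coef0 /= add0r mulr1 => /eqP; rewrite (negPf Lw).
Qed.

End Polarization.

(** * Common eigenbases, and the invertibility of the matrix of normals *)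

Section SpectralForm.
Context {R : realType} {n : nat}.

(** The map c from positions to blocks is the same for all [gam], which allows eigenvalues at eta =
    0 and at other eta to be compared block by block. *)
Lemma spectral_diag_index (p : nat) (m : 'I_p -> nat) : (0 < p)%N ->
  (\sum_(k < p) m k)%N = n ->
  exists c : 'I_n -> 'I_p, forall gam : 'I_p -> R,
    Defs.spectral_diag m gam = diag_mx (\row_(i < n) gam (c i)).
Proof.
move=> p0 mn; pose k0 : 'I_p := Ordinal p0.
pose cs := flatten [seq nseq (m k) k | k <- enum 'I_p].
have szcs : size cs = n.
  rewrite /cs size_flatten /shape -map_comp sumnE big_map.
  by rewrite -mn big_enum /=; apply: eq_bigr => k _; rewrite size_nseq.
exists (fun i => nth k0 cs i) => gam; congr diag_mx; apply/rowP => i; rewrite !mxE.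
rewrite -(nth_map _ 0) ?szcs // /cs map_flatten -map_comp.
by congr (nth _ (flatten _) _); apply: eq_map => k /=; rewrite map_nseq.
Qed.

(* With Q = U1^T U2, equality at eta = 0 gives Q D2(0) = D1(0) Q, so all columns
   j with Q_ij != 0 carry the same eigenvalue at eta = 0; the strict ordering of
   the gamma's then puts them in one block, for every eta. *)
Lemma common_eigenbasis l (a1 a2 : R * 'rV[R]_n -> 'M[R]_n) (mu : R) :
  spectral_form l a1 -> spectral_form l a2 -> a1 (mu, 0) = a2 (mu, 0) ->
  exists (U : 'M[R]_n), [/\ U^T *m U = 1%:M, U *m U^T = 1%:M &
    forall eta i j, i != j -> (U^T *m (a1 (mu, eta) - a2 (mu, eta)) *m U) i j = 0].
Proof.
move=> [p1 [m1 [g1 [U1 [[p10 m10 s1] G1 [_ O1] L1 E1]]]]].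
move=> [p2 [m2 [g2 [U2 [[p20 m20 s2] G2 [_ O2] L2 E2]]]]] E0.
have [c1 C1] := spectral_diag_index p10 s1.
have [c2 C2] := spectral_diag_index p20 s2.
have [UU1 UU1'] := O1 mu; have [UU2 UU2'] := O2 mu.
exists (U1 mu); split=> // eta i j ij.
have [Q QE] : exists Q : 'M[R]_n, Q = (U1 mu)^T *m U2 mu by eexists.
have QQ : Q *m Q^T = 1%:M.
  by rewrite QE trmx_mul trmxK mulmxA -(mulmxA _ (U2 mu)) UU2' mulmx1.
pose d1 eta := \row_i g1 (c1 i) (mu, eta).
pose d2 eta := \row_i g2 (c2 i) (mu, eta).
have F1 e : (U1 mu)^T *m a1 (mu, e) *m U1 mu = diag_mx (d1 e).
  by rewrite E1 C1 -!mulmxA UU1 mulmx1 mulmxA UU1 mul1mx.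
have F2 e : (U1 mu)^T *m a2 (mu, e) *m U1 mu = Q *m diag_mx (d2 e) *m Q^T.
  by rewrite E2 C2 QE trmx_mul trmxK !mulmxA.
have comm : Q *m diag_mx (d2 0) = diag_mx (d1 0) *m Q.
  by rewrite -F1 E0 F2 -mulmxA (mulmx1C QQ) mulmx1.
have same k k' : Q i k != 0 -> Q i k' != 0 -> c2 k = c2 k'.
  have E k0 : Q i k0 != 0 -> g2 (c2 k0) (mu, 0) = g1 (c1 i) (mu, 0).
    move=> Qn0; have := congr1 (fun M : 'M[R]_n => M i k0) comm.
    rewrite mul_mx_diag mul_diag_mx !mxE mulrC => H.
    exact: (mulIf Qn0 H).
  move=> /E e1 /E e2; apply/eqP; apply: contraT => /negPf ne.
  have : (c2 k < c2 k')%N || (c2 k' < c2 k)%N.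
    by rewrite -neq_ltn; apply/negP => /eqP/val_inj/eqP; rewrite ne.
  by case/orP => /(L2 _ _ (mu, 0)); rewrite e1 e2 ltxx.
rewrite mulmxBr mulmxBl F1 F2 !mxE (negPf ij) mulr0n sub0r.
apply/eqP; rewrite oppr_eq0; apply/eqP.
have [[k Qk]|none] := pselect (exists k, Q i k != 0).
  (* All j0 with Q_(i j0) != 0 lie in one block, so on row i the matrix D2(eta) acts as a scalar,
     and the entry is this scalar times (Q Q^T)_(ij) = 0. *)
  have -> : \sum_j0 (Q *m diag_mx (d2 eta)) i j0 * Q^T j0 j
     = d2 eta 0 k * \sum_j0 Q i j0 * Q^T j0 j.
    rewrite mulr_sumr; apply: eq_bigr => j0 _; rewrite mul_mx_diag !mxE.
    have [->|Qj] := eqVneq (Q i j0) 0; first by rewrite !mul0r mulr0.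
    by rewrite (same _ _ Qj Qk); ring.
  have := congr1 (fun M : 'M[R]_n => M i j) QQ; rewrite !mxE (negPf ij) => ->.
  by rewrite mulr0.
rewrite big1 // => j0 _; rewrite mul_mx_diag !mxE.
have [->|Qj] := eqVneq (Q i j0) 0; first by rewrite !mul0r.
by case: none; exists j0.
Qed.

Lemma spectral_diagonalization l (a : R * 'rV[R]_n -> 'M[R]_n) z :
  spectral_form l a -> exists (U : 'M[R]_n) (g : 'I_n -> R),
    [/\ U^T *m U = 1%:M, forall i, 0 < g i &
        a z = U *m diag_mx (\row_i g i) *m U^T].
Proof.
case: z => mu eta [p [m [g [U [[p0 m0 s] G [_ O] L E]]]]].
have [c C] := spectral_diag_index p0 s.
exists (U mu), (fun i => g (c i) (mu, eta)); split; first by have [] := O mu.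
  by move=> i; have [_] := G (c i); exact.
by rewrite E C.
Qed.

Lemma dot_ge0 (v : 'rV[R]_n) : 0 <= dot v v.
Proof. by apply: sumr_ge0 => i _; rewrite -expr2 sqr_ge0. Qed.

Lemma enorm_sqr (v : 'rV[R]_n) : enorm v ^+ 2 = dot v v.
Proof. by rewrite sqr_sqrtr // dot_ge0. Qed.

Lemma dot_gt0 (v : 'rV[R]_n) : v != 0 -> 0 < dot v v.
Proof.
move=> v0; rewrite lt_neqAle dot_ge0 andbT eq_sym; apply: contra v0 => /eqP d0.
apply/eqP/rowP => i; rewrite mxE; apply/eqP; rewrite -sqrf_eq0 expr2; apply/eqP.
apply: (psumr_eq0P (fun j _ => _) d0) => //= j _.
by rewrite -expr2 sqr_ge0.
Qed.

Lemma cauchy_schwarz_sum (a b : 'I_n -> R) : 0 < \sum_k a k ^+ 2 ->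
  (\sum_k a k * b k) ^+ 2 <= (\sum_k a k ^+ 2) * \sum_k b k ^+ 2.
Proof.
have [A AE] : exists A, A = \sum_k a k ^+ 2 by eexists.
have [B BE] : exists B, B = \sum_k b k ^+ 2 by eexists.
have [S SE] : exists S, S = \sum_k a k * b k by eexists.
rewrite -AE -BE -SE => A0.
have : 0 <= \sum_k (A * b k - S * a k) ^+ 2 by apply: sumr_ge0 => k _; exact: sqr_ge0.
have -> : \sum_k (A * b k - S * a k) ^+ 2 = A * (A * B - S ^+ 2).
  transitivity (A ^+ 2 * (\sum_k b k ^+ 2) - 2 * A * S * (\sum_k a k * b k)
      + S ^+ 2 * (\sum_k a k ^+ 2)); last by rewrite -AE -BE -SE; ring.
  rewrite !mulr_sumr -sumrB -big_split /=.
  by apply: eq_bigr => k _; ring.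
by rewrite pmulr_rge0 // subr_ge0.
Qed.

(* If c N = 0 then |c| = |sum_k c_k (nu_k - e_k)| < |c| by Cauchy-Schwarz. *)
Lemma near_orthonormal_unitmx (e nu : 'I_n -> 'rV[R]_n) : (0 < n)%N ->
  orthonormal_basis e -> (forall k, enorm (nu k - e k) < 1 / Num.sqrt n%:R) ->
  (\matrix_(k, i) nu k 0 i) \in unitmx.
Proof.
move=> n0 oe close; rewrite -row_free_unit -kermx_eq0; apply: contraT.
move=> /rowV0Pn[c]; rewrite sub_kermx => /eqP cN c0.
have cc := dot_gt0 c0.
have sqc : \sum_k c 0 k ^+ 2 = dot c c by apply: eq_bigr => k _; rewrite expr2.
have dk k : dot (nu k - e k) (nu k - e k) < n%:R^-1.
  have sn : 0 < Num.sqrt n%:R :> R by rewrite sqrtr_gt0 ltr0n.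
  have := close k; rewrite -(ltr_pXn2r (n := 2)) ?nnegrE ?sqrtr_ge0 ?divr_ge0 //.
  by rewrite enorm_sqr expr_div_n expr1n sqr_sqrtr // div1r.
pose w i := \sum_k c 0 k * (nu k - e k) 0 i.
have wE i : w i = - \sum_k c 0 k * e k 0 i.
  have := congr1 (fun M : 'rV[R]_n => M 0 i) cN; rewrite !mxE => cNi.
  rewrite /w -[RHS]add0r -{2}cNi -sumrB; apply: eq_bigr => k _.
  by rewrite !mxE mulrBr.
have ww : \sum_i w i ^+ 2 = dot c c.
  transitivity (\sum_k \sum_j c 0 k * c 0 j * dot (e k) (e j)).
    transitivity (\sum_i \sum_k \sum_j c 0 k * c 0 j * (e k 0 i * e j 0 i)).
      apply: eq_bigr => i _; rewrite wE sqrrN expr2 mulr_suml.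
      apply: eq_bigr => k _; rewrite mulr_sumr; apply: eq_bigr => j _; ring.
    rewrite exchange_big; apply: eq_bigr => k _ /=.
    rewrite exchange_big; apply: eq_bigr => j _ /=.
    by rewrite -mulr_sumr.
  apply: eq_bigr => k _; rewrite (bigD1 k) //= oe eqxx mulr1 big1 ?addr0 // => j jk.
  by rewrite oe eq_sym (negPf jk) mulr0.
have : \sum_i w i ^+ 2 <= \sum_i dot c c * \sum_k (nu k - e k) 0 i ^+ 2.
  apply: ler_sum => i _; rewrite -sqc; apply: cauchy_schwarz_sum.
  by rewrite sqc.
rewrite -mulr_sumr exchange_big /= ww leNgt => /negP[].
rewrite -[X in _ < X]mulr1 ltr_pM2l //.
have -> : 1 = \sum_(k < n) n%:R^-1 :> R.
  by rewrite sumr_const card_ord -[RHS]mulr_natr mulVf // pnatr_eq0 -lt0n.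
apply: ltr_sum => [|k _]; first by apply/hasP; exists (Ordinal n0); rewrite ?mem_index_enum.
by apply: le_lt_trans (dk k); apply: ler_sum => i _; rewrite expr2.
Qed.

End SpectralForm.

(** * The maximum principle *)

(** If L were positive, g' would be positive just to the right of its zero at 0, and g would exceed
    [g 0] there. *)
Lemma second_derivative_at_max (R : realType) (g g' : R -> R) (L d : R) : 0 < d ->
  (forall t, `|t| < d -> is_derive t (1 : R) g (g' t)) ->
  is_derive (0 : R) (1 : R) g' L -> (forall t, `|t| < d -> g t <= g 0) -> L <= 0.
Proof.
move=> d0 dg [dg' LE] gmax; rewrite leNgt; apply/negP => L0.
have in_d t : t \in `]- d, d[ -> `|t| < d by rewrite in_itv /= ltr_norml.
have g'0 : g' 0 = 0.
  have dmax : is_derive (0 : R) (1 : R) g 0.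
    apply: (@derive1_at_max R g (- d) d 0).
    - by rewrite ge0_cp // ltW.
    - by move=> t /in_d td; exact: (@ex_derive _ _ _ _ _ _ _ (dg t td)).
    - by rewrite in_itv /= oppr_lt0 d0.
    - by move=> t /in_d; exact: gmax.
  have d00 : `|0 : R| < d by rewrite normr0.
  by rewrite -(@derive_val _ _ _ _ _ _ _ (dg 0 d00)) (@derive_val _ _ _ _ _ _ _ dmax).
move: dg'; rewrite /derivable => /cvgrPdist_lt /(_ L L0).
rewrite -/(derive g' 0 1) LE => -[r /= r0 Hr].
pose t := Num.min r d / 2.
have m0 : 0 < Num.min r d by rewrite lt_min r0.
have t0 : 0 < t by rewrite divr_gt0.
have tm : t < Num.min r d by rewrite /t ltr_pdivrMr // ltr_pMr // ltr1n.
have [tr td] : t < r /\ t < d by move: tm; rewrite lt_min => /andP.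
have [c /[!in_itv]/= /andP[c0 ct] E] : exists2 c, c \in `]0, t[%R &
    g t - g 0 = g' c * (t - 0).
  apply: MVT => // [c|].
    rewrite in_itv /= => /andP[c0 ct]; apply: dg.
    by rewrite gtr0_norm // (lt_trans ct).
  apply: derivable_within_continuous => c; rewrite in_itv /= => /andP[c0 ct].
  have cd : `|c| < d by rewrite ger0_norm // (le_lt_trans ct).
  exact: (@ex_derive _ _ _ _ _ _ _ (dg c cd)).
have : g t - g 0 <= 0 by rewrite subr_le0 gmax // gtr0_norm.
rewrite E subr0 pmulr_lle0 // leNgt => /negP[].
have := Hr c; rewrite /ball_ /= sub0r normrN gtr0_norm // => /(_ (lt_trans ct tr)).
rewrite gt_eqF // => /(_ isT); rewrite addr0 [c *: 1]mulr1 g'0 subr0.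
rewrite /GRing.scale /= ltr_norml => /andP[_].
rewrite ltrBlDr ltrDl => H.
by rewrite -(pmulr_rgt0 _ (x := c^-1)) ?invr_gt0.
Qed.

Lemma cvg_near_eq (T : Type) (R : realType) (F : set_system T) {FF : Filter F}
    (f g : T -> R) (l : R) : (\forall x \near F, f x = g x) ->
  g x @[x --> F] --> l -> f x @[x --> F] --> l.
Proof.
move=> fg; apply: cvg_trans; apply: near_eq_cvg.
by apply: filterS fg => h ->.
Qed.

Lemma is_derive_quadratic (R : realType) (a b c t : R) :
  is_derive t (1 : R) (fun t => a + b * t + c * t ^+ 2) (b + 2 * c * t).
Proof.
pose p : {poly R} := a%:P + b *: 'X + c *: 'X^2.
have E : (fun t => a + b * t + c * t ^+ 2) = horner p.
  by apply/funext => s; rewrite !hornerE.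
rewrite E; apply: is_derive_eq.
by rewrite /p !(derivD, derivC, derivZ, derivX, derivXn) /= !(hornerE, hornerMn); ring.
Qed.

(** When H is a Hessian the inner double sum is the second derivative along the j-th column of U, so
    A : H is a combination of second derivatives of functions of one variable. *)
Lemma spectral_contraction (R : realType) n (U A H : 'M[R]_n) (g : 'I_n -> R) :
  A = U *m diag_mx (\row_i g i) *m U^T ->
  \sum_i \sum_k A i k * H i k =
  \sum_j g j * \sum_i \sum_k U i j * U k j * H i k.
Proof.
move=> ->; under [RHS]eq_bigr do rewrite mulr_sumr.
rewrite [RHS]exchange_big /=; apply: eq_bigr => i _.
under [RHS]eq_bigr do rewrite mulr_sumr.
rewrite [RHS]exchange_big /=; apply: eq_bigr => k _.
rewrite mul_mx_diag mxE mulr_suml; apply: eq_bigr => j _.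
by rewrite !mxE !mulrA (mulrC (g j)).
Qed.

Section C2.
Context {R : realType} {n : nat}.
Implicit Types (Om : set 'rV[R]_n) (u v : 'rV[R]_n -> R) (x xi : 'rV[R]_n).

Definition C2_on Om u : Prop :=
  [/\ forall i x, Om x -> derivable u x (delta_mx 0 i),
      forall i j x, Om x -> derivable (pd i u) x (delta_mx 0 j),
      forall i x, Om x -> {for x, continuous (pd i u)} &
      forall i j x, Om x -> {for x, continuous (pd j (pd i u))}].

(** Only partial derivatives are given; their continuity allows coordinate directions to be added
    one at a time. *)
Lemma is_derive_coords Om u x xi : open Om -> Om x ->
  (forall i y, Om y -> derivable u y (delta_mx 0 i)) ->
  (forall i y, Om y -> {for y, continuous (pd i u)}) ->
  is_derive x xi u (\sum_i xi 0 i * pd i u x).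
Proof.
move=> oOm Omx du cu; rewrite [X in is_derive _ X](row_sum_delta xi).
elim: (index_enum 'I_n) => [|i r IH].
  by rewrite !big_nil; exact: is_derive0.
rewrite !big_cons addrC [X in is_derive _ _ _ X]addrC.
have nOm : \forall y \near x, Om y by exact: open_nbhs_nbhs.
have dZ y : Om y -> is_derive y (xi 0 i *: delta_mx 0 i) u (xi 0 i * pd i u y).
  by move=> Omy; apply: is_deriveZdir; exact: du.
have [H1 H2] := IH; rewrite -H2 -(@derive_val _ _ _ _ _ _ _ (dZ x Omx)).
apply: is_deriveDdir; last exact: H1.
  by apply: filterS nOm => y /dZ[].
suff : 'D_(xi 0 i *: delta_mx 0 i) u y @[y --> x] -->
    'D_(xi 0 i *: delta_mx 0 i) u x by [].
rewrite (@derive_val _ _ _ _ _ _ _ (dZ x Omx)).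
have H : \forall y \near x, 'D_(xi 0 i *: delta_mx 0 i) u y = xi 0 i * pd i u y.
  by apply: filterS nOm => y /dZ[].
apply: (cvg_near_eq H).
by apply: cvgMr; exact: cu.
Qed.

Lemma is_derive_grad_dir Om u x xi : open Om -> Om x -> C2_on Om u ->
  is_derive x xi (fun y => \sum_i xi 0 i * pd i u y)
    (\sum_i \sum_k xi 0 i * xi 0 k * pd i (pd k u) x).
Proof.
move=> oOm Omx [d1 d2 c1 c2].
rewrite exchange_big /=.
rewrite (_ : (fun y => _) = \sum_i (xi 0 i \*: pd i u)); last first.
  by apply/funext => y; rewrite fct_sumE.
apply: is_derive_sum => k.
rewrite (_ : \sum_i _ = xi 0 k *: \sum_i (xi 0 i * pd i (pd k u) x)); last first.
  by rewrite /GRing.scale /= mulr_sumr; apply: eq_bigr => i _; rewrite mulrCA mulrA.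
apply: is_deriveZ.
exact: (is_derive_coords xi oOm Omx (fun i y => d2 k i y) (fun i y => c2 k i y)).
Qed.

Lemma compact_closure_bounded Om : bounded_set Om -> compact (closure Om).
Proof.
move=> bOm; apply: bounded_closed_compact; last exact: closed_closure.
have [M [Mr HM]] := bOm.
(* One unit because [bounded_set] bounds by numbers strictly above M, and one for the distance from
   a closure point to a point of [Om]. *)
exists (M + 2); split; first by rewrite realD ?Mr ?realn //.
move=> N MN y /= cly.
have [z [Omz zy]] := cly _ (nbhsx_ballx y 1 ltr01).
have := HM (M + 1) _ z Omz; rewrite ltrDl ltr01 => /(_ isT) /= zM.
move: zy; rewrite -ball_normE /ball_ /= => zy.
rewrite -(subrK z y); apply: le_trans (ler_normD _ _) _.
by apply: le_trans (ltW MN); lra.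
Qed.

(* At an interior maximum of u + e |x|^2, which exists for small e if u is
   positive somewhere, A : D^2 u <= - 2 e tr A < 0. *)
Lemma weak_maximum_principle Om u (U A : 'M[R]_n) (g : 'I_n -> R) : (0 < n)%N ->
  open Om -> bounded_set Om ->
  U^T *m U = 1%:M -> (forall i, 0 < g i) -> A = U *m diag_mx (\row_i g i) *m U^T ->
  {within closure Om, continuous u} -> C2_on Om u ->
  (forall x, Om x -> \sum_i \sum_k A i k * pd i (pd k u) x = 0) ->
  (forall x, boundary Om x -> u x <= 0) -> forall x, closure Om x -> u x <= 0.
Proof.
move=> n0 oOm bOm UU g0 AE cu C2u eq bd x0 cx0.
rewrite leNgt; apply/negP => ux0.
have cOm := compact_closure_bounded bOm.
have cdot : continuous (fun x : 'rV[R]_n => dot x x).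
  move=> x; apply: (@cvg_sum_fin _ _ _ (nbhs_filter x)) => i.
  by apply: cvgM; exact: coord_continuous.
have ne : closure Om !=set0 by exists x0.
have [m _ mmax] := EVT_max_rV ne cOm (continuous_subspaceT cdot).
pose M := dot m m.
have M0 : 0 <= M := dot_ge0 m.
have dotM x : closure Om x -> dot x x <= M by move=> cx; apply: mmax; rewrite inE.
(* This makes e M < u(x0). On the boundary u + e |x|^2 is at most e M, hence below its value at x0,
   which forces the maximum into the interior. *)
pose e := u x0 / (2 * (M + 1)).
have M1 : 0 < M + 1 by rewrite ltr_wpDl.
have e0 : 0 < e by rewrite divr_gt0 // mulr_gt0.
have eM : e * M < u x0.
  rewrite /e mulrAC ltr_pdivrMr ?mulr_gt0 // ltr_pM2l //; lra.
pose z x := u x + e * dot x x.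
have cz : {within closure Om, continuous z}.
  apply/subspace_continuousP => x cx; apply: cvgD.
    by move/subspace_continuousP: cu; apply.
  by apply: cvgMr; apply: cvg_within_filter; exact: cdot.
have [y /[!inE] cy ymax] := EVT_max_rV ne cOm cz.
have zx : u x0 <= z y.
  apply: le_trans (ymax x0 _); last by rewrite inE.
  by rewrite lerDl mulr_ge0 ?dot_ge0 // ltW.
have Omy : Om y.
  apply: contrapT => nOmy.
  have : z y <= e * M.
    rewrite -[leRHS]add0r lerD //; last by rewrite ler_wpM2l ?dotM // ltW.
    by apply: bd; split=> //; rewrite (interior_id _).1.
  by move/(le_trans zx); rewrite leNgt eM.
have hess (xi : 'rV[R]_n) :
    \sum_i \sum_k xi 0 i * xi 0 k * pd i (pd k u) y <= - (2 * e * dot xi xi).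
  (* G is z along the line through y in the direction xi, with |y + t xi|^2 expanded so that this
     part is a polynomial in t. *)
  pose G (t : R) := u (y + t *: xi) + e * (dot y y + 2 * t * dot y xi + t ^+ 2 * dot xi xi).
  have GE t : G t = z (y + t *: xi).
    rewrite /G /z; congr (_ + e * _); rewrite /dot !mulr_sumr -!big_split /=.
    by apply: eq_bigr => i _; rewrite !mxE; ring.
  have [d /= d0 Hd] : exists2 d : R, 0 < d & forall t, `|t| < d -> Om (y + t *: xi).
    have [d d0 Hd] := near_plane xi 0 (open_nbhs_nbhs (conj oOm Omy)).
    by exists d => // t td; have := Hd t 0 td; rewrite normr0 scaler0 addr0; exact.
  have [C2a C2b C2c C2d] := C2u.
  pose G' (t : R) := \sum_i xi 0 i * pd i u (y + t *: xi) +
    e * (2 * dot y xi + 2 * t * dot xi xi).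
  rewrite -subr_le0 opprK.
  apply: (@second_derivative_at_max _ G G' _ d) => // [t td||t td].
  - apply: is_deriveD.
      have H := is_derive_coords xi oOm (Hd t td) C2a C2c.
      rewrite -(@derive_val _ _ _ _ _ _ _ H); apply: is_derive_line.
      exact: (@ex_derive _ _ _ _ _ _ _ H).
    have H := is_derive_quadratic (e * dot y y) (2 * e * dot y xi) (e * dot xi xi) t.
    rewrite (_ : (fun t => e * _) = (fun t => e * dot y y + 2 * e * dot y xi * t +
       e * dot xi xi * t ^+ 2)); last by apply/funext => s; ring.
    by apply: (is_derive_eq H); ring.
  - apply: is_deriveD.
      have H := is_derive_grad_dir xi oOm Omy C2u.
      exact: is_derive_line0 H.
    have H := is_derive_quadratic (2 * e * dot y xi) (2 * e * dot xi xi) 0 0.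
    rewrite (_ : (fun t => e * _) = (fun t => 2 * e * dot y xi + 2 * e * dot xi xi * t +
       0 * t ^+ 2)); last by apply/funext => s; ring.
    by apply: (is_derive_eq H); ring.
  - by rewrite !GE scale0r addr0; apply: ymax; rewrite inE; apply: subset_closure; exact: Hd.
have := eq y Omy.
have EH : \sum_i \sum_k A i k * pd i (pd k u) y =
    \sum_i \sum_k A i k * (\matrix_(i, k) pd i (pd k u) y) i k.
  by apply: eq_bigr => i _; apply: eq_bigr => k _; rewrite mxE.
rewrite EH (spectral_contraction _ AE).
have UU1 j : dot (\row_i U i j) (\row_i U i j) = 1.
  have E : \sum_k U^T j k * U k j = 1.
    by have := congr1 (fun M : 'M[R]_n => M j j) UU; rewrite !mxE eqxx.
  by rewrite -[RHS]E; apply: eq_bigr => k _; rewrite !mxE.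
have neg j : \sum_i \sum_k U i j * U k j * (\matrix_(i, k) pd i (pd k u) y) i k < 0.
  have := hess (\row_i U i j); rewrite UU1 mulr1 => H.
  apply: (@le_lt_trans _ _ (- (2 * e))); last by rewrite oppr_lt0 mulr_gt0.
  apply: le_trans H; rewrite le_eqVlt; apply/orP; left; apply/eqP.
  by apply: eq_bigr => i _; apply: eq_bigr => k _; rewrite !mxE.
apply/eqP; rewrite lt_eqF //.
apply: (@lt_le_trans _ _ (\sum_(j < n) 0)); last by rewrite big1_eq.
apply: ltr_sum => [|j _].
  by apply/hasP; exists (Ordinal n0); rewrite ?mem_index_enum.
by rewrite pmulr_rlt0.
Qed.

End C2.

(** * Curves in the Hoelder space *)

Section HoelderCurves.
Context {R : realType} {n : nat}.
Variables (Om : set 'rV[R]_n) (al : R).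
Hypotheses (n0 : (0 < n)%N) (oOm : open Om) (neOm : Om !=set0).
Implicit Types (f g u v k : 'rV[R]_n -> R) (x : 'rV[R]_n).

Lemma sup_norm_le f x : Om x -> (`|f x|%:E <= sup_norm Om f)%E.
Proof. by move=> Omx; apply: ereal_sup_ubound; exists x. Qed.

Lemma sup_norm_ge0 f : (0 <= sup_norm Om f)%E.
Proof.
by have [x Omx] := neOm; apply: le_trans (sup_norm_le f Omx); rewrite lee_fin.
Qed.

(** A supremum over the empty set would be -oo, so two distinct points of [Om] must be exhibited.
    Nonnegativity of every summand lets the whole norm bound each of them. *)
Lemma hoelder_seminorm_ge0 f : (0 <= hoelder_seminorm Om al f)%E.
Proof.
have [x Omx] := neOm.
have [d d0 Hd] := near_plane (delta_mx 0 (Ordinal n0)) 0 (open_nbhs_nbhs (conj oOm Omx)).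
pose y := x + (d / 2) *: delta_mx 0 (Ordinal n0).
have Omy : Om y.
  have := Hd (d / 2) 0; rewrite normr0 scaler0 addr0; apply => //.
  by rewrite gtr0_norm ?divr_gt0 // ltr_pdivrMr // ltr_pMr // ltr1n.
have xy : x != y.
  apply/eqP => /rowP/(_ (Ordinal n0))/eqP; rewrite !mxE !eqxx mulr1.
  by rewrite -subr_eq0 opprD addNKr oppr_eq0 gt_eqF // divr_gt0.
apply: (@le_trans _ _ ((`|f x - f y| / enorm (x - y) `^ al)%:E)).
  by rewrite lee_fin divr_ge0 // powR_ge0.
by apply: ereal_sup_ubound; exists (x, y).
Qed.

Lemma C2al_norm_bounds f (e : R) : (C2al_norm Om al f < e%:E)%E ->
  [/\ forall x, Om x -> `|f x| <= e,
      forall i x, Om x -> `|pd i f x| <= e &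
      forall i j x, Om x -> `|pd j (pd i f) x| <= e].
Proof.
rewrite /C2al_norm => H.
have A0 := sup_norm_ge0 f.
have B0 : (0 <= \sum_(i < n) sup_norm Om (pd i f))%E.
  by apply: sume_ge0 => i _; exact: sup_norm_ge0.
have C0 : (0 <= \sum_(i < n) \sum_(j < n) sup_norm Om (pd j (pd i f)))%E.
  by apply: sume_ge0 => i _; apply: sume_ge0 => j _; exact: sup_norm_ge0.
have D0 : (0 <= \sum_(i < n) \sum_(j < n) hoelder_seminorm Om al (pd j (pd i f)))%E.
  by apply: sume_ge0 => i _; apply: sume_ge0 => j _; exact: hoelder_seminorm_ge0.
have le_sum (F : 'I_n -> \bar R) i : (forall j, 0 <= F j)%E -> (F i <= \sum_j F j)%E.
  by move=> F0; rewrite (bigD1 i) //= leeDl // sume_ge0.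
split=> [x Omx|i x Omx|i j x Omx]; rewrite -lee_fin; apply/ltW/(le_lt_trans _ H).
- apply: le_trans (sup_norm_le f Omx) _.
  by rewrite -!addeA leeDl // !adde_ge0.
- apply: le_trans (sup_norm_le _ Omx) _.
  apply: le_trans (le_sum (fun i => sup_norm Om (pd i f)) i _) _.
    by move=> j; exact: sup_norm_ge0.
  by rewrite -addeA -addeA addeCA leeDl // !adde_ge0.
- apply: le_trans (sup_norm_le _ Omx) _.
  apply: le_trans (le_sum (fun j => sup_norm Om (pd j (pd i f))) j _) _.
    by move=> j'; exact: sup_norm_ge0.
  apply: le_trans (le_sum (fun i => \sum_(j < n) sup_norm Om (pd j (pd i f)))%E i _) _.
    by move=> i'; apply: sume_ge0 => j' _; exact: sup_norm_ge0.
  by rewrite -addeA addeCA leeDl // !adde_ge0.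
Qed.

(* [C2al] without its Hoelder bound, which is what is needed pointwise. *)
Definition C2_closure u : Prop :=
  [/\ {within closure Om, continuous u},
      forall i x, Om x -> derivable u x (delta_mx 0 i),
      forall i j x, Om x -> derivable (pd i u) x (delta_mx 0 j),
      forall i, has_cont_ext Om (pd i u) &
      forall i j, has_cont_ext Om (pd j (pd i u))].

Lemma C2al_C2_closure u : C2al Om al u -> C2_closure u.
Proof. by move=> [? ? ? ? H]; split=> // i j; have [] := H i j. Qed.

Lemma cont_ext_continuous f x : has_cont_ext Om f -> Om x -> {for x, continuous f}.
Proof.
move=> [g /subspace_continuousP cg gf] Omx.
have nOm : \forall y \near x, Om y by exact: open_nbhs_nbhs.
have cgx : g y @[y --> x] --> g x.
  move=> A nA; have := cg x (subset_closure Omx) A nA.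
  by apply: filterS2 nOm => y Omy; apply; exact: subset_closure.
suff : f y @[y --> x] --> g x by rewrite gf.
have H : \forall y \near x, f y = g y by apply: filterS nOm => y /gf ->.
exact: (cvg_near_eq H).
Qed.

Lemma C2_closure_on u : C2_closure u -> C2_on Om u.
Proof.
move=> [_ d1 d2 h1 h2]; split; [exact: d1|exact: d2| |] => [i x|i j x].
  exact: cont_ext_continuous (h1 i).
exact: cont_ext_continuous (h2 i j).
Qed.


Lemma cvg_cont_ext f g x : {within closure Om, continuous g} ->
  (forall y, Om y -> g y = f y) -> closure Om x ->
  f y @[y --> within Om (nbhs x)] --> g x.
Proof.
move=> /subspace_continuousP cg gf cx A nA.
have H : \forall y \near x, closure Om y -> A (g y) by exact: cg x cx A nA.
suff : \forall y \near x, Om y -> A (f y) by [].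
by apply: filterS H => y Hy Omy; rewrite -gf //; apply/Hy/subset_closure.
Qed.

Lemma cont_extE f g x : {within closure Om, continuous g} ->
  (forall y, Om y -> g y = f y) -> closure Om x -> cont_ext Om f x = g x.
Proof.
move=> cg gf cx.
have PF : ProperFilter (within Om (nbhs x)) by exact: within_nbhs_proper.
apply/cvg_lim => //; exact: cvg_cont_ext.
Qed.

Lemma has_cont_ext_eq f g : (forall x, Om x -> f x = g x) ->
  has_cont_ext Om f -> has_cont_ext Om g.
Proof. by move=> fg [h ch hf]; exists h => // x Omx; rewrite hf // fg. Qed.

Lemma cont_ext_eq f g x : (forall y, Om y -> f y = g y) -> closure Om x ->
  has_cont_ext Om f -> cont_ext Om f x = cont_ext Om g x.
Proof.
move=> fg cx [h ch hf]; rewrite (cont_extE ch hf) // (cont_extE (f := g) ch) //.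
by move=> y Omy; rewrite hf // fg.
Qed.

Lemma cont_ext_le f x (e : R) : has_cont_ext Om f -> closure Om x ->
  (forall y, Om y -> `|f y| <= e) -> `|cont_ext Om f x| <= e.
Proof.
move=> [g cg gf] cx fe; rewrite (cont_extE cg gf) //.
have PF : ProperFilter (within Om (nbhs x)) by exact: within_nbhs_proper.
have H : `|f y| @[y --> within Om (nbhs x)] --> `|g x|.
  by apply: cvg_norm; exact: cvg_cont_ext.
rewrite -(cvg_lim (@Rhausdorff R) H); apply: limr_le; first by apply/cvg_ex; eexists; exact: H.
have : \forall y \near within Om (nbhs x), Om y by exact: withinT.
by apply: filterS => y; exact: fe.
Qed.

(* The combination occurring in the difference quotients of [Cl_curve]. *)
Definition comb (c : R) f g k x : R := c * (f x - g x) - k x.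

Lemma within_continuous_comb c f g k :
  {within closure Om, continuous f} -> {within closure Om, continuous g} ->
  {within closure Om, continuous k} -> {within closure Om, continuous (comb c f g k)}.
Proof.
move=> /subspace_continuousP cf /subspace_continuousP cg /subspace_continuousP ck.
apply/subspace_continuousP => x cx; apply: cvgB; last exact: ck.
by apply: cvgMr; apply: cvgB; [exact: cf | exact: cg].
Qed.

Lemma has_cont_ext_comb c f g k : has_cont_ext Om f -> has_cont_ext Om g ->
  has_cont_ext Om k -> has_cont_ext Om (comb c f g k).
Proof.
move=> [f' cf f'E] [g' cg g'E] [k' ck k'E].
exists (comb c f' g' k'); first exact: within_continuous_comb.
by move=> x Omx; rewrite /comb f'E ?g'E ?k'E.
Qed.

Lemma cont_ext_comb c f g k x : closure Om x -> has_cont_ext Om f ->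
  has_cont_ext Om g -> has_cont_ext Om k ->
  cont_ext Om (comb c f g k) x
  = c * (cont_ext Om f x - cont_ext Om g x) - cont_ext Om k x.
Proof.
move=> cx [f' cf f'E] [g' cg g'E] [k' ck k'E].
rewrite (cont_extE cf f'E) // (cont_extE cg g'E) // (cont_extE ck k'E) //.
rewrite (@cont_extE _ (comb c f' g' k')) //; first exact: within_continuous_comb.
by move=> y Omy; rewrite /comb f'E ?g'E ?k'E.
Qed.

Lemma is_derive_comb c f g k x (v : 'rV[R]_n) : derivable f x v -> derivable g x v ->
  derivable k x v ->
  is_derive x v (comb c f g k) (c * ('D_v f x - 'D_v g x) - 'D_v k x).
Proof.
move=> df dg dk.
exact: (is_deriveB (is_deriveZ c (is_deriveB (derivableP df) (derivableP dg)))
  (derivableP dk)).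
Qed.

Lemma pd_comb c f g k i x : C2_closure f -> C2_closure g -> C2_closure k -> Om x ->
  pd i (comb c f g k) x = comb c (pd i f) (pd i g) (pd i k) x.
Proof.
move=> [_ df _ _ _] [_ dg _ _ _] [_ dk _ _ _] Omx.
exact: (@derive_val _ _ _ _ _ _ _
  (is_derive_comb c (df i x Omx) (dg i x Omx) (dk i x Omx))).
Qed.

Lemma is_derive_pd_comb c f g k i j x :
  C2_closure f -> C2_closure g -> C2_closure k -> Om x ->
  is_derive x (delta_mx 0 j) (pd i (comb c f g k))
    (comb c (pd j (pd i f)) (pd j (pd i g)) (pd j (pd i k)) x).
Proof.
move=> Cf Cg Ck Omx.
have [_ _ df _ _] := Cf; have [_ _ dg _ _] := Cg; have [_ _ dk _ _] := Ck.
apply: near_eq_is_derive; last first.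
  exact: (is_derive_comb c (df i j x Omx) (dg i j x Omx) (dk i j x Omx)).
have nOm : \forall y \near x, Om y by exact: open_nbhs_nbhs.
by apply: filterS nOm => y Omy; rewrite pd_comb.
Qed.

Lemma C2_closure_comb c f g k : C2_closure f -> C2_closure g -> C2_closure k ->
  C2_closure (comb c f g k).
Proof.
move=> Cf Cg Ck.
have [cf df ddf hf hhf] := Cf; have [cg dg ddg hg hhg] := Cg.
have [ck dk ddk hk hhk] := Ck; split.
- exact: within_continuous_comb.
- move=> i x Omx; apply: ex_derive.
  exact: (is_derive_comb c (df i x Omx) (dg i x Omx) (dk i x Omx)).
- by move=> i j x Omx; apply: ex_derive; exact: is_derive_pd_comb.
- move=> i; apply: (@has_cont_ext_eq (comb c (pd i f) (pd i g) (pd i k))).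
    by move=> x Omx; rewrite pd_comb.
  exact: has_cont_ext_comb.
- move=> i j.
  apply: (@has_cont_ext_eq (comb c (pd j (pd i f)) (pd j (pd i g)) (pd j (pd i k)))).
    move=> x Omx; rewrite -[RHS]/('D_(delta_mx 0 j) (pd i (comb c f g k)) x).
    by rewrite (@derive_val _ _ _ _ _ _ _ (is_derive_pd_comb c i j Cf Cg Ck Omx)).
  exact: has_cont_ext_comb.
Qed.

(* Functionals continuous for the C^{2+al} norm, through which a C^l curve in the
   function space becomes a C^l function of tau. *)
Definition jet_functional (L : ('rV[R]_n -> R) -> R) : Prop :=
  (forall c f g k, C2_closure f -> C2_closure g -> C2_closure k ->
     L (comb c f g k) = c * (L f - L g) - L k) /\
  (forall f e, C2_closure f -> (C2al_norm Om al f < e%:E)%E -> `|L f| <= e).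

(** The norm only sees values on [Om]; at a boundary point the value is recovered as the continuous
    extension. *)
Lemma jet_value x : closure Om x -> jet_functional (fun f => f x).
Proof.
move=> cx; split=> // f e [cf _ _ _ _] /C2al_norm_bounds[fe _ _].
rewrite -(cont_extE (f := f) cf _ cx) //; apply: cont_ext_le => //.
by exists f.
Qed.

Lemma jet_pd i x : closure Om x -> jet_functional (fun f => cont_ext Om (pd i f) x).
Proof.
move=> cx; split=> [c f g k Cf Cg Ck|f e [_ _ _ hf _] /C2al_norm_bounds[_ fe _]].
  have [_ _ _ hf _] := Cf; have [_ _ _ hg _] := Cg; have [_ _ _ hk _] := Ck.
  rewrite -cont_ext_comb //; apply: cont_ext_eq => //.
    by move=> y Omy; rewrite pd_comb.
  by have [_ _ _ h _] := C2_closure_comb c Cf Cg Ck.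
by apply: cont_ext_le => // y Omy; exact: fe.
Qed.

Lemma jet_pd2 i j x : Om x -> jet_functional (fun f => pd j (pd i f) x).
Proof.
move=> Omx; split=> [c f g k Cf Cg Ck|f e Cf /C2al_norm_bounds[_ _ fe]].
  exact: (@derive_val _ _ _ _ _ _ _ (is_derive_pd_comb c i j Cf Cg Ck Omx)).
exact: fe.
Qed.

(** The error of the difference quotient is a [comb], so its norm bounds the error for every L. As w
    is chosen before L, values and partial derivatives of the tau-derivatives all come from the same
    functions. *)
Lemma Cl_curve_jet l e (v : R -> 'rV[R]_n -> R) : Cl_curve Om al l e v ->
  exists w : nat -> R -> 'rV[R]_n -> R,
  [/\ forall t, - e < t < e -> forall x, closure Om x -> w 0%N t x = v t x,
      forall t, - e < t < e -> forall k : nat, (k <= l)%N -> C2al Om al (w k t) &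
      forall L, jet_functional L -> forall (k : nat) t, (k < l)%N -> `|t| < e ->
        is_derive t (1 : R) (fun s => L (w k s)) (L (w k.+1 t))].
Proof.
move=> [w H]; exists w; split=> [t /H[]|t /H[]|] //.
move=> L [Llin Lbd] k t kl te.
have [_ Ct lim _] := H t ltac:(by rewrite -ltr_norml).
have Q : h^-1 *: (L (w k (h *: 1 + t)) - L (w k t)) @[h --> (0 : R)^']
    --> L (w k.+1 t).
  apply/cvgrPdist_le => d d0.
  have n1 : \forall h \near (0 : R)^', (C2al_norm Om al
      (fun x => (h^-1 * (w k (t + h) x - w k t x) - w k.+1 t x)%R) < d%:E)%E.
    have d0' : (0 < d%:E)%E by rewrite lte_fin.
    exact: (lim k kl [set y | (y < d%:E)%E] (open_ereal_lt' d0')).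
  have n2 : \forall h \near (0 : R)^', `|h| < e - `|t|.
    by apply: dnbhs0_lt; rewrite subr_gt0.
  apply: filterS2 n1 n2 => h hd hs.
  have hte : - e < t + h < e.
    by rewrite -ltr_norml; apply: le_lt_trans (ler_normD _ _) _; rewrite -ltrBrDl.
  have [_ Cth _ _] := H _ hte.
  have C1 := C2al_C2_closure (Cth k (ltnW kl)).
  have C2 := C2al_C2_closure (Ct k (ltnW kl)).
  have C3 := C2al_C2_closure (Ct k.+1 kl).
  have := Lbd _ _ (C2_closure_comb h^-1 C1 C2 C3) hd.
  by rewrite Llin // distrC [h *: 1]mulr1 [h + t]addrC.
by split; [apply/cvg_ex; eexists; exact: Q | exact: cvg_lim Q].
Qed.

End HoelderCurves.

(** * Expansion of the boundary value problem in tau *)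

Section DivergenceTerms.
Context {R : realType} {n : nat}.
Local Notation V := (R * 'rV[R]_n)%type.
Implicit Types (phi : V -> R).

(* The summand d_i (phi(u, grad u) d_k u) of the divergence, expanded, with
   s = u, P = grad u and H i k = d_i d_k u. *)
Definition div_term phi (i k : 'I_n) (s : R) (P : 'rV[R]_n) (H : 'M[R]_n) : R :=
  'D_e_mu phi (s, P) * (P 0 i * P 0 k)
  + \sum_m 'D_(e_eta m) phi (s, P) * (H i m * P 0 k) + phi (s, P) * H i k.

Lemma cvg_mul_increment (T : Type) (F : set_system T) (FF : Filter F)
    (c f1 f2 g1 g2 : T -> R) (a b : R) :
  g1 t @[t --> F] --> (0 : R) -> f2 t @[t --> F] --> (0 : R) ->
  c t * (f1 t - f2 t) @[t --> F] --> a -> c t * (g1 t - g2 t) @[t --> F] --> b ->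
  c t * (f1 t * g1 t - f2 t * g2 t) @[t --> F] --> (0 : R).
Proof.
move=> hg1 hf2 hf hg.
have E : (fun t => c t * (f1 t * g1 t - f2 t * g2 t)) =
    (fun t => c t * (f1 t - f2 t) * g1 t + f2 t * (c t * (g1 t - g2 t))).
  by apply/funext => t; ring.
rewrite E -[X in _ --> X](addr0 (0 : R)) -[X in _ --> X + _](mulr0 a).
rewrite -[X in _ --> _ + X](mul0r b).
by apply: cvgD; apply: cvgM.
Qed.

(** The first two parts of [div_term] are quadratic in (P, H), which tends to 0, so their rescaled
    increments vanish. Only phi H contributes, with phi frozen at (s0, 0). *)
Lemma cvg_div_term_increment (T : Type) (F : set_system T) (FF : Filter F)
    phi i k (s1 s2 : T -> R) (P1 P2 : T -> 'rV[R]_n) (H1 H2 : T -> 'M[R]_n)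
    (s0 : R) (c : T -> R) (sg : R) (pi : 'I_n -> R) (Th : 'I_n -> 'I_n -> R) :
  Ck 2 phi -> s1 t @[t --> F] --> s0 -> s2 t @[t --> F] --> s0 ->
  (forall i, P1 t 0 i @[t --> F] --> (0 : 'rV[R]_n) 0 i) ->
  (forall i, P2 t 0 i @[t --> F] --> (0 : 'rV[R]_n) 0 i) ->
  (forall i j, H2 t i j @[t --> F] --> (0 : R)) ->
  c t * (s1 t - s2 t) @[t --> F] --> sg ->
  (forall i, c t * (P1 t 0 i - P2 t 0 i) @[t --> F] --> pi i) ->
  (forall i j, c t * (H1 t i j - H2 t i j) @[t --> F] --> Th i j) ->
  c t * (div_term phi i k (s1 t) (P1 t) (H1 t)
         - div_term phi i k (s2 t) (P2 t) (H2 t)) @[t --> F]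
    --> phi (s0, 0) * Th i k.
Proof.
move=> cphi hs1 hs2 hP1 hP2 hH2 hs hP hH.
have hP1' j : P1 t 0 j @[t --> F] --> (0 : R) by have := hP1 j; rewrite mxE.
have hP2' j : P2 t 0 j @[t --> F] --> (0 : R) by have := hP2 j; rewrite mxE.
have c1 := Ck_derive e_mu cphi.
have c2 m := Ck_derive (e_eta m) cphi.
pose t1 t := c t * ('D_e_mu phi (s1 t, P1 t) * (P1 t 0 i * P1 t 0 k)
   - 'D_e_mu phi (s2 t, P2 t) * (P2 t 0 i * P2 t 0 k)).
pose t2 m t := c t * ('D_(e_eta m) phi (s1 t, P1 t) * (H1 t i m * P1 t 0 k)
   - 'D_(e_eta m) phi (s2 t, P2 t) * (H2 t i m * P2 t 0 k)).
pose t3 t := c t * (phi (s1 t, P1 t) * H1 t i k - phi (s2 t, P2 t) * H2 t i k).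
have E : (fun t => c t * (div_term phi i k (s1 t) (P1 t) (H1 t)
         - div_term phi i k (s2 t) (P2 t) (H2 t))) =
   (fun t => t1 t + \sum_m t2 m t + t3 t).
  apply/funext => t; rewrite /t1 /t2 /t3 /div_term -mulr_sumr sumrB; ring.
have p0 f g : f t @[t --> F] --> (0 : R) -> g t @[t --> F] --> (0 : R) ->
    f t * g t @[t --> F] --> (0 : R).
  by move=> hf hg; rewrite -[X in _ --> X](mulr0 (0 : R)); exact: cvgM.
rewrite E (_ : phi (s0, 0) * Th i k = 'D_e_mu phi (s0, 0) * 0 +
  \sum_m 'D_(e_eta m) phi (s0, 0) * 0 + phi (s0, 0) * Th i k); last first.
  by rewrite mulr0 add0r big1 ?add0r // => m _; rewrite mulr0.
apply: cvgD; first apply: cvgD.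
- apply: (cvg_product_increment c1 hs1 hP1 hs2 hP2 hs hP); first exact: p0.
  exact: (cvg_mul_increment _ (hP1' k) (hP2' i) (hP i) (hP k)).
- apply: cvg_sum_fin => m.
  apply: (cvg_product_increment (c2 m) hs1 hP1 hs2 hP2 hs hP); first exact: p0.
  exact: (cvg_mul_increment _ (hP1' k) (hH2 i m) (hH i m) (hP k)).
- have cphi1 : Ck 1 phi := CkW cphi.
  exact: (cvg_product_increment cphi1 hs1 hP1 hs2 hP2 hs hP (hH2 i k) (hH i k)).
Qed.

(** Orders along the curve, with P = O(t) and H = o(t): D_mu phi is O(t^k) against P P = o(t), D_eta
    phi is O(t^(k-1)) against H P = o(t^2), and phi is O(t^k) against H. Each product is o(t^(k+1));
    for k = 0 the middle one is even o(t^2). *)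
Lemma cvg_div_term_vanishing phi i j k m (mu0 : R) (om : 'rV[R]_n)
    (s : R -> R) (P : R -> 'rV[R]_n) (H : R -> 'M[R]_n) :
  Ck k.+2 phi -> (\forall mu \near mu0, vanishes_at k phi mu) -> (m <= k.+1)%N ->
  s t @[t --> (0 : R)^'] --> mu0 ->
  (forall i, t^-1 * P t 0 i @[t --> (0 : R)^'] --> om 0 i) ->
  (forall i j, t^-1 * H t i j @[t --> (0 : R)^'] --> (0 : R)) ->
  (t ^+ m)^-1 * div_term phi i j (s t) (P t) (H t) @[t --> (0 : R)^'] --> (0 : R).
Proof.
move=> cphi van mk hs hP hH.
have ck : Ck k phi by apply: Ck_le cphi; rewrite leqW.
have ck1 : Ck k.+1 phi by exact: CkW.
have [C _ HC] := vanishing_bound ck van.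
have [C1 _ HC1] := vanishing_bound (Ck_derive e_mu ck1) (vanishes_mu ck van).
have hP0 i' : P t 0 i' @[t --> (0 : R)^'] --> (0 : R).
  by have := cvg_curve0 hP (i := i'); rewrite mxE.
pose t1 t := (t ^+ m)^-1 * ('D_e_mu phi (s t, P t) * (P t 0 i * P t 0 j)).
pose t2 q t := (t ^+ m)^-1 * ('D_(e_eta q) phi (s t, P t) * (H t i q * P t 0 j)).
pose t3 t := (t ^+ m)^-1 * (phi (s t, P t) * H t i j).
have -> : (fun t => (t ^+ m)^-1 * div_term phi i j (s t) (P t) (H t)) =
    (fun t => t1 t + \sum_q t2 q t + t3 t).
  by apply/funext => t; rewrite /t1 /t2 /t3 /div_term -mulr_sumr; ring.
suff : t1 t + \sum_q t2 q t + t3 t @[t --> (0 : R)^'] --> (0 : R) + \sum_(q < n) 0 + 0.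
  by rewrite big1_eq !addr0.
apply: cvgD; first apply: cvgD.
- apply: (cvg_vanishing_term hs hP (i := 1) _ HC1); first by rewrite add1n.
  rewrite (_ : (fun t => _) = (fun t => t^-1 * P t 0 i * P t 0 j)); last first.
    by apply/funext => t; rewrite expr1 mulrA.
  by rewrite -[X in _ --> X](mulr0 (om 0 i)); apply: cvgM.
- apply: cvg_sum_fin => q.
  have [||C2 _ HC2] := @vanishing_bound _ _ k.-1 ('D_(e_eta q) phi) mu0.
  + by apply: Ck_le (Ck_derive _ ck1); exact: leq_pred.
  + by apply: filterS van => mu Hmu; exact: (vanishes_eta q Hmu).
  apply: (cvg_vanishing_term hs hP (i := 2) _ HC2).
    by apply: leq_trans mk _; rewrite add2n ltnS leqSpred.
  rewrite (_ : (fun t => _) = (fun t => t^-1 * H t i q * (t^-1 * P t 0 j))); last first.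
    by apply/funext => t; rewrite expr2 invfM mulrACA.
  by rewrite -[X in _ --> X](mul0r (om 0 j)); apply: cvgM.
- apply: (cvg_vanishing_term hs hP (i := 1) _ HC); first by rewrite add1n.
  by rewrite (_ : (fun t => _) = (fun t => t^-1 * H t i j)).
Qed.

End DivergenceTerms.

(** * Explicit solutions, uniqueness for frozen coefficients, and the expanded equation *)

Section Towers.
Context {R : realType} {n : nat}.
Variables (Om : set 'rV[R]_n) (al : R).
Hypotheses (n0 : (0 < n)%N) (oOm : open Om) (neOm : Om !=set0) (bOm : bounded_set Om).
Implicit Types (a : R * 'rV[R]_n -> 'M[R]_n) (u v : 'rV[R]_n -> R) (x om : 'rV[R]_n).

Definition hess u x : 'M[R]_n := \matrix_(i, k) pd i (pd k u) x.

Lemma hessE u x i k : hess u x i k = pd i (pd k u) x.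
Proof. by rewrite mxE. Qed.

Lemma gradE u x i : grad u x 0 i = pd i u x.
Proof. by rewrite mxE. Qed.

Lemma pd_cst (c : R) i : pd i (fun _ : 'rV[R]_n => c) = fun=> 0.
Proof. by apply/funext => x; exact: derive_cst. Qed.

Lemma has_cont_ext_cst (c : R) : has_cont_ext Om (fun=> c).
Proof. by exists (fun=> c) => //; apply: continuous_subspaceT; exact: cst_continuous. Qed.

Lemma C2_closure_cst (c : R) : C2_closure Om (fun=> c).
Proof.
split.
- by apply: continuous_subspaceT; exact: cst_continuous.
- by move=> i x _; exact: derivable_cst.
- by move=> i j x _; rewrite pd_cst; exact: derivable_cst.
- by move=> i; rewrite pd_cst; exact: has_cont_ext_cst.
- by move=> i j; rewrite !pd_cst; exact: has_cont_ext_cst.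
Qed.

Lemma C2al_cst (c : R) : C2al Om al (fun=> c).
Proof.
have [h1 h2 h3 h4 h5] := C2_closure_cst c; split=> // i j; split; first exact: h5.
rewrite !pd_cst; apply: (@le_lt_trans _ _ 0%E); last exact: ltry.
apply: ge_ereal_sup => _ [z _ <-].
by rewrite subrr normr0 mul0r.
Qed.

Lemma is_derive_dot om x (v : 'rV[R]_n) :
  is_derive x v (fun y => dot y om) (dot v om).
Proof.
have H : h^-1 *: (((fun y => dot y om) \o shift x) (h *: v) - dot x om)
    @[h --> 0^'] --> dot v om.
  apply: (@near_dnbhs_cvg _ _ (fun=> dot v om)); last exact: cvg_cst.
  move=> h h0; rewrite /= /dot -sumrB scaler_sumr; apply: eq_bigr => i _.
  by rewrite !mxE mulrDl addrK -mulrA /GRing.scale /= mulKf.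
by split; [apply/cvg_ex; eexists; exact: H | exact: cvg_lim H].
Qed.

Lemma pd_dot om i : pd i (fun y => dot y om) = fun=> om 0 i.
Proof.
apply/funext => x; rewrite /pd (@derive_val _ _ _ _ _ _ _ (is_derive_dot _ _ _)).
rewrite /dot (bigD1 i) //= big1 ?addr0 => [|j ji]; rewrite !mxE !eqxx ?mul1r //=.
by rewrite (negPf ji) mul0r.
Qed.

Lemma C2_closure_dot om : C2_closure Om (fun y => dot y om).
Proof.
split.
- apply: continuous_subspaceT => x.
  apply: (@cvg_sum_fin _ _ _ (nbhs_filter x)) => i.
  by apply: cvgM; [exact: coord_continuous | exact: cvg_cst].
- by move=> i x _; exact: (@ex_derive _ _ _ _ _ _ _ (is_derive_dot _ _ _)).
- by move=> i j x _; rewrite pd_dot; exact: derivable_cst.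
- by move=> i; rewrite pd_dot; exact: has_cont_ext_cst.
- by move=> i j; rewrite pd_dot pd_cst; exact: has_cont_ext_cst.
Qed.

Lemma pd2_comb c f g k i j x :
  C2_closure Om f -> C2_closure Om g -> C2_closure Om k -> Om x ->
  pd j (pd i (comb c f g k)) x = c * (pd j (pd i f) x - pd j (pd i g) x) - pd j (pd i k) x.
Proof.
move=> Cf Cg Ck Omx.
exact: (@derive_val _ _ _ _ _ _ _ (is_derive_pd_comb oOm c i j Cf Cg Ck Omx)).
Qed.

Lemma elliptic_uniqueness (U A : 'M[R]_n) (g : 'I_n -> R) u v :
  U^T *m U = 1%:M -> (forall i, 0 < g i) -> A = U *m diag_mx (\row_i g i) *m U^T ->
  C2_closure Om u -> C2_closure Om v ->
  (forall x, Om x ->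
     \sum_i \sum_k A i k * (pd i (pd k u) x - pd i (pd k v) x) = 0) ->
  (forall x, boundary Om x -> u x = v x) -> forall x, closure Om x -> u x = v x.
Proof.
move=> UU g0 AE Cu Cv eq bd.
have le u1 u2 : C2_closure Om u1 -> C2_closure Om u2 ->
    (forall x, Om x ->
      \sum_i \sum_k A i k * (pd i (pd k u1) x - pd i (pd k u2) x) = 0) ->
    (forall x, boundary Om x -> u1 x = u2 x) -> forall x, closure Om x -> u1 x <= u2 x.
  move=> C1 C2 eq12 bd12 x cx.
  (* [comb 1 u1 u2 0] is the difference u1 - u2, whose regularity is thus already established. *)
  have C12 := C2_closure_comb oOm 1 C1 C2 (C2_closure_cst 0).
  have [cC _ _ _ _] := C12.
  have : comb 1 u1 u2 (fun=> 0) x <= 0.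
    apply: (weak_maximum_principle n0 oOm bOm UU g0 AE cC _ _ _ cx).
    - exact: C2_closure_on.
    - move=> y Omy; rewrite -[RHS](eq12 y Omy).
      apply: eq_bigr => i _; apply: eq_bigr => k _.
      have E := @pd2_comb 1 u1 u2 (fun=> 0) k i y C1 C2 (C2_closure_cst 0) Omy.
      by rewrite E !pd_cst mul1r subr0.
    - by move=> y /bd12; rewrite /comb => ->; rewrite subrr mulr0 subr0.
  by rewrite /comb mul1r subr0 subr_le0.
move=> x cx; apply/eqP; rewrite eq_le; apply/andP; split.
  exact: (le u v Cu Cv eq bd x cx).
apply: (le v u Cv Cu _ _ x cx) => [y Omy|y /bd -> //].
transitivity (- \sum_i \sum_k A i k * (pd i (pd k u) y - pd i (pd k v) y)).
  rewrite -sumrN; apply: eq_bigr => i _; rewrite -sumrN; apply: eq_bigr => k _.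
  by rewrite -mulrN opprB.
by rewrite eq // oppr0.
Qed.

(** Functions on the closure are represented by total functions, and two representatives of one
    solution may differ elsewhere. *)
Lemma solution_ext a lam om tau u v : C2al Om al v ->
  (forall x, closure Om x -> v x = u x) ->
  solution Om al a lam om tau u -> solution Om al a lam om tau v.
Proof.
move=> Cv uv [Cu equ bdu].
have uvO x : Om x -> v x = u x by move=> Omx; apply: uv; exact: subset_closure.
have nOm x : Om x -> \forall y \near x, Om y by move=> Omx; exact: open_nbhs_nbhs.
have pdE i x : Om x -> pd i v x = pd i u x.
  by move=> Omx; apply: near_eq_derive; apply: filterS (nOm x Omx) => y /uvO.
have gradE y : Om y -> grad v y = grad u y.
  by move=> Omy; apply/rowP => j; rewrite !mxE pdE.
split; [exact: Cv | move=> x Omx | move=> x bx]; last first.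
  by rewrite uv; [exact: bdu | case: bx].
apply: etrans (equ x Omx); apply: (congr1 -%R); apply: eq_bigr => i _.
apply: near_eq_derive; apply: filterS (nOm x Omx) => y Omy.
by apply: eq_bigr => k _; rewrite (uvO y Omy) (pdE k y Omy) (gradE y Omy).
Qed.

Lemma conormal_flux_ext a nu u v x : (forall k, has_cont_ext Om (pd k u)) ->
  closure Om x -> (forall y, closure Om y -> u y = v y) ->
  conormal_flux Om a nu u x = conormal_flux Om a nu v x.
Proof.
move=> hu cx uv.
have nOm y : Om y -> \forall z \near y, Om z by move=> Omy; exact: open_nbhs_nbhs.
have bE : bgrad Om u x = bgrad Om v x.
  apply/rowP => k; rewrite !mxE; apply: cont_ext_eq => // y Omy.
  apply: near_eq_derive; apply: filterS (nOm y Omy) => z Omz.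
  by apply: uv; exact: subset_closure.
by rewrite /conormal_flux bE uv.
Qed.

Lemma solution_cst a lam om : solution Om al a lam om 0 (fun=> lam).
Proof.
split=> [|x _|x _]; [exact: C2al_cst| |by rewrite mul0r addr0].
rewrite big1 ?oppr0 // => i _.
rewrite (_ : (fun y => _) = fun=> 0) ?pd_cst //.
by apply/funext => y; rewrite big1 // => k _; rewrite pd_cst mulr0.
Qed.

Lemma solution_div_term a lam om tau u x : (forall i k, Ck 1 (fun z => a z i k)) ->
  solution Om al a lam om tau u -> Om x ->
  \sum_i \sum_k div_term (fun z => a z i k) i k (u x) (grad u x) (hess u x) = 0.
Proof.
move=> ca [[_ d1 d2 _ _] eq _] Omx.
have := eq x Omx; move/eqP; rewrite oppr_eq0 => /eqP E.
apply: etrans _ E; apply: eq_bigr => i _; apply/esym.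
have dM k : is_derive x (delta_mx 0 i) (fun y => a (u y, grad u y) i k * pd k u y)
    (a (u x, grad u x) i k * pd i (pd k u) x + pd k u x *
      'D_(pd i u x, \row_m pd i (pd m u) x) (fun z => a z i k) (u x, grad u x)).
  apply: is_deriveM.
    apply: (is_derive_comp_pair (ca i k)); first exact: derivableP (d1 i x Omx).
    move=> m; rewrite (_ : (fun y => grad u y 0 m) = pd m u).
      exact: derivableP (d2 m i x Omx).
    by apply/funext => y; rewrite mxE.
  exact: derivableP (d2 k i x Omx).
have H := @is_derive_sum _ _ _ n _ _ _ _ dM.
rewrite /pd (_ : (fun y => _) =
    \sum_(k < n) (fun y => a (u y, grad u y) i k * pd k u y)); last first.
  by apply/funext => y; rewrite fct_sumE.
rewrite (@derive_val _ _ _ _ _ _ _ H); apply: eq_bigr => k _.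
rewrite derive_pair // /div_term /hess !mxE.
rewrite mulrDr mulr_sumr addrC; congr (_ + _ + _); first by ring.
by apply: eq_bigr => m _; rewrite !mxE; ring.
Qed.

End Towers.

Section Expansion.
Context {R : realType} {n : nat}.
Variables (Om : set 'rV[R]_n) (al : R).
Hypotheses (n0 : (0 < n)%N) (oOm : open Om) (neOm : Om !=set0) (bOm : bounded_set Om).
Implicit Types (a : R * 'rV[R]_n -> 'M[R]_n) (u v : 'rV[R]_n -> R) (x om : 'rV[R]_n)
  (L : ('rV[R]_n -> R) -> R) (w : nat -> R -> 'rV[R]_n -> R).

Local Notation jet := (jet_functional Om al).

Lemma jet_pd_in i x : Om x -> jet (fun f => pd i f x).
Proof.
move=> Omx; split=> [c f g k Cf Cg Ck|f e Cf].
  exact: (pd_comb c i Cf Cg Ck Omx).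
by move=> /(C2al_norm_bounds n0 oOm neOm)[_ fe _]; exact: fe.
Qed.

Lemma near_Om x : Om x -> \forall y \near x, Om y.
Proof. by move=> Omx; exact: open_nbhs_nbhs. Qed.

Lemma pd_ext i u v x : (forall y, closure Om y -> u y = v y) -> Om x ->
  pd i u x = pd i v x.
Proof.
move=> uv Omx; apply: near_eq_derive; apply: filterS (near_Om Omx) => y Omy.
by apply: uv; exact: subset_closure.
Qed.

Lemma pd2_ext i j u v x : (forall y, closure Om y -> u y = v y) -> Om x ->
  pd j (pd i u) x = pd j (pd i v) x.
Proof.
move=> uv Omx; apply: near_eq_derive; apply: filterS (near_Om Omx) => y Omy.
exact: pd_ext.
Qed.

Lemma cont_ext_pd_ext i u v x : (forall y, closure Om y -> u y = v y) ->
  has_cont_ext Om (pd i u) -> closure Om x ->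
  cont_ext Om (pd i u) x = cont_ext Om (pd i v) x.
Proof. by move=> uv hu cx; apply: cont_ext_eq => // y Omy; exact: pd_ext. Qed.

(* [w j t] is the j-th tau-derivative of the solution at tau = t. *)
Definition tower a l (lam : R) om (e : R) w : Prop :=
  [/\ 0 < e,
      forall t, `|t| < e -> solution Om al a lam om t (w 0%N t),
      forall t k, `|t| < e -> (k <= l)%N -> C2_closure Om (w k t),
      forall L, jet L -> forall k t, (k < l)%N -> `|t| < e ->
        is_derive t (1 : R) (fun s => L (w k s)) (L (w k.+1 t)) &
      forall x, closure Om x -> w 0%N 0 x = lam].

(** Well-posedness supplies some C^l family of solutions. Uniqueness identifies it on the closure
    with the given u, about whose dependence on tau nothing is assumed, and at tau = 0 with the
    constant [lam]. *)
Lemma tower_exists a l lam om (e : R) (u : R -> 'rV[R]_n -> R) : 0 < e ->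
  wellposed_radius Om al a l lam e -> sphere om ->
  (forall t, - e < t < e -> unique_solution Om al a lam om t (u t)) ->
  exists2 w, tower a l lam om e w &
    forall t x, `|t| < e -> closure Om x -> w 0%N t x = u t x.
Proof.
move=> e0 wp som uu; have [u' [uu' cu']] := wp om som.
have [w [w0 Cw Dw]] := Cl_curve_jet oOm cu'.
have w0' t : `|t| < e -> forall x, closure Om x -> w 0%N t x = u' t x.
  by move=> te; apply: w0; rewrite -ltr_norml.
exists w; last first.
  move=> t x te cx; rewrite w0' //; rewrite ltr_norml in te.
  have [_ uniq] := uu' t te; have [su _] := uu t te.
  by rewrite (uniq _ su).
split=> //.
- move=> t te; have te' := te; rewrite ltr_norml in te'.
  have [su _] := uu' t te'.
  apply: (solution_ext oOm _ _ su); last exact: w0'.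
  exact: (Cw t te' 0%N).
- by move=> t k te kl; apply: C2al_C2_closure; apply: Cw; rewrite // -ltr_norml.
- move=> x cx; rewrite w0' ?normr0 //.
  have [_ uniq] := uu' 0 ltac:(by rewrite oppr_lt0 e0).
  by rewrite -(uniq _ (solution_cst _ _ _ lam om) x cx).
Qed.

Section Tower.
Variables (a : R * 'rV[R]_n -> 'M[R]_n) (l : nat) (lam : R) (om : 'rV[R]_n) (e : R)
  (w : nat -> R -> 'rV[R]_n -> R).
Hypotheses (tw : tower a l.+1 lam om e w).

Lemma tower_first L : jet L ->
  t^-1 * (L (w 0%N t) - L (w 0%N 0)) @[t --> (0 : R)^'] --> L (w 1%N 0).
Proof.
move=> jL; have [e0 _ _ dw _] := tw.
have [] := dw L jL 0%N 0 isT ltac:(by rewrite normr0); rewrite /derivable /derive => d <-.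
apply: (@near_dnbhs_cvg _ _ (fun h : R => h^-1 * (L (w 0%N (h *: 1 + 0)) - L (w 0%N 0))));
  last exact: d.
by move=> t _; rewrite addr0 [t *: _]mulr1.
Qed.

Lemma tower_cvg L : jet L -> L (w 0%N t) @[t --> (0 : R)^'] --> L (w 0%N 0).
Proof.
move=> /tower_first H.
have H0 := @cvg0_of_quotient _ (fun t => L (w 0%N t) - L (w 0%N 0)) _ 0 H.
have E t : L (w 0%N t) = t ^+ 0 * (L (w 0%N t) - L (w 0%N 0)) + L (w 0%N 0).
  by rewrite mul1r subrK.
rewrite (funext E) -[X in _ --> X]add0r; apply: cvgD => //; exact: cvg_cst.
Qed.

Lemma tower_pd0 i x : Om x -> pd i (w 0%N 0) x = 0.
Proof.
have [_ _ _ _ w0] := tw; move=> Omx.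
by rewrite (pd_ext i (v := fun=> lam)) // pd_cst.
Qed.

Lemma tower_pd20 i j x : Om x -> pd j (pd i (w 0%N 0)) x = 0.
Proof.
have [_ _ _ _ w0] := tw; move=> Omx.
by rewrite (pd2_ext i j (v := fun=> lam)) // !pd_cst.
Qed.

Lemma tower_C2 k : (k <= l.+1)%N -> C2_closure Om (w k 0).
Proof. by have [e0 _ C _ _] := tw => kl; apply: C => //; rewrite normr0. Qed.

Lemma cont_ext_0 x : closure Om x -> cont_ext Om (fun=> 0) x = 0.
Proof.
by move=> cx; apply: (cont_extE (g := fun=> 0)) => //;
   apply: continuous_subspaceT; exact: cst_continuous.
Qed.

Lemma tower_cont_ext_pd0 i x : closure Om x -> cont_ext Om (pd i (w 0%N 0)) x = 0.
Proof.
have [_ _ _ _ w0] := tw; move=> cx.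
rewrite (cont_ext_pd_ext (v := fun=> lam)) ?pd_cst ?cont_ext_0 //.
by have [_ _ _ + _] := tower_C2 (leq0n _); exact.
Qed.

Lemma tower_first_pd i x : Om x ->
  t^-1 * pd i (w 0%N t) x @[t --> (0 : R)^'] --> pd i (w 1%N 0) x.
Proof.
move=> Omx; have := tower_first (jet_pd_in i Omx); rewrite tower_pd0 //.
by rewrite (_ : (fun t => _) = fun t => t^-1 * pd i (w 0%N t) x) //;
   apply/funext => t; rewrite subr0.
Qed.

Lemma tower_first_pd2 i j x : Om x ->
  t^-1 * pd j (pd i (w 0%N t)) x @[t --> (0 : R)^'] --> pd j (pd i (w 1%N 0)) x.
Proof.
move=> Omx; have := tower_first (jet_pd2 al n0 oOm neOm i j Omx); rewrite tower_pd20 //.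
by rewrite (_ : (fun t => _) = fun t => t^-1 * pd j (pd i (w 0%N t)) x) //;
   apply/funext => t; rewrite subr0.
Qed.

Lemma tower_first_cont_ext_pd i x : closure Om x ->
  t^-1 * cont_ext Om (pd i (w 0%N t)) x @[t --> (0 : R)^'] -->
  cont_ext Om (pd i (w 1%N 0)) x.
Proof.
move=> cx; have := tower_first (jet_pd al n0 oOm neOm i cx).
rewrite tower_cont_ext_pd0 //.
by rewrite (_ : (fun t => _) = fun t => t^-1 * cont_ext Om (pd i (w 0%N t)) x) //;
   apply/funext => t; rewrite subr0.
Qed.

End Tower.
End Expansion.

(** * The first tau-derivative of a solution *)

Section FirstOrder.
Context {R : realType} {n : nat}.
Variables (Om : set 'rV[R]_n) (al : R).
Hypotheses (n0 : (0 < n)%N) (oOm : open Om) (neOm : Om !=set0) (bOm : bounded_set Om).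
Variables (a : R * 'rV[R]_n -> 'M[R]_n) (l : nat) (lam : R) (om : 'rV[R]_n) (e : R)
  (w : nat -> R -> 'rV[R]_n -> R).
Hypotheses (tw : tower Om al a l.+1 lam om e w) (ca : forall i k, Ck 2 (fun z => a z i k))
  (sa : exists l', spectral_form l' a).

Lemma near_lt_dnbhs0 : \forall t \near (0 : R)^', `|t| < e.
Proof. by have [e0 _ _ _ _] := tw; exact: dnbhs0_lt. Qed.

Lemma div_term_const (phi : R * 'rV[R]_n -> R) i k (s : R) :
  div_term phi i k s 0 0 = 0.
Proof.
rewrite /div_term !mxE !mul0r !mulr0 add0r addr0 big1 // => m _.
by rewrite !mxE mul0r mulr0.
Qed.

Lemma tower_div_term x t : Om x -> `|t| < e ->
  \sum_i \sum_k div_term (fun z => a z i k) i k (w 0%N t x) (grad (w 0%N t) x)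
    (hess (w 0%N t) x) = 0.
Proof.
move=> Omx te; have [_ sol _ _ _] := tw.
exact: (solution_div_term (fun i k => CkW (@ca i k)) (sol t te) Omx).
Qed.

Lemma tower_value_cvg x : closure Om x -> w 0%N t x @[t --> (0 : R)^'] --> lam.
Proof.
have [_ _ _ _ w0] := tw; move=> cx; rewrite -(w0 x cx).
exact: (tower_cvg tw (jet_value al n0 oOm neOm cx)).
Qed.

(** The solution is compared with the constant [lam], for which every [div_term] is 0; dividing by t
    freezes the coefficients in the limit. *)
Lemma tower_equation_order1 x : Om x ->
  \sum_i \sum_k a (lam, 0) i k * pd i (pd k (w 1%N 0)) x = 0.
Proof.
move=> Omx; have cx : closure Om x := subset_closure Omx.
have H i k : t^-1 * (div_term (fun z => a z i k) i k (w 0%N t x) (grad (w 0%N t) x)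
     (hess (w 0%N t) x) - div_term (fun z => a z i k) i k lam 0 0)
    @[t --> (0 : R)^'] --> a (lam, 0) i k * (hess (w 1%N 0) x) i k.
  have [_ _ _ _ w0] := tw.
  apply: (@cvg_div_term_increment _ _ _ _ _ (fun z => a z i k) i k
    (fun t => w 0%N t x) (fun=> lam) (fun t => grad (w 0%N t) x) (fun=> 0)
    (fun t => hess (w 0%N t) x) (fun=> 0) lam (fun t => t^-1) (w 1%N 0 x)
    (fun i => pd i (w 1%N 0) x) (fun i j => hess (w 1%N 0) x i j)).
  - exact: ca.
  - exact: tower_value_cvg.
  - exact: cvg_cst.
  - move=> j; rewrite mxE; under eq_fun do rewrite mxE.
    by have := tower_cvg tw (jet_pd_in al n0 oOm neOm j Omx); rewrite (tower_pd0 oOm tw j Omx).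
  - by move=> j; exact: cvg_cst.
  - by move=> j m; rewrite mxE; exact: cvg_cst.
  - by have := tower_first tw (jet_value al n0 oOm neOm cx); rewrite w0.
  - move=> j; under eq_fun do rewrite !mxE subr0.
    exact: (tower_first_pd n0 oOm neOm tw (i := j) Omx).
  - move=> j m; under eq_fun do rewrite !mxE subr0; rewrite mxE.
    exact: (tower_first_pd2 n0 oOm neOm tw (i := m) (j := j) Omx).
have S : \sum_i \sum_k t^-1 * (div_term (fun z => a z i k) i k (w 0%N t x)
     (grad (w 0%N t) x) (hess (w 0%N t) x) - div_term (fun z => a z i k) i k lam 0 0)
    @[t --> (0 : R)^'] --> \sum_i \sum_k a (lam, 0) i k * (hess (w 1%N 0) x) i k.
  by apply: cvg_sum_fin => i; apply: cvg_sum_fin => k; exact: H.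
have Z : (fun=> 0 : R) t @[t --> (0 : R)^'] -->
    \sum_i \sum_k a (lam, 0) i k * (hess (w 1%N 0) x) i k.
  apply: cvg_near_eq S.
  have := near_lt_dnbhs0; apply: filterS => t te; apply/esym.
  rewrite -[RHS](mulr0 t^-1) -[X in _ = _ * X](tower_div_term Omx te) mulr_sumr.
  apply: eq_bigr => i _; rewrite mulr_sumr; apply: eq_bigr => k _.
  by rewrite div_term_const subr0.
have := cvg_unique (@Rhausdorff R) Z (cvg_cst (0 : R)).
move=> E; rewrite -[RHS]E; apply: eq_bigr => i _; apply: eq_bigr => k _.
by rewrite mxE.
Qed.

Lemma tower_boundary1 x : boundary Om x -> w 1%N 0 x = dot x om.
Proof.
move=> bx; have cx : closure Om x by case: bx.
have [_ sol _ _ w0] := tw.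
have H := tower_first tw (jet_value al n0 oOm neOm cx).
have Z : dot x om @[t --> (0 : R)^'] --> w 1%N 0 x.
  apply: (cvg_near_eq _ H).
  have n1 : \forall t \near (0 : R)^', t != 0 by exact: withinT.
  apply: filterS2 near_lt_dnbhs0 n1 => t te tn0.
  have [_ _ bd] := sol t te.
  by rewrite bd // w0 // addrAC subrr add0r mulKf.
exact: (cvg_unique (@Rhausdorff R) Z (cvg_cst _)).
Qed.

Lemma tower_order1 x : closure Om x -> w 1%N 0 x = dot x om.
Proof.
have [l' sp] := sa.
have [U [g [UU g0 AE]]] := spectral_diagonalization (lam, 0) sp.
apply: (elliptic_uniqueness (u := w 1%N 0) (v := fun y => dot y om) n0 oOm bOm UU g0 AE).
- exact: (tower_C2 tw).
- exact: C2_closure_dot.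
- move=> y Omy; rewrite -[RHS](tower_equation_order1 Omy).
  apply: eq_bigr => i _; apply: eq_bigr => k _.
  by rewrite pd_dot pd_cst subr0.
- exact: tower_boundary1.
Qed.

Lemma tower_quotient_pd i x : Om x ->
  t^-1 * pd i (w 0%N t) x @[t --> (0 : R)^'] --> om 0 i.
Proof.
move=> Omx; have := tower_first_pd n0 oOm neOm tw (i := i) Omx.
by rewrite (pd_ext oOm i tower_order1 Omx) pd_dot.
Qed.

Lemma tower_quotient_pd2 i j x : Om x ->
  t^-1 * pd j (pd i (w 0%N t)) x @[t --> (0 : R)^'] --> (0 : R).
Proof.
move=> Omx; have := tower_first_pd2 n0 oOm neOm tw (i := i) (j := j) Omx.
by rewrite (pd2_ext oOm i j tower_order1 Omx) pd_dot pd_cst.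
Qed.

Lemma tower_quotient_cont_ext_pd i x : closure Om x ->
  t^-1 * cont_ext Om (pd i (w 0%N t)) x @[t --> (0 : R)^'] --> om 0 i.
Proof.
move=> cx; have := tower_first_cont_ext_pd n0 oOm neOm tw (i := i) cx.
have [_ _ _ h _] := tower_C2 tw (isT : (1 <= l.+1)%N).
rewrite (cont_ext_pd_ext oOm tower_order1 (h i) cx) pd_dot.
rewrite (cont_extE (g := fun=> om 0 i)) //.
by apply: continuous_subspaceT; exact: cst_continuous.
Qed.

End FirstOrder.

(** Here x1, x2 are entries of a1 at the first and second solution, y2 is the entry of a2 at the
    second, p1, p2 are gradient components, d = b(lam, t omega) and o is a component of omega. The
    right side isolates three errors: the change of solution, of gradient, and of the argument of
    b. *)
Lemma flux_identity (R : realType) (c t x1 p1 x2 y2 p2 d o : R) :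
  c * (y2 * p2 - x1 * p1) + c * t * d * o =
  - (c * (x1 * p1 - x2 * p2)) - c * ((x2 - y2) * (p2 - t * o))
  - c * t * (x2 - y2 - d) * o.
Proof. by ring. Qed.

(** * Comparison of the two families of solutions *)

Section Comparison.
Context {R : realType} {n : nat}.
Variables (Om : set 'rV[R]_n) (al : R).
Hypotheses (n0 : (0 < n)%N) (oOm : open Om) (neOm : Om !=set0) (bOm : bounded_set Om).
Variables (a1 a2 : R * 'rV[R]_n -> 'M[R]_n) (l : nat) (lam : R) (om : 'rV[R]_n) (e : R)
  (w1 w2 : nat -> R -> 'rV[R]_n -> R) (k : nat).
Hypotheses (tw1 : tower Om al a1 l.+1 lam om e w1) (tw2 : tower Om al a2 l.+1 lam om e w2).
Hypotheses (ca1 : forall i j, Ck k.+2 (fun z => a1 z i j))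
  (ca2 : forall i j, Ck k.+2 (fun z => a2 z i j)).
Hypotheses (sa1 : exists l', spectral_form l' a1) (sa2 : exists l', spectral_form l' a2).
Hypothesis (kl : (k <= l)%N).

Let b i j (z : R * 'rV[R]_n) : R := a1 z i j - a2 z i j.

Hypothesis (van : forall i j, \forall mu \near lam, vanishes_at k (b i j) mu).

Let ca1' i j : Ck 2 (fun z => a1 z i j).
Proof. exact: (Ck_le (isT : (2 <= k.+2)%N) (@ca1 i j)). Qed.

Let ca2' i j : Ck 2 (fun z => a2 z i j).
Proof. exact: (Ck_le (isT : (2 <= k.+2)%N) (@ca2 i j)). Qed.

Let cb i j : Ck k.+2 (b i j).
Proof. exact: (CkB (@ca1 i j) (@ca2 i j)). Qed.

Lemma div_termB (phi psi : R * 'rV[R]_n -> R) i j s P H : Ck 1 phi -> Ck 1 psi ->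
  div_term (fun z => phi z - psi z) i j s P H = div_term phi i j s P H - div_term psi i j s P H.
Proof.
move=> cphi cpsi.
have E v z : 'D_v (fun z => phi z - psi z) z = 'D_v phi z - 'D_v psi z.
  by apply: (@deriveB _ _ _ phi psi); [exact: Ck_derivable cphi | exact: Ck_derivable cpsi].
rewrite /div_term E; under eq_bigr do rewrite E mulrBl.
by rewrite sumrB; ring.
Qed.

Lemma tower_difference_limit L m : jet_functional Om al L -> (m <= l.+1)%N ->
  (forall j, (j < m)%N -> L (w1 j 0) = L (w2 j 0)) ->
  (t ^+ m)^-1 * (L (w1 0%N t) - L (w2 0%N t)) @[t --> (0 : R)^'] -->
  (m`!%:R)^-1 * (L (w1 m 0) - L (w2 m 0)).
Proof.
move=> jL ml L0; have [e0 _ _ dw1 _] := tw1; have [_ _ _ dw2 _] := tw2.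
have dw j t : (j < l.+1)%N -> `|t| < e -> is_derive t (1 : R)
    (fun t => L (w1 j t) - L (w2 j t)) (L (w1 j.+1 t) - L (w2 j.+1 t)).
  by move=> jl te; apply: is_deriveB; [exact: dw1 | exact: dw2].
apply: (@peano_limit _ m (fun j t => L (w1 j t) - L (w2 j t)) e e0).
- by move=> j t jm te; apply: dw => //; exact: leq_trans ml.
- apply/differentiable_continuous/derivable1_diffP.
  have := dw 0%N 0 isT; rewrite normr0 => /(_ e0) H.
  exact: (@ex_derive _ _ _ _ _ _ _ H).
- by move=> j jm; rewrite L0 ?subrr.
Qed.

Lemma tower_agree_equation m x : (0 < m <= k.+1)%N ->
  (forall j x, (j < m)%N -> closure Om x -> w1 j 0 x = w2 j 0 x) -> Om x ->
  \sum_i \sum_j a1 (lam, 0) i j * (pd i (pd j (w1 m 0)) x - pd i (pd j (w2 m 0)) x) = 0.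
Proof.
move=> /andP[m0 mk] agree Omx; have cx : closure Om x := subset_closure Omx.
have ml : (m <= l.+1)%N by apply: leq_trans mk _.
pose c (t : R) := (t ^+ m)^-1.
have c0 i j : (m`!%:R)^-1 * (pd i (pd j (w1 m 0)) x - pd i (pd j (w2 m 0)) x) =
  (\matrix_(i, j) ((m`!%:R)^-1 * (pd i (pd j (w1 m 0)) x - pd i (pd j (w2 m 0)) x))) i j.
  by rewrite mxE.
have H i j : c t * (div_term (fun z => a1 z i j) i j (w1 0%N t x) (grad (w1 0%N t) x)
     (hess (w1 0%N t) x) - div_term (fun z => a1 z i j) i j (w2 0%N t x) (grad (w2 0%N t) x)
     (hess (w2 0%N t) x))
    @[t --> (0 : R)^'] --> a1 (lam, 0) i j *
      ((m`!%:R)^-1 * (pd i (pd j (w1 m 0)) x - pd i (pd j (w2 m 0)) x)).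
  rewrite c0.
  apply: (@cvg_div_term_increment _ _ _ _ _ (fun z => a1 z i j) i j
    (fun t => w1 0%N t x) (fun t => w2 0%N t x) (fun t => grad (w1 0%N t) x)
    (fun t => grad (w2 0%N t) x)
    (fun t => hess (w1 0%N t) x) (fun t => hess (w2 0%N t) x) lam c
    ((m`!%:R)^-1 * (w1 m 0 x - w2 m 0 x))
    (fun i => (m`!%:R)^-1 * (pd i (w1 m 0) x - pd i (w2 m 0) x)) _).
  - exact: ca1'.
  - exact: (tower_value_cvg n0 oOm neOm tw1 cx).
  - exact: (tower_value_cvg n0 oOm neOm tw2 cx).
  - move=> q; rewrite mxE; under eq_fun do rewrite mxE.
    by have := tower_cvg tw1 (jet_pd_in al n0 oOm neOm q Omx); rewrite (tower_pd0 oOm tw1 q Omx).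
  - move=> q; rewrite mxE; under eq_fun do rewrite mxE.
    by have := tower_cvg tw2 (jet_pd_in al n0 oOm neOm q Omx); rewrite (tower_pd0 oOm tw2 q Omx).
  - move=> q q'.
    rewrite (_ : (fun t => _) = (fun t => pd q (pd q' (w2 0%N t)) x)); last first.
      by apply/funext => t; rewrite hessE.
    by have := tower_cvg tw2 (jet_pd2 al n0 oOm neOm q' q Omx);
       rewrite (tower_pd20 oOm tw2 q' q Omx).
  - apply: (tower_difference_limit (jet_value al n0 oOm neOm cx) ml) => j' jm.
    exact: agree.
  - move=> q; under eq_fun do rewrite !gradE.
    apply: (tower_difference_limit (jet_pd_in al n0 oOm neOm q Omx) ml) => j' jm.
    exact: (pd_ext oOm q (fun y cy => agree j' y jm cy) Omx).
  - move=> q q'; rewrite mxE.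
    rewrite (_ : (fun t => _) =
      (fun t => c t * (pd q (pd q' (w1 0%N t)) x - pd q (pd q' (w2 0%N t)) x))); last first.
      by apply/funext => t; congr (c t * (_ - _)); exact: hessE.
    apply: (tower_difference_limit (jet_pd2 al n0 oOm neOm q' q Omx) ml) => j' jm.
    exact: (pd2_ext oOm q' q (fun y cy => agree j' y jm cy) Omx).
have B i j : c t * div_term (b i j) i j (w2 0%N t x) (grad (w2 0%N t) x) (hess (w2 0%N t) x)
    @[t --> (0 : R)^'] --> (0 : R).
  apply: (@cvg_div_term_vanishing _ _ (b i j) i j k m lam om
    (fun t => w2 0%N t x) (fun t => grad (w2 0%N t) x) (fun t => hess (w2 0%N t) x)).
  - exact: cb.
  - exact: van.
  - exact: mk.
  - exact: (tower_value_cvg n0 oOm neOm tw2 cx).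
  - move=> q; under eq_fun do rewrite mxE.
    exact: (tower_quotient_pd n0 oOm neOm bOm tw2 ca2' sa2 Omx).
  - move=> q q'.
    rewrite (_ : (fun t => _) = (fun t => t^-1 * pd q (pd q' (w2 0%N t)) x)).
      exact: (tower_quotient_pd2 n0 oOm neOm bOm tw2 ca2' sa2 q' q Omx).
    by apply/funext => t; rewrite hessE.
have S : \sum_i \sum_j (c t * (div_term (fun z => a1 z i j) i j (w1 0%N t x) (grad (w1 0%N t) x)
     (hess (w1 0%N t) x) - div_term (fun z => a1 z i j) i j (w2 0%N t x) (grad (w2 0%N t) x)
     (hess (w2 0%N t) x)) +
     c t * div_term (b i j) i j (w2 0%N t x) (grad (w2 0%N t) x) (hess (w2 0%N t) x))
    @[t --> (0 : R)^'] --> \sum_i \sum_j (a1 (lam, 0) i j *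
      ((m`!%:R)^-1 * (pd i (pd j (w1 m 0)) x - pd i (pd j (w2 m 0)) x)) + 0).
  by apply: cvg_sum_fin => i; apply: cvg_sum_fin => j; apply: cvgD; [exact: H | exact: B].
have Z : (fun=> 0 : R) t @[t --> (0 : R)^'] -->
   \sum_i \sum_j (a1 (lam, 0) i j *
      ((m`!%:R)^-1 * (pd i (pd j (w1 m 0)) x - pd i (pd j (w2 m 0)) x)) + 0).
  apply: cvg_near_eq S.
  have := near_lt_dnbhs0 tw1; apply: filterS => t te; apply/esym.
  have E1 := tower_div_term tw1 ca1' Omx te.
  have E2 := tower_div_term tw2 ca2' Omx te.
  have E3 := etrans (congr1 ( *%R (c t)) (congr2 (fun u v : R => u - v) E1 E2))
    (etrans (congr1 ( *%R (c t)) (subrr 0)) (mulr0 (c t))).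
  apply: etrans _ E3; rewrite /=.
  rewrite -sumrB mulr_sumr; apply: eq_bigr => i _.
  rewrite -sumrB mulr_sumr; apply: eq_bigr => j _.
  have := div_termB i j (w2 0%N t x) (grad (w2 0%N t) x) (hess (w2 0%N t) x)
    (CkW (ca1' i j)) (CkW (ca2' i j)).
  by rewrite -mulrDr => ->; rewrite addrA subrK.
have E := cvg_unique (@Rhausdorff R) Z (cvg_cst (0 : R)).
have m1 : (m`!%:R)^-1 != 0 :> R by rewrite invr_eq0 pnatr_eq0 -lt0n fact_gt0.
apply: (mulfI m1); rewrite mulr0 -[RHS]E mulr_sumr; apply: eq_bigr => i _.
by rewrite mulr_sumr; apply: eq_bigr => j _; rewrite addr0 mulrCA.
Qed.


Lemma tower_agree m x : (m <= k.+1)%N -> closure Om x -> w1 m 0 x = w2 m 0 x.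
Proof.
elim/ltn_ind: m x => m IH x mk cx.
have [m0|m0] := posnP m.
  by have [_ _ _ _ z1] := tw1; have [_ _ _ _ z2] := tw2; rewrite m0 z1 ?z2.
have ml : (m <= l.+1)%N by apply: leq_trans mk _.
have agree j y : (j < m)%N -> closure Om y -> w1 j 0 y = w2 j 0 y.
  by move=> jm; apply: IH => //; exact: leq_trans (ltnW jm) mk.
have [l' sp] := sa1.
have [U [g [UU g0 AE]]] := spectral_diagonalization (lam, 0) sp.
apply: (elliptic_uniqueness (u := w1 m 0) (v := w2 m 0) n0 oOm bOm UU g0 AE) cx.
- exact: (tower_C2 tw1 ml).
- exact: (tower_C2 tw2 ml).
- by move=> y Omy; apply: tower_agree_equation => //; rewrite m0.
move=> y bdy; have cy : closure Om y by case: bdy.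
have H := tower_difference_limit (jet_value al n0 oOm neOm cy) ml
  (fun j jm => agree j y jm cy).
(* For small t both solutions have the same boundary values, so the quotient is identically 0
   there. *)
have Z : (fun=> 0 : R) t @[t --> (0 : R)^'] --> (m`!%:R)^-1 * (w1 m 0 y - w2 m 0 y).
  apply: cvg_near_eq H.
  have := near_lt_dnbhs0 tw1; apply: filterS => t te.
  have [_ sol1 _ _ _] := tw1; have [_ sol2 _ _ _] := tw2.
  have [_ _ bd1] := sol1 t te; have [_ _ bd2] := sol2 t te.
  by rewrite bd1 // bd2 // subrr mulr0.
have : (m`!%:R)^-1 * (w1 m 0 y - w2 m 0 y) = 0.
  exact: (cvg_unique (@Rhausdorff R) Z (cvg_cst (0 : R))).
move/eqP; rewrite mulf_eq0 invr_eq0 pnatr_eq0 eqn0Ngt fact_gt0 /=.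
by rewrite subr_eq0 => /eqP.
Qed.

Lemma bgradE u x i : bgrad Om u x 0 i = cont_ext Om (pd i u) x.
Proof. by rewrite mxE. Qed.

(** Agreement through order k + 1 inclusive makes solutions and boundary gradients differ by
    o(t^(k+1)), so the a1-fluxes differ by as little. Equality of the fluxes then leaves b(u2, grad
    u2) grad u2, in which (lam, t omega) and t omega may be substituted up to the same error. *)
Lemma tower_flux (nu : 'rV[R]_n -> 'rV[R]_n) x (e1 : R) : 0 < e1 -> closure Om x ->
  (forall t, `|t| < e1 ->
    conormal_flux Om a1 nu (w1 0%N t) x = conormal_flux Om a2 nu (w2 0%N t) x) ->
  \sum_i nu x 0 i * \sum_j (t ^+ k)^-1 * b i j (lam, t *: om) * om 0 j
    @[t --> (0 : R)^'] --> (0 : R).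
Proof.
move=> e10 cx fl.
pose P1 t := bgrad Om (w1 0%N t) x; pose P2 t := bgrad Om (w2 0%N t) x.
pose s1 t := w1 0%N t x; pose s2 t := w2 0%N t x.
pose c (t : R) := (t ^+ k.+1)^-1.
have agree m y : (m <= k.+1)%N -> closure Om y -> w1 m 0 y = w2 m 0 y.
  exact: tower_agree.
have hs1 : s1 t @[t --> (0 : R)^'] --> lam := tower_value_cvg n0 oOm neOm tw1 cx.
have hs2 : s2 t @[t --> (0 : R)^'] --> lam := tower_value_cvg n0 oOm neOm tw2 cx.
have hP1 i : P1 t 0 i @[t --> (0 : R)^'] --> (0 : 'rV[R]_n) 0 i.
  rewrite mxE; under eq_fun do rewrite bgradE.
  have := tower_cvg tw1 (jet_pd al n0 oOm neOm i cx).
  by rewrite (tower_cont_ext_pd0 oOm tw1 i cx).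
have hP2 i : P2 t 0 i @[t --> (0 : R)^'] --> (0 : 'rV[R]_n) 0 i.
  rewrite mxE; under eq_fun do rewrite bgradE.
  have := tower_cvg tw2 (jet_pd al n0 oOm neOm i cx).
  by rewrite (tower_cont_ext_pd0 oOm tw2 i cx).
have hP2t i : t^-1 * P2 t 0 i @[t --> (0 : R)^'] --> om 0 i.
  under eq_fun do rewrite bgradE.
  exact: (tower_quotient_cont_ext_pd n0 oOm neOm bOm tw2 ca2' sa2).
have ds : c t * (s1 t - s2 t) @[t --> (0 : R)^'] --> (0 : R).
  have := tower_difference_limit (jet_value al n0 oOm neOm cx)
    (kl : (k.+1 <= l.+1)%N) (fun j jk => agree j x (ltnW jk) cx).
  by rewrite agree // subrr mulr0.
have dP i : c t * (P1 t 0 i - P2 t 0 i) @[t --> (0 : R)^'] --> (0 : R).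
  have pdE m : (m <= k.+1)%N ->
      cont_ext Om (pd i (w1 m 0)) x = cont_ext Om (pd i (w2 m 0)) x.
    move=> mk; apply: (cont_ext_pd_ext oOm _ _ cx).
      by move=> y cy; exact: agree.
    by have [_ _ _ h _] := tower_C2 tw1 (leq_trans mk (kl : (k.+1 <= l.+1)%N)); exact: h.
  have := tower_difference_limit (jet_pd al n0 oOm neOm i cx)
    (kl : (k.+1 <= l.+1)%N) (fun j jk => pdE j (ltnW jk)).
  rewrite pdE // subrr mulr0.
  by rewrite (_ : (fun t => _) = (fun t => c t * (P1 t 0 i - P2 t 0 i))) //;
    apply/funext => t; rewrite !bgradE.
have H i j : c t * (a1 (s1 t, P1 t) i j * P1 t 0 j - a1 (s2 t, P2 t) i j * P2 t 0 j)
    @[t --> (0 : R)^'] --> a1 (lam, 0) i j * 0.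
  apply: (cvg_product_increment (CkW (ca1' i j)) hs1 hP1 hs2 hP2 ds dP).
    by have := hP2 j; rewrite mxE.
  exact: dP.
have B i j : c t * (b i j (s2 t, P2 t) * (P2 t 0 j - t * om 0 j))
    @[t --> (0 : R)^'] --> (0 : R).
  have [C _ HC] := vanishing_bound (Ck_le (leqW (leqnSn k)) (cb i j)) (van i j).
  apply: (cvg_vanishing_term hs2 hP2t (i := 1) _ HC); first by rewrite add1n.
  apply: (@near_dnbhs_cvg _ _ (fun t => t^-1 * P2 t 0 j - om 0 j)) => [t t0|].
    by rewrite expr1 mulrBr mulKf.
  rewrite -[X in _ --> X](subrr (om 0 j)).
  by apply: cvgB; [exact: hP2t | exact: cvg_cst].
have D i j : (t ^+ k)^-1 * (b i j (s2 t, P2 t) - b i j (lam, t *: om)) * om 0 j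
    @[t --> (0 : R)^'] --> 0 * om 0 j.
  apply: cvgM; last exact: cvg_cst.
  exact: (cvg_frozen_argument hs2 hP2t (CkW (cb i j)) (van i j)).
have S : \sum_i nu x 0 i * (\sum_j (
     c t * (a2 (s2 t, P2 t) i j * P2 t 0 j - a1 (s1 t, P1 t) i j * P1 t 0 j) +
     (t ^+ k)^-1 * b i j (lam, t *: om) * om 0 j)) @[t --> (0 : R)^'] -->
   \sum_i nu x 0 i * \sum_j (- (a1 (lam, 0) i j * 0) - 0 - 0 * om 0 j).
  apply: cvg_sum_fin => i; apply: cvgMr; apply: cvg_sum_fin => j.
  apply: (@near_dnbhs_cvg _ _ (fun t =>
    - (c t * (a1 (s1 t, P1 t) i j * P1 t 0 j - a1 (s2 t, P2 t) i j * P2 t 0 j))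
    - c t * (b i j (s2 t, P2 t) * (P2 t 0 j - t * om 0 j))
    - (t ^+ k)^-1 * (b i j (s2 t, P2 t) - b i j (lam, t *: om)) * om 0 j)) => [t t0|].
    have -> : (t ^+ k)^-1 = c t * t by rewrite /c exprS invfM mulrAC mulVf ?mul1r.
    exact: flux_identity.
  apply: cvgB; last exact: D.
  by apply: cvgB; [apply: cvgN; exact: H | exact: B].
have E0 : \sum_i nu x 0 i * \sum_j (- (a1 (lam, 0) i j * 0) - 0 - 0 * om 0 j) = 0.
  apply: big1 => i _; rewrite big1 ?mulr0 // => j _.
  by rewrite mulr0 mul0r !oppr0 !addr0.
rewrite E0 in S; apply: cvg_near_eq S.
have aux (p q d g : R) : p = q -> d * (q - p) + g = g.
  by move=> ->; rewrite subrr mulr0 add0r.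
have : \forall t \near (0 : R)^', `|t| < e1 by exact: dnbhs0_lt.
apply: filterS => t /fl; rewrite /conormal_flux => F.
apply/esym; transitivity (c t * (\sum_i \sum_j a2 (s2 t, P2 t) i j * P2 t 0 j * nu x 0 i
    - \sum_i \sum_j a1 (s1 t, P1 t) i j * P1 t 0 j * nu x 0 i) +
   \sum_i nu x 0 i * \sum_j (t ^+ k)^-1 * b i j (lam, t *: om) * om 0 j); last first.
  exact: aux F.
rewrite -sumrB mulr_sumr -big_split; apply: eq_bigr => i _ /=.
rewrite big_split mulrDr; congr (_ + _).
rewrite -sumrB !mulr_sumr; apply: eq_bigr => j _; ring.
Qed.

End Comparison.

(** * From the fluxes to the coefficients *)

Section OrderStep.
Context {R : realType} {n : nat}.
Local Notation V := (R * 'rV[R]_n)%type.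
Implicit Types (phi psi : V -> R) (vs : seq 'rV[R]_n) (eta om : 'rV[R]_n).

Lemma scale_eta (h mu : R) (v eta : 'rV[R]_n) :
  h *: ((0, v) : V) + (mu, eta) = (mu, h *: v + eta).
Proof. by congr pair; rewrite /= scaler0 add0r. Qed.

Lemma Ds_eta_ext phi psi (mu : R) vs :
  (forall eta, phi (mu, eta) = psi (mu, eta)) ->
  forall eta, Ds_eta vs phi (mu, eta) = Ds_eta vs psi (mu, eta).
Proof.
move=> E; elim: vs => [|v vs IH] //= eta.
pose q f (h : R) : R := h^-1 *: ((Ds_eta vs f \o shift (mu, eta)) (h *: ((0, v) : V))
  - Ds_eta vs f (mu, eta)).
have qE : q phi = q psi by apply/funext => h; rewrite /q /= scale_eta !IH.
by rewrite -[LHS]/(lim (q phi @ 0^')) qE.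
Qed.

(** The conclusion differentiates a matrix-valued function of eta alone, the proof scalar functions
    of (mu, eta) along directions (0, v); the difference quotients agree entry by entry. *)
Lemma D_etaE k (a : V -> 'M[R]_n) (mu : R) (vs : k.-tuple 'rV[R]_n) :
  (forall i j, Ck k (fun z => a z i j)) -> forall eta i j,
  D_eta k a mu eta vs i j = Ds_eta vs (fun z => a z i j) (mu, eta).
Proof.
case: vs => vs pvs ca; rewrite /D_eta /Dk /=.
have szvs : size vs = k by exact/eqP.
have {szvs ca pvs} : forall i j, Ck (size vs) (fun z => a z i j) by rewrite szvs.
elim: vs => [|v vs IH] //= ca eta i j.
set f := foldr _ _ vs.
have fE eta' i' j' : f eta' i' j' = Ds_eta vs (fun z => a z i' j') (mu, eta').
  by apply: IH => p q; exact: CkW (ca p q).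
have qE i' j' :
   (fun h : R => h^-1 *: (((fun y => f y i' j') \o shift eta) (h *: v) - f eta i' j')) =
   (fun h : R => h^-1 *: ((Ds_eta vs (fun z => a z i' j') \o shift (mu, eta)) (h *: ((0, v) : V))
      - Ds_eta vs (fun z => a z i' j') (mu, eta))).
  by apply/funext => h /=; rewrite scale_eta !fE.
have df i' j' : derivable (fun y => f y i' j') eta v.
  rewrite /derivable qE; apply: (@Ck_derivable _ _ 0).
  by apply: Ck_Ds; rewrite size_map addn1; exact: ca.
rewrite derive_mx; last by apply/derivable_mxP.
by rewrite mxE /derive qE.
Qed.

Lemma Ds_eta_multilinear k phi z : Ck k phi ->
  symmetric_multilinear k (fun vs => Ds_eta vs phi z).
Proof.
move=> cphi; split=> [u v c us usk|us v vs usk].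
  have cD : Ck 1 (Ds_eta us phi) by apply: Ck_Ds; rewrite size_map addn1 usk.
  have E : ((0, u + c *: v) : V) = (0, u) + c *: (0, v).
    by congr pair; rewrite /= scaler0 addr0.
  rewrite /Ds_eta /= -!/(Ds _ _) -!/(Ds_eta _ _) E derive_dirD //.
  by rewrite derive_dirZ.
rewrite /Ds_eta map_cat /= Ds_rot ?size_map ?usk //.
by rewrite map_cat.
Qed.

Lemma Ds_eta_radial_limit k phi (mu : R) (v : 'rV[R]_n) : Ck k.+1 phi ->
  vanishes_at k phi mu ->
  (t ^+ k)^-1 * phi (mu, t *: v) @[t --> (0 : R)^'] -->
  (k`!%:R)^-1 * Ds_eta (nseq k v) phi (mu, 0).
Proof.
move=> cphi van.
pose f j (t : R) := Ds_eta (nseq j v) phi (mu, t *: v).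
have lineE (g : V -> R) t : g (mu, t *: v) = g ((mu, 0) + t *: ((0, v) : V)).
  by congr g; congr pair; rewrite /= ?scaler0 ?addr0 ?add0r.
have df j t : (j <= k)%N -> is_derive t (1 : R) (f j) (f j.+1 t).
  move=> jk; have cD : Ck 1 (Ds_eta (nseq j v) phi).
    by apply: Ck_Ds; rewrite size_map size_nseq addn1; exact: Ck_le cphi.
  rewrite /f (_ : (fun t => _) = fun t => Ds_eta (nseq j v) phi ((mu, 0) + t *: ((0, v) : V))).
    by rewrite [X in is_derive _ _ _ X]lineE; apply: is_derive_line; exact: Ck_derivable cD.
  by apply/funext => s; exact: lineE.
have f0 j : f j 0 = Ds_eta (nseq j v) phi (mu, 0) by rewrite /f scale0r.
rewrite -f0; apply: (@peano_limit _ k f 1 ltr01).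
- by move=> j t jk _; apply: df; exact: ltnW.
- apply/differentiable_continuous/derivable1_diffP.
  exact: (@ex_derive _ _ _ _ _ _ _ (df 0%N 0 (leq0n k))).
- by move=> j jk; rewrite f0; apply: van; rewrite size_nseq.
Qed.

Lemma enormZ (c : R) (v : 'rV[R]_n) : 0 <= c -> enorm (c *: v) = c * enorm v.
Proof.
move=> c0; rewrite /enorm (_ : dot (c *: v) (c *: v) = c ^+ 2 * dot v v).
  by rewrite sqrtrM ?sqr_ge0 // sqrtr_sqr ger0_norm.
by rewrite /dot mulr_sumr; apply: eq_bigr => i _; rewrite !mxE; ring.
Qed.

Lemma enorm_gt0 (v : 'rV[R]_n) : v != 0 -> 0 < enorm v.
Proof. by move=> v0; rewrite sqrtr_gt0 dot_gt0. Qed.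

Lemma sphere_normalize (v : 'rV[R]_n) : v != 0 -> sphere ((enorm v)^-1 *: v).
Proof.
move=> /enorm_gt0 v0; rewrite /sphere /= enormZ ?invr_ge0 ?ltW //.
by rewrite mulVf // gt_eqF.
Qed.

Variables (B : V -> 'M[R]_n) (lam : R) (k : nat).
Hypotheses (cB : forall i j, Ck k.+1 (fun z => B z i j))
  (van : forall i j, vanishes_at k (fun z => B z i j) lam)
  (lim0 : forall om, sphere om -> forall i,
    \sum_j (t ^+ k)^-1 * B (lam, t *: om) i j * om 0 j @[t --> (0 : R)^'] --> (0 : R)).

(** Order 0 comes before any common eigenbasis, whose construction presupposes this equality. Taking
    the j-th basis vector for omega isolates column j. *)
Lemma coefficient_eq0 i j : k = 0%N -> B (lam, 0) i j = 0.
Proof.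
move=> k0; pose om : 'rV[R]_n := delta_mx 0 j.
have som : sphere om.
  rewrite /sphere /= /enorm /dot (bigD1 j) //= big1 => [|q qj].
    by rewrite !mxE !eqxx mulr1 addr0 sqrtr1.
  by rewrite !mxE (negPf qj) mulr0.
have H := lim0 som i.
have cBij : continuous (fun z => B z i j) := Ck_continuous (@cB i j).
have Hc : B (lam, t *: om) i j @[t --> (0 : R)^'] --> B (lam, 0) i j.
  apply: (@cvg_coefficient _ _ _ _ _ (fun z => B z i j) (fun=> lam) (fun t => t *: om)) => //.
    exact: cvg_cst.
  move=> q; rewrite (_ : (fun t => _) = (fun t => t * om 0 q)); last first.
    by apply/funext => t; rewrite mxE.
  rewrite [X in _ --> X]mxE -[X in _ --> X](mul0r (om 0 q)).
  by apply: cvgM; [exact: cvg_id_dnbhs0 | exact: cvg_cst].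
have E : (fun t => \sum_j (t ^+ k)^-1 * B (lam, t *: om) i j * om 0 j) =
    (fun t => B (lam, t *: om) i j).
  apply/funext => t; rewrite (bigD1 j) //= big1 => [|q qj].
    by rewrite k0 expr0 invr1 !mxE !eqxx mulr1 mul1r addr0.
  by rewrite !mxE (negPf qj) mulr0.
rewrite E in H.
exact: (cvg_unique (@Rhausdorff R) Hc H).
Qed.

Variable U : 'M[R]_n.
Hypotheses (UU : U^T *m U = 1%:M) (UU' : U *m U^T = 1%:M)
  (offdiag : forall eta i j, i != j -> (U^T *m B (lam, eta) *m U) i j = 0).

(** U is fixed while z varies, so this is one linear combination of the entries of B for all z, and
    derivatives pass through it. [offdiag] makes it an eigenvalue of B only at mu = lam. *)
Definition eigen (i : 'I_n) (z : V) : R :=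
  \sum_(p : 'I_n * 'I_n) (U p.1 i * U p.2 i) * B z p.1 p.2.

Lemma eigenE i z : eigen i z = (U^T *m B z *m U) i i.
Proof.
rewrite !mxE /eigen -(pair_bigA _ (fun r s => U r i * U s i * B z r s)) /=.
rewrite exchange_big; apply: eq_bigr => s _ /=; rewrite !mxE mulr_suml.
by apply: eq_bigr => r _; rewrite !mxE; ring.
Qed.

Lemma eigen_apply i eta om :
  \sum_r U r i * \sum_s B (lam, eta) r s * om 0 s
  = eigen i (lam, eta) * \sum_s U s i * om 0 s.
Proof.
transitivity ((U^T *m (B (lam, eta) *m om^T)) i 0).
  by rewrite mxE; apply: eq_bigr => r _; rewrite !mxE; congr (_ * _);
     apply: eq_bigr => s _; rewrite !mxE.
have -> : U^T *m (B (lam, eta) *m om^T) =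
    U^T *m B (lam, eta) *m U *m (U^T *m om^T).
  by rewrite -!mulmxA (mulmxA U) UU' mul1mx.
rewrite mxE (bigD1 i) //= big1 => [|j ji].
  rewrite addr0 eigenE; congr (_ * _); rewrite mxE.
  by apply: eq_bigr => s _; rewrite !mxE.
by rewrite offdiag 1?eq_sym // mul0r.
Qed.

Lemma eigen_decomp eta r s :
  B (lam, eta) r s = \sum_i (U r i * U s i) * eigen i (lam, eta).
Proof.
have E : B (lam, eta) = U *m (U^T *m B (lam, eta) *m U) *m U^T.
  by rewrite !mulmxA UU' mul1mx -mulmxA UU' mulmx1.
rewrite [in LHS]E mxE; apply: eq_bigr => i _.
rewrite mxE (bigD1 i) //= big1 => [|j ji].
  by rewrite addr0 -eigenE !mxE; ring.
by rewrite offdiag // mulr0.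
Qed.

Lemma eigen_Ck i : Ck k.+1 (eigen i).
Proof. by apply: Ck_sum => p; apply: CkZ. Qed.

Lemma Ds_eta_eigen vs i z : (size vs <= k.+1)%N -> Ds_eta vs (eigen i) z =
  \sum_(p : 'I_n * 'I_n) (U p.1 i * U p.2 i) * Ds_eta vs (fun z => B z p.1 p.2) z.
Proof.
move=> vk; rewrite /Ds_eta /eigen Ds_sum // => p.
by rewrite size_map; exact: (Ck_le vk (@cB p.1 p.2)).
Qed.

Lemma eigen_vanishes i : vanishes_at k (eigen i) lam.
Proof.
move=> vs vk; rewrite Ds_eta_eigen; last by apply: leqW; exact: ltnW.
by rewrite big1 // => p _; rewrite van ?mulr0.
Qed.

Lemma eigen_limit i om : sphere om ->
  (t ^+ k)^-1 * eigen i (lam, t *: om) * \sum_s U s i * om 0 s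
    @[t --> (0 : R)^'] --> (0 : R).
Proof.
move=> som.
have H : \sum_r U r i * (\sum_j (t ^+ k)^-1 * B (lam, t *: om) r j * om 0 j)
    @[t --> (0 : R)^'] --> \sum_r U r i * 0.
  by apply: cvg_sum_fin => r; apply: cvgMr; exact: lim0.
have E0 : \sum_r U r i * 0 = 0 by rewrite big1 // => r _; rewrite mulr0.
rewrite E0 in H; apply: (@near_dnbhs_cvg _ _ _ _ _ _ H) => t t0.
rewrite -mulrA -eigen_apply mulr_sumr; apply: eq_bigr => r _.
rewrite mulrCA; congr (_ * _); rewrite mulr_sumr; apply: eq_bigr => j _.
by rewrite mulrA.
Qed.

(** The limit is known for unit vectors only; homogeneity of both factors in v extends the identity
    to all v. *)
Lemma eigen_diagonal i (v : 'rV[R]_n) :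
  Ds_eta (nseq k v) (eigen i) (lam, 0) * \sum_s U s i * v 0 s = 0.
Proof.
have [->|v0] := eqVneq v 0.
  by rewrite [X in _ * X]big1 ?mulr0 // => s _; rewrite mxE mulr0.
pose om := (enorm v)^-1 *: v.
have som : sphere om := sphere_normalize v0.
have H := eigen_limit i som.
have K1 : (t ^+ k)^-1 * eigen i (lam, t *: om) @[t --> (0 : R)^'] -->
    (k`!%:R)^-1 * Ds_eta (nseq k om) (eigen i) (lam, 0).
  by apply: Ds_eta_radial_limit; [exact: eigen_Ck | exact: eigen_vanishes].
have K : (t ^+ k)^-1 * eigen i (lam, t *: om) * (\sum_s U s i * om 0 s) @[t --> (0 : R)^'] -->
    (k`!%:R)^-1 * Ds_eta (nseq k om) (eigen i) (lam, 0) * \sum_s U s i * om 0 s.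
  by apply: cvgM; [exact: K1 | exact: cvg_cst].
have : (k`!%:R)^-1 * Ds_eta (nseq k om) (eigen i) (lam, 0) * \sum_s U s i * om 0 s = 0.
  exact: (cvg_unique (@Rhausdorff R) K H).
have vE : v = enorm v *: om by rewrite scalerA mulfV ?scale1r // gt_eqF // enorm_gt0.
move/eqP; rewrite !mulf_eq0 invr_eq0 pnatr_eq0 eqn0Ngt fact_gt0 /= => K0.
have DE : Ds_eta (nseq k v) (eigen i) (lam, 0)
    = enorm v ^+ k * Ds_eta (nseq k om) (eigen i) (lam, 0).
  rewrite {1}vE /Ds_eta !map_nseq.
  have -> : ((0, enorm v *: om) : V) = enorm v *: (0, om).
    by congr pair; rewrite /= scaler0.
  by rewrite Ds_nseq_scale //; exact: CkW (@eigen_Ck i).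
have LE : \sum_s U s i * v 0 s = enorm v * \sum_s U s i * om 0 s.
  by rewrite {1}vE mulr_sumr; apply: eq_bigr => s _; rewrite mxE mulrCA.
rewrite DE LE; case/orP: K0 => /eqP ->; by rewrite !(mulr0, mul0r).
Qed.

Lemma eigen_Ds0 i vs : size vs = k -> Ds_eta vs (eigen i) (lam, 0) = 0.
Proof.
move=> vk.
(* The i-th column of U pairs to 1 with itself and so lies off the hyperplane. *)
apply: (@polarization_off_hyperplane _ _ k (fun vs => Ds_eta vs (eigen i) (lam, 0))
  (fun v => \sum_s U s i * v 0 s) (\row_s U s i)) => //.
- by apply: Ds_eta_multilinear; exact: CkW (@eigen_Ck i).
- move=> u v c; rewrite mulr_sumr -big_split; apply: eq_bigr => s _ /=.
  by rewrite !mxE; ring.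
- have E : \sum_s U^T i s * U s i = 1.
    by have := congr1 (fun M : 'M[R]_n => M i i) UU; rewrite !mxE eqxx.
  rewrite (_ : \sum_s _ = 1) ?oner_neq0 // -[RHS]E.
  by apply: eq_bigr => s _; rewrite !mxE.
- exact: eigen_diagonal.
Qed.

Lemma Ds_eta_eq0 r s vs : size vs = k -> Ds_eta vs (fun z => B z r s) (lam, 0) = 0.
Proof.
move=> vk.
(* The decomposition holds for mu = lam only, which suffices because every direction of
   differentiation is of the form (0, v). *)
rewrite (@Ds_eta_ext _ (fun z => \sum_i (U r i * U s i) * eigen i z)); last first.
  by move=> eta; exact: eigen_decomp.
rewrite /Ds_eta Ds_sum; last first.
  by move=> i; rewrite size_map vk; exact: CkW (@eigen_Ck i).
by rewrite big1 // => i _; rewrite -/(Ds_eta _ _) eigen_Ds0 ?mulr0.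
Qed.

End OrderStep.

(** * Endpoints of the parameter interval, inversion of the normals, and conclusion *)

Lemma DsB (R : realType) (V : normedModType R) (vs : seq V) (f g : V -> R) :
  Ck (size vs) f -> Ck (size vs) g ->
  Ds vs (fun x => f x - g x) = fun x => Ds vs f x - Ds vs g x.
Proof.
elim: vs => [|v vs IH] // cf cg; rewrite [LHS]/= -/(Ds _ _) IH; [|exact: CkW cf|exact: CkW cg].
apply/funext => x; apply: (@deriveB _ _ _ (Ds vs f) (Ds vs g)).
  by apply: (@Ck_derivable _ _ 0); apply: Ck_Ds; rewrite addn1.
by apply: (@Ck_derivable _ _ 0); apply: Ck_Ds; rewrite addn1.
Qed.

Lemma eq0_on_closed_itv (R : realType) (f : R -> R) (r : R) : 0 < r -> continuous f ->
  (forall x, - r < x < r -> f x = 0) -> forall x, - r <= x <= r -> f x = 0.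
Proof.
move=> r0 cf f0 x xr.
(* For 0 < |t| < 1 this point lies in the open interval whatever the sign of x, so one limit reaches
   both endpoints. *)
have H : f (x * (1 - t ^+ 2)) @[t --> (0 : R)^'] --> f x.
  apply: (@cvg_comp _ _ _ (fun t => x * (1 - t ^+ 2)) f _ (nbhs x)); last exact: cf.
  have : x * (1 - t ^+ 2) @[t --> (0 : R)^'] --> x * (1 - 0 ^+ 2).
    apply: cvgMr; apply: cvgB; first exact: cvg_cst.
    by apply: cvg_exp; exact: cvg_id_dnbhs0.
  by rewrite expr0n subr0 mulr1.
have Z : (fun=> 0 : R) t @[t --> (0 : R)^'] --> f x.
  apply: cvg_near_eq H.
  have n1 : \forall t \near (0 : R)^', t != 0 by exact: withinT.
  have n2 : \forall t \near (0 : R)^', `|t| < 1 by exact: dnbhs0_lt.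
  apply: filterS2 n1 n2 => t t0 t1; apply/esym/f0.
  rewrite -ltr_norml normrM.
  have t2 : 0 < t ^+ 2 by rewrite exprn_even_gt0.
  have t21 : t ^+ 2 < 1 by rewrite -[t ^+ 2]ger0_norm ?ltW // normrX exprn_ilt1.
  have xr' : `|x| <= r by rewrite ler_norml.
  rewrite [X in _ * X]ger0_norm; last by rewrite subr_ge0 ltW.
  apply: (@le_lt_trans _ _ (r * (1 - t ^+ 2))).
    by apply: ler_wpM2r => //; rewrite subr_ge0; exact: ltW.
  by rewrite -[ltRHS]mulr1 ltr_pM2l // ltrBlDr ltrDl.
exact: (cvg_unique (@Rhausdorff R) Z (cvg_cst (0 : R))).
Qed.

Lemma cvg_unitmx_components (R : realType) n (N : 'M[R]_n) (G : 'I_n -> R -> R) :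
  N \in unitmx ->
  (forall q, \sum_i N q i * G i t @[t --> (0 : R)^'] --> (0 : R)) ->
  forall i, G i t @[t --> (0 : R)^'] --> (0 : R).
Proof.
move=> uN H i.
have K : \sum_q invmx N i q * (\sum_j N q j * G j t) @[t --> (0 : R)^'] -->
    \sum_q invmx N i q * 0.
  by apply: cvg_sum_fin => q; apply: cvgMr; exact: H.
have E0 : \sum_q invmx N i q * 0 = 0 by rewrite big1 // => q _; rewrite mulr0.
rewrite E0 in K; apply: (@near_dnbhs_cvg _ _ _ _ _ _ K) => t _.
have := congr1 (fun M : 'cV[R]_n => M i 0) (mulKmx uN (\col_j G j t)).
rewrite !mxE => <-; apply: eq_bigr => q _; congr (_ * _).
by rewrite mxE; apply: eq_bigr => j _; rewrite mxE.
Qed.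

Theorem theorem2p1 (R : realType) (n : nat) (hn : (2 <= n)%N)
  (al : R) (hal : 0 < al < 1)
  (Om : set 'rV[R]_n) (hOm : bounded_domain Om) (hbd : C2al_boundary Om al)
  (nu : 'rV[R]_n -> 'rV[R]_n)
  (hnu : forall x, boundary Om x -> outward_unit_normal Om x (nu x))
  (l : nat) (hl : (1 <= l)%N)
  (a1 a2 : R * 'rV[R]_n -> 'M[R]_n)
  (ha1 : admissible_coef l a1) (ha2 : admissible_coef l a2)
  (e' : 'I_n -> 'rV[R]_n) (he' : orthonormal_basis e')
  (x : 'I_n -> 'rV[R]_n) (hx : forall k, boundary Om (x k))
  (hxe : forall k, enorm (nu (x k) - e' k) < 1 / Num.sqrt n%:R)
  (eps : R -> R)
  (heps : forall lam : R, [/\ 0 < eps lam,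
                          wellposed_radius Om al a1 l lam (eps lam) &
                          wellposed_radius Om al a2 l lam (eps lam)])
  (r : R) (hr : 0 < r)
  (u1 u2 : R -> 'rV[R]_n -> R -> 'rV[R]_n -> R)
  (hu1 : forall (lam : R) (om : 'rV[R]_n) (tau : R), - r <= lam <= r -> sphere om ->
    - eps lam < tau < eps lam ->
    unique_solution Om al a1 lam om tau (u1 lam om tau))
  (hu2 : forall (lam : R) (om : 'rV[R]_n) (tau : R), - r <= lam <= r -> sphere om ->
    - eps lam < tau < eps lam ->
    unique_solution Om al a2 lam om tau (u2 lam om tau))
  (e : R -> R) (he : forall lam : R, - r <= lam <= r -> 0 < e lam < eps lam)
  (hflux : forall (lam : R) (om : 'rV[R]_n) (tau : R) (k : 'I_n),
    - r <= lam <= r -> sphere om ->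
    - e lam < tau < e lam ->
    conormal_flux Om a1 nu (u1 lam om tau) (x k)
    = conormal_flux Om a2 nu (u2 lam om tau) (x k)) :
  forall (lam : R) (k : nat), - r <= lam <= r -> (k <= l.-1)%N ->
  D_eta k a1 lam 0 = D_eta k a2 lam 0.
Proof.
have n0 : (0 < n)%N by exact: leq_trans hn.
have [neOm oOm _ bOm] := hOm.
case: l hl ha1 ha2 heps => [//|l'] _ {}ha1 {}ha2 {}heps.
have [+ _ _ sa1] := ha1; have [+ _ _ sa2] := ha2; rewrite !add2n => ca2 ca1.
have c1 j i q : (j <= l'.+3)%N -> Ck j (fun z => a1 z i q).
  by move=> jl; exact: (Ck_le jl (Ck_coord i q ca1)).
have c2 j i q : (j <= l'.+3)%N -> Ck j (fun z => a2 z i q).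
  by move=> jl; exact: (Ck_le jl (Ck_coord i q ca2)).
pose N : 'M[R]_n := \matrix_(q, i) nu (x q) 0 i.
have uN : N \in unitmx := near_orthonormal_unitmx n0 he' hxe.
pose b i j (z : R * 'rV[R]_n) : R := a1 z i j - a2 z i j.
have cb j i q : (j <= l'.+3)%N -> Ck j (b i q).
  by move=> jl; apply: CkB; [exact: c1 | exact: c2].
suff main k : (k <= l')%N -> forall lam : R, - r <= lam <= r ->
    forall i j vs, size vs = k -> Ds_eta vs (b i j) (lam, 0) = 0.
  move=> lam k lamr kl; apply/funext => vs; apply/matrixP => i j.
  have kl3 : (k <= l'.+3)%N by do 3 apply: leqW.
  rewrite !D_etaE; [|by move=> p q; exact: c2|by move=> p q; exact: c1].
  apply/eqP; rewrite -subr_eq0; apply/eqP.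
  have szvs : size vs = k by rewrite size_tuple.
  rewrite -[RHS](main k kl lam lamr i j vs szvs) /Ds_eta DsB //; rewrite size_map szvs.
    exact: c1.
  exact: c2.
elim/ltn_ind: k => k IH kl.
have kl2 : (k.+2 <= l'.+3)%N by apply: leqW.
have kl1 : (k.+1 <= l'.+3)%N by apply: ltnW.
(* The induction hypothesis holds on [-r, r]; only for interior [lam] does it give vanishing on a
   full neighbourhood. The endpoints follow by continuity in mu. *)
suff int (lam : R) : - r < lam < r ->
    forall i j vs, size vs = k -> Ds_eta vs (b i j) (lam, 0) = 0.
  move=> lam lamr i j vs vk.
  apply: (eq0_on_closed_itv hr _ _ lamr (f := fun mu => Ds_eta vs (b i j) (mu, 0))).
    move=> mu; apply: (@cvg_coefficient _ _ _ _ _ _ id (fun=> 0)).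
    - apply: (@Ck_continuous _ _ 0); apply: Ck_Ds.
      by rewrite size_map vk addn0; apply: cb; apply: ltnW.
    - exact: cvg_id.
    - by move=> q; exact: cvg_cst.
  by move=> mu mur; exact: int.
move=> lamr; have lamr' : - r <= lam <= r by move: lamr => /andP[? ?]; rewrite !ltW.
have [eps0 wp1 wp2] := heps lam.
have /andP[e0 eeps] := he lam lamr'.
have van i j : \forall mu \near lam, vanishes_at k (b i j) mu.
  have d0 : 0 < Num.min (lam + r) (r - lam).
    by move: lamr => /andP[? ?]; rewrite lt_min; apply/andP; split; lra.
  apply/(@nbhs_ballP _ R); exists (Num.min (lam + r) (r - lam)) => // mu.
  rewrite /ball /= lt_min !ltr_norml => /andP[/andP[? ?] /andP[? ?]] vs vk.
  by apply: (IH _ vk (leq_trans (ltnW vk) kl)) => //; apply/andP; split; lra.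
have lim0 om : sphere om -> forall i,
    \sum_j (t ^+ k)^-1 * b i j (lam, t *: om) * om 0 j @[t --> (0 : R)^'] --> (0 : R).
  move=> som.
  have [w1 tw1 wu1] := tower_exists oOm eps0 wp1 som
    (fun t te => hu1 lam om t lamr' som te).
  have [w2 tw2 wu2] := tower_exists oOm eps0 wp2 som
    (fun t te => hu2 lam om t lamr' som te).
  apply: (cvg_unitmx_components uN) => q.
  have [bx _] := hx q.
  have := @tower_flux _ _ Om al n0 oOm neOm bOm a1 a2 l' lam om (eps lam) w1 w2 k tw1 tw2
    (fun i j => c1 k.+2 i j kl2) (fun i j => c2 k.+2 i j kl2)
    (ex_intro (spectral_form^~ a1) _ sa1) (ex_intro (spectral_form^~ a2) _ sa2)
    kl van nu (x q) (e lam) e0 bx.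
  (* The flux hypothesis concerns the given solutions; it transfers to the towers, which agree with
     them on the closure. *)
  have flux t : `|t| < e lam ->
      conormal_flux Om a1 nu (w1 0%N t) (x q) = conormal_flux Om a2 nu (w2 0%N t) (x q).
    move=> te; have teps : `|t| < eps lam := lt_trans te eeps.
    have [_ _ C1 _ _] := tw1; have [_ _ C2 _ _] := tw2.
    have [_ _ _ h1 _] := C1 t 0%N teps (leq0n _).
    have [_ _ _ h2 _] := C2 t 0%N teps (leq0n _).
    rewrite (conormal_flux_ext oOm _ _ h1 bx (fun y cy => wu1 t y teps cy)).
    rewrite (conormal_flux_ext oOm _ _ h2 bx (fun y cy => wu2 t y teps cy)).
    by apply: hflux => //; rewrite -ltr_norml.
  move=> /(_ flux) H; apply: (@near_dnbhs_cvg _ _ _ _ _ _ H) => t _.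
  by apply: eq_bigr => i _; rewrite mxE.
pose B (z : R * 'rV[R]_n) : 'M[R]_n := a1 z - a2 z.
have BE i j : (fun z => B z i j) = b i j by apply/funext => z; rewrite !mxE.
have cB i j : Ck k.+1 (fun z => B z i j) by rewrite BE; exact: cb.
have vanB i j : vanishes_at k (fun z => B z i j) lam.
  by rewrite BE; exact: (nbhs_singleton (van i j)).
have limB om : sphere om -> forall i,
    \sum_j (t ^+ k)^-1 * B (lam, t *: om) i j * om 0 j @[t --> (0 : R)^'] --> (0 : R).
  move=> som i; have H := lim0 om som i.
  apply: (@near_dnbhs_cvg _ _ _ _ _ _ H) => t _.
  by apply: eq_bigr => j _; congr (_ * _ * _); rewrite -BE.
move=> i j vs vk; rewrite -BE.
(* For k > 0 the induction hypothesis at order 0 gives a1(lam, 0) = a2(lam, 0), on which the common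
   eigenbasis rests. *)
have [k0|k0] := posnP k.
  move: vk; rewrite {1}k0 => /size0nil ->.
  exact: (coefficient_eq0 cB limB i j k0).
have a12 : a1 (lam, 0) = a2 (lam, 0).
  apply/matrixP => p q; apply/eqP; rewrite -subr_eq0; apply/eqP.
  exact: (IH 0%N k0 (leq0n _) lam lamr' p q [::]).
have [U [UU UU' off]] := common_eigenbasis sa1 sa2 a12.
exact: (Ds_eta_eq0 cB vanB limB UU UU' off).
Qed.
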